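(* Let $p,q\in\mathbb D^2$ be two distinct points. Then $$c_{\mathbb D^2}(z;p,q)=l_{\mathbb D^2}(z;p,q)\quad\text{for all } z\in\mathbb D^2 .$$
   Context: $\mathbb D$ denotes the open unit disc in $\mathbb C$ and $\mathbb D^2$ the bidisc. For a domain $D\subset\mathbb C^n$, pairwise distinct poles $p_1,\dots,p_N\in D$ and $z\in D$: the Lempert function (with all weights equal to $1$) is $l_D(z;p_1,\dots,p_N):=\inf\{\sum_{j=1}^N\log|\lambda_j|\}$, the infimum taken over all holomorphic $\psi:\mathbb D\to D$ and $\lambda_1,\dots,\lambda_N\in\mathbb D$ with $\psi(0)=z$ and $\psi(\lambda_j)=p_j$, $j=1,\dots,N$; the Carathéodory function is $c_D(z;p_1,\dots,p_N):=\sup\{\log|F(z)| : F:D\to\mathbb D \text{ holomorphic},\ F(p_j)=0,\ j=1,\dots,N\}$. *)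

(* Defs.v *)
From Stdlib Require Import Reals.
Open Scope R_scope.

Definition Cx : Type := (R * R)%type.
Definition Cre (z : Cx) : R := fst z.
Definition Cim (z : Cx) : R := snd z.
Definition C0 : Cx := (0, 0).
Definition Cadd (z w : Cx) : Cx := (fst z + fst w, snd z + snd w).
Definition Copp (z : Cx) : Cx := (- fst z, - snd z).
Definition Csub (z w : Cx) : Cx := Cadd z (Copp w).
Definition Cmul (z w : Cx) : Cx :=
  (fst z * fst w - snd z * snd w, fst z * snd w + snd z * fst w).
Definition Cabs (z : Cx) : R := sqrt (fst z * fst z + snd z * snd z).

Definition inD (z : Cx) : Prop := Cabs z < 1.
Definition inD2 (z : Cx * Cx) : Prop := inD (fst z) /\ inD (snd z).

Definition C_differentiable_at (f : Cx -> Cx) (a : Cx) : Prop :=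
  exists d : Cx, forall eps : R, 0 < eps -> exists delta : R, 0 < delta /\
    forall h : Cx, Cabs h < delta ->
      Cabs (Csub (Csub (f (Cadd a h)) (f a)) (Cmul d h)) <= eps * Cabs h.

Definition holo_D_D2 (psi : Cx -> Cx * Cx) : Prop :=
  forall a : Cx, inD a ->
    inD2 (psi a) /\
    C_differentiable_at (fun l => fst (psi l)) a /\
    C_differentiable_at (fun l => snd (psi l)) a.

Definition C2abs (h : Cx * Cx) : R := Rmax (Cabs (fst h)) (Cabs (snd h)).

Definition C2_differentiable_at (F : Cx * Cx -> Cx) (a : Cx * Cx) : Prop :=
  exists d1 d2 : Cx, forall eps : R, 0 < eps -> exists delta : R, 0 < delta /\
    forall h : Cx * Cx, C2abs h < delta ->
      Cabs (Csub (Csub (F (Cadd (fst a) (fst h), Cadd (snd a) (snd h))) (F a))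
                 (Cadd (Cmul d1 (fst h)) (Cmul d2 (snd h))))
        <= eps * C2abs h.

Definition holo_D2_D (F : Cx * Cx -> Cx) : Prop :=
  forall a : Cx * Cx, inD2 a -> inD (F a) /\ C2_differentiable_at F a.

Inductive ER : Type := Fin (r : R) | MInf.

Definition ER_le (x y : ER) : Prop :=
  match x, y with
  | MInf, _ => True
  | Fin _, MInf => False
  | Fin a, Fin b => a <= b
  end.

Definition logE (x : R) : ER := if Req_EM_T x 0 then MInf else Fin (ln x).

Definition is_supE (S : ER -> Prop) (v : ER) : Prop :=
  (forall x, S x -> ER_le x v) /\ (forall u, (forall x, S x -> ER_le x u) -> ER_le v u).
Definition is_infE (S : ER -> Prop) (v : ER) : Prop :=
  (forall x, S x -> ER_le v x) /\ (forall u, (forall x, S x -> ER_le u x) -> ER_le u v).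

(* set of values sum_j log|lambda_j| over admissible discs *)
Definition lempert_set (z p q : Cx * Cx) (t : ER) : Prop :=
  exists (psi : Cx -> Cx * Cx) (l1 l2 : Cx),
    holo_D_D2 psi /\ inD l1 /\ inD l2 /\
    psi C0 = z /\ psi l1 = p /\ psi l2 = q /\
    t = logE (Cabs l1 * Cabs l2).

Definition cara_set (z p q : Cx * Cx) (t : ER) : Prop :=
  exists F : Cx * Cx -> Cx,
    holo_D2_D F /\ F p = C0 /\ F q = C0 /\ t = logE (Cabs (F z)).

Definition lempert_is (z p q : Cx * Cx) (v : ER) : Prop := is_infE (lempert_set z p q) v.
Definition cara_is (z p q : Cx * Cx) (v : ER) : Prop := is_supE (cara_set z p q) v.

(* Main.v *)
(* Both sides are compared through explicit objects. Normalise [z = 0] by automorphisms.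
   A disc through [0], [p], [q] with parameters [l], [m] exists as soon as both coordinate
   Nevanlinna-Pick problems [0 -> 0], [l -> p_j], [m -> q_j] are solvable; minimise [|l m|]
   over all such pairs. At a minimum in the open bidisc the tight coordinates are interpolated,
   up to rotation, by [x (x + al_j) / (1 + al_j~ x)], and the first order condition says that the
   parameter [al*] for which this product takes equal values at [l] and [m] is a convex
   combination [t al_1 + (1 - t) al_2]. For suitable unimodular [v], [k_1], [k_2] the function
   [v - 1 / (t / (v - x / k_1) + (1 - t) / (v - y / k_2))] then restricts to the disc as the product
   with parameter [al*], so it takes the value [- l m] at [p] and at [q]; composed with a Moebius
   map it vanishes at [p] and [q] and has modulus [|l m|] at [0]. The minimum can escape to
   [|l| = 1] or [|m| = 1] only in degenerate cases; those where the two coordinates of [p] or of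
   [q] have equal modulus, for which the infimum need not be attained, are reached by scaling the
   first coordinate. The inequality between the two functions is the Schwarz lemma with two
   zeros, obtained from Goursat's theorem. *)

Require Import Defs.
From Stdlib Require Import Reals Lra Psatz ClassicalEpsilon.
From Coquelicot Require Import Coquelicot.
Open Scope R_scope.

(** * Complex differentiability *)

(** Holomorphy means pointwise complex differentiability, with no continuity of the derivative;
    every estimate therefore rests on one consequence of Goursat, that the value at 0 is bounded by
    the values on a circle. Dividing a function by its Blaschke product would require removing
    singularities, so [f] times the [n]-th power of that quotient is estimated instead and [n] tends
    to infinity. The weight [t] comes from separation in the plane: each tight coordinate
    contributes the real linear functional given by [al_j - al*], and if some direction were
    positive on both, [|l m|] could be decreased. The shape of the extremal function comes from a
    half-plane: [w -> 1 / (1 - w)] maps the disc onto a convex set, so averages taken there are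
    admissible, and [v] is chosen so that the two averaged fractions share their denominator;
    averaging them then averages the parameters. Scaling is outward, by [d > 1]: a disc through the
    scaled poles is shrunk back at no cost, and only the function, which now vanishes near the poles
    instead of at them, needs a correction. *)

Lemma Cabs_Cmod (z : Cx) : Cabs z = Cmod z.
Proof. unfold Cabs, Cmod. f_equal. ring. Qed.

Lemma Cplus_minus_r (a z : C) : (a + (z - a))%C = z.
Proof. ring. Qed.

Lemma Cplus_minus_l (a h : C) : (a + h - a)%C = h.
Proof. ring. Qed.

Lemma Cminus_eq0 (a b : C) : (a - b)%C = 0%C -> a = b.
Proof. intro E. replace a with (a - b + b)%C by ring. rewrite E. ring. Qed.

(* The metric structure of C given by [Cmod]; the canonical one of [R * R] is the product structure. *)
Notation CU := (AbsRing_UniformSpace C_AbsRing).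
Notation CU2 := (prod_UniformSpace CU CU).
Notation contC U f a := (@continuous U CU f a).

Lemma continuous_C_plus (U : UniformSpace) (f g : U -> C) (a : U) :
  contC U f a -> contC U g a -> contC U (fun z => (f z + g z)%C) a.
Proof.
  intros Hf Hg.
  exact (continuous_plus (U := U) (V := AbsRing_NormedModule C_AbsRing) f g a Hf Hg).
Qed.

Lemma continuous_C_mult (U : UniformSpace) (f g : U -> C) (a : U) :
  contC U f a -> contC U g a -> contC U (fun z => (f z * g z)%C) a.
Proof. intros Hf Hg. exact (continuous_mult (U := U) (K := C_AbsRing) f g a Hf Hg). Qed.

Lemma continuous_C_opp (U : UniformSpace) (f : U -> C) (a : U) :
  contC U f a -> contC U (fun z => (- f z)%C) a.
Proof. intros Hf. exact (continuous_opp (U := U) (V := AbsRing_NormedModule C_AbsRing) f a Hf). Qed.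

Lemma continuous_C_minus (U : UniformSpace) (f g : U -> C) (a : U) :
  contC U f a -> contC U g a -> contC U (fun z => (f z - g z)%C) a.
Proof. intros Hf Hg. apply continuous_C_plus; [exact Hf | now apply continuous_C_opp]. Qed.

Lemma ball_CU (a : C) (e : R) (z : C) : ball (a : CU) e z <-> Cmod (z - a) < e.
Proof. split; intro H; exact H. Qed.

Lemma continuous_C_eps (U : UniformSpace) (f : U -> C) (a : U) :
  contC U f a <->
  forall eps : R, 0 < eps -> locally a (fun z => Cmod (f z - f a) < eps).
Proof.
  unfold continuous. rewrite filterlim_locally. split.
  - intros H e He. exact (H (mkposreal e He)).
  - intros H e. exact (H e (cond_pos e)).
Qed.

Lemma continuous_C_neq0 (U : UniformSpace) (f : U -> C) (a : U) :
  contC U f a -> f a <> 0%C -> locally a (fun z => f z <> 0%C).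
Proof.
  intros Hf Ha. apply Cmod_gt_0 in Ha.
  generalize (proj1 (continuous_C_eps U f a) Hf _ Ha). apply filter_imp.
  intros z Hz Hz0. rewrite Hz0 in Hz.
  replace (0 - f a)%C with (- f a)%C in Hz by ring. rewrite Cmod_opp in Hz. lra.
Qed.

Lemma continuous_C_inv (U : UniformSpace) (f : U -> C) (a : U) :
  contC U f a -> f a <> 0%C -> contC U (fun z => (/ f z)%C) a.
Proof.
  intros Hf Ha. apply continuous_C_eps. intros e He.
  set (m := Cmod (f a)). assert (Hm : 0 < m) by now apply Cmod_gt_0.
  assert (Hd : 0 < Rmin (m / 2) (e * m * m / 2)).
  { apply Rmin_pos; [lra |]. apply Rmult_lt_0_compat; [|lra].
    repeat apply Rmult_lt_0_compat; lra. }
  generalize (proj1 (continuous_C_eps U f a) Hf _ Hd). apply filter_imp.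
  intros z Hz.
  assert (H1 : Cmod (f z - f a) < m / 2) by (eapply Rlt_le_trans; [exact Hz | apply Rmin_l]).
  assert (H2 : Cmod (f z - f a) < e * m * m / 2) by (eapply Rlt_le_trans; [exact Hz | apply Rmin_r]).
  assert (H3 : m / 2 < Cmod (f z)).
  { generalize (Cmod_triangle (f z) (- (f z - f a))).
    replace (f z + - (f z - f a))%C with (f a) by ring.
    rewrite Cmod_opp. fold m. lra. }
  assert (Hz0 : f z <> 0%C) by (apply Cmod_gt_0; lra).
  replace (/ f z - / f a)%C with (- (f z - f a) / (f z * f a))%C by (field; split; assumption).
  rewrite Cmod_div by now apply Cmult_neq_0.
  rewrite Cmod_opp, Cmod_mult. fold m.
  apply Rmult_lt_reg_r with (Cmod (f z) * m); [apply Rmult_lt_0_compat; lra|].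
  unfold Rdiv. rewrite Rmult_assoc, Rinv_l, Rmult_1_r
    by (apply Rgt_not_eq, Rmult_lt_0_compat; lra).
  apply Rlt_le_trans with (1 := H2).
  assert (0 <= e * m) by (apply Rmult_le_pos; lra). nra.
Qed.

(* Caratheodory's form of complex differentiability with respect to two coordinates [x], [y];
   functions of one variable are the case where [y] is constant. *)
Definition dif (U : UniformSpace) (x y F : U -> C) (a : U) : Prop :=
  exists f1 f2 : U -> C, contC U f1 a /\ contC U f2 a /\
    locally a (fun z => F z = (F a + f1 z * (x z - x a) + f2 z * (y z - y a))%C).

Lemma dif_ext_loc (U : UniformSpace) (x y F G : U -> C) (a : U) :
  locally a (fun z => F z = G z) -> dif U x y F a -> dif U x y G a.
Proof.
  intros He (f1 & f2 & H1 & H2 & H). exists f1, f2. split; [exact H1|split; [exact H2|]].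
  assert (Ha := locally_singleton _ _ He). cbv beta in Ha.
  generalize (filter_and _ _ He H). apply filter_imp. intros z [E1 E2].
  now rewrite <- E1, <- Ha.
Qed.

Lemma dif_const (U : UniformSpace) (x y : U -> C) (c : C) (a : U) : dif U x y (fun _ => c) a.
Proof.
  exists (fun _ => RtoC 0), (fun _ => RtoC 0).
  repeat split; try apply continuous_const.
  apply filter_forall. intros z. ring.
Qed.

Lemma dif_fst (U : UniformSpace) (x y : U -> C) (a : U) : dif U x y x a.
Proof.
  exists (fun _ => RtoC 1), (fun _ => RtoC 0).
  repeat split; try apply continuous_const.
  apply filter_forall. intros z. ring.
Qed.

Lemma dif_snd (U : UniformSpace) (x y : U -> C) (a : U) : dif U x y y a.
Proof.
  exists (fun _ => RtoC 0), (fun _ => RtoC 1).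
  repeat split; try apply continuous_const.
  apply filter_forall. intros z. ring.
Qed.

Lemma dif_continuous (U : UniformSpace) (x y F : U -> C) (a : U) :
  contC U x a -> contC U y a -> dif U x y F a ->
  contC U F a.
Proof.
  intros Hx Hy (f1 & f2 & H1 & H2 & H).
  apply (continuous_ext_loc (T := U) (U := CU) F
    (fun z => (F a + f1 z * (x z - x a) + f2 z * (y z - y a))%C : CU) a).
  { revert H. apply filter_imp. intros z Hz. symmetry. exact Hz. }
  apply continuous_C_plus; [apply continuous_C_plus; [apply continuous_const|]|].
  - apply continuous_C_mult; [exact H1|].
    apply continuous_C_minus; [exact Hx | apply continuous_const].
  - apply continuous_C_mult; [exact H2|].
    apply continuous_C_minus; [exact Hy | apply continuous_const].
Qed.

Lemma dif_plus (U : UniformSpace) (x y F G : U -> C) (a : U) :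
  dif U x y F a -> dif U x y G a -> dif U x y (fun z => (F z + G z)%C) a.
Proof.
  intros (f1 & f2 & H1 & H2 & H) (g1 & g2 & K1 & K2 & K).
  exists (fun z => (f1 z + g1 z)%C), (fun z => (f2 z + g2 z)%C).
  split; [now apply continuous_C_plus|split; [now apply continuous_C_plus|]].
  generalize (filter_and _ _ H K). apply filter_imp. intros z [E1 E2].
  rewrite E1, E2. ring.
Qed.

Lemma dif_mult (U : UniformSpace) (x y F G : U -> C) (a : U) :
  contC U x a -> contC U y a ->
  dif U x y F a -> dif U x y G a -> dif U x y (fun z => (F z * G z)%C) a.
Proof.
  intros Hx Hy HF HG. assert (CF := dif_continuous U x y F a Hx Hy HF).
  destruct HF as (f1 & f2 & H1 & H2 & H), HG as (g1 & g2 & K1 & K2 & K).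
  exists (fun z => (f1 z * G a + F z * g1 z)%C), (fun z => (f2 z * G a + F z * g2 z)%C).
  split; [|split].
  1, 2: apply continuous_C_plus; apply continuous_C_mult; try assumption; apply continuous_const.
  generalize (filter_and _ _ H K). apply filter_imp. intros z [E1 E2].
  rewrite E2.
  transitivity (F z * G a + (F z * g1 z * (x z - x a) + F z * g2 z * (y z - y a)))%C; [ring|].
  rewrite E1 at 1. ring.
Qed.

Lemma dif_opp (U : UniformSpace) (x y F : U -> C) (a : U) :
  dif U x y F a -> dif U x y (fun z => (- F z)%C) a.
Proof.
  intros (f1 & f2 & H1 & H2 & H).
  exists (fun z => (- f1 z)%C), (fun z => (- f2 z)%C).
  split; [now apply continuous_C_opp|split; [now apply continuous_C_opp|]].
  revert H. apply filter_imp. intros z E1. rewrite E1. ring.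
Qed.

Lemma dif_minus (U : UniformSpace) (x y F G : U -> C) (a : U) :
  dif U x y F a -> dif U x y G a -> dif U x y (fun z => (F z - G z)%C) a.
Proof. intros HF HG. apply dif_plus; [exact HF | now apply dif_opp]. Qed.

Lemma dif_inv (U : UniformSpace) (x y F : U -> C) (a : U) :
  contC U x a -> contC U y a ->
  F a <> 0%C -> dif U x y F a -> dif U x y (fun z => (/ F z)%C) a.
Proof.
  intros Hx Hy Ha HF. assert (CF := dif_continuous U x y F a Hx Hy HF).
  destruct HF as (f1 & f2 & H1 & H2 & H).
  exists (fun z => (- f1 z * (/ (F z * F a)))%C), (fun z => (- f2 z * (/ (F z * F a)))%C).
  assert (CI : contC U (fun z => (/ (F z * F a))%C) a).
  { apply continuous_C_inv; [|now apply Cmult_neq_0].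
    apply continuous_C_mult; [exact CF | apply continuous_const]. }
  split; [|split].
  1, 2: apply continuous_C_mult; [now apply continuous_C_opp | exact CI].
  generalize (filter_and _ _ H (continuous_C_neq0 U F a CF Ha)). apply filter_imp.
  intros z [E1 E2].
  transitivity (/ F a - (F z - F a) / (F z * F a))%C; [field; now split|].
  replace (F z - F a)%C with (f1 z * (x z - x a) + f2 z * (y z - y a))%C
    by (rewrite E1; ring).
  field. now split.
Qed.

Lemma dif_div (U : UniformSpace) (x y F G : U -> C) (a : U) :
  contC U x a -> contC U y a ->
  G a <> 0%C -> dif U x y F a -> dif U x y G a -> dif U x y (fun z => (F z / G z)%C) a.
Proof. intros. apply dif_mult; try assumption. now apply dif_inv. Qed.

Lemma dif_pow (U : UniformSpace) (x y F : U -> C) (n : nat) (a : U) :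
  contC U x a -> contC U y a ->
  dif U x y F a -> dif U x y (fun z => (F z ^ n)%C) a.
Proof.
  intros Hx Hy HF. induction n as [|n IH].
  - exact (dif_const U x y (RtoC 1) a).
  - now apply (dif_mult U x y F (fun z => (F z ^ n)%C)).
Qed.

Lemma dif_comp (U V : UniformSpace) (x y : U -> C) (X Y G : V -> C) (m : U -> V) (a : U) :
  contC U x a -> contC U y a -> continuous m a ->
  dif U x y (fun z => X (m z)) a -> dif U x y (fun z => Y (m z)) a ->
  dif V X Y G (m a) -> dif U x y (fun z => G (m z)) a.
Proof.
  intros Hx Hy Hm (f1 & f2 & H1 & H2 & H) (g1 & g2 & K1 & K2 & K) (h1 & h2 & L1 & L2 & L).
  exists (fun z => (h1 (m z) * f1 z + h2 (m z) * g1 z)%C),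
         (fun z => (h1 (m z) * f2 z + h2 (m z) * g2 z)%C).
  assert (M1 : contC U (fun z => h1 (m z)) a) by now apply (continuous_comp (U := U) (V := V) (W := CU) m h1).
  assert (M2 : contC U (fun z => h2 (m z)) a) by now apply (continuous_comp (U := U) (V := V) (W := CU) m h2).
  split; [|split].
  1, 2: apply continuous_C_plus; now apply continuous_C_mult.
  generalize (filter_and _ _ H (filter_and _ _ K (Hm _ L))). apply filter_imp.
  intros z (E1 & E2 & E3). rewrite E3, E1, E2. ring.
Qed.

Definition dif1 (f : C -> C) (a : C) : Prop := dif CU (fun z => z) (fun _ => RtoC 0) f a.
Definition dif2 (F : C * C -> C) (a : C * C) : Prop := dif CU2 fst snd F a.

Lemma dif1_iff (f : C -> C) (a : C) : C_differentiable_at f a <-> dif1 f a.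
Proof.
  unfold C_differentiable_at. change Cx with C.
  split.
  - intros [d Hd].
    (* The difference quotient, with the derivative filled in at [a]; its continuity at [a] is
       exactly differentiability. *)
    set (phi := fun z : C => if Ceq_dec z a then d else ((f z - f a) / (z - a))%C).
    exists phi, (fun _ => RtoC 0). split; [|split; [apply continuous_const|]].
    + apply continuous_C_eps. intros e He.
      destruct (Hd (e / 2)) as (r & Hr & H); [lra|].
      exists (mkposreal r Hr). intros z Hz. apply ball_CU in Hz. simpl in Hz.
      unfold phi. destruct (Ceq_dec a a) as [_|n]; [|now contradict n].
      destruct (Ceq_dec z a) as [E|n].
      { unfold Cminus; rewrite Cplus_opp_r, Cmod_0; exact He. }
      assert (Hn : (z - a)%C <> 0%C) by (intro E; apply n; now apply Cminus_eq0).
      specialize (H (z - a)%C). rewrite !Cabs_Cmod in H. specialize (H Hz).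
      change (Cmod ((f (a + (z - a)) - f a) - d * (z - a))%C <= e / 2 * Cmod (z - a)%C) in H.
      rewrite Cplus_minus_r in H.
      replace ((f z - f a) / (z - a) - d)%C with ((f z - f a - d * (z - a)) / (z - a))%C
        by (field; exact Hn).
      rewrite Cmod_div by exact Hn. apply Cmod_gt_0 in Hn.
      apply Rle_lt_trans with (e / 2); [|lra].
      apply Rmult_le_reg_r with (Cmod (z - a)); [exact Hn|].
      unfold Rdiv at 1. rewrite Rmult_assoc, Rinv_l, Rmult_1_r by lra. exact H.
    + apply filter_forall. intros z. unfold phi. destruct (Ceq_dec z a) as [->|n].
      * ring.
      * field. intro E; apply n; now apply Cminus_eq0.
  - intros (f1 & f2 & H1 & _ & [r H]). exists (f1 a). intros e He.
    destruct (proj1 (continuous_C_eps CU f1 a) H1 e He) as [s Hs].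
    exists (Rmin r s). split; [apply Rmin_pos; apply cond_pos|].
    intros h Hh. rewrite Cabs_Cmod in Hh.
    assert (E : forall t : R, Cmod h < t -> Cmod (a + h - a) < t)
      by (intros t Ht; now rewrite Cplus_minus_l).
    rewrite !Cabs_Cmod.
    change (Cmod ((f (a + h) - f a) - f1 a * h)%C <= e * Cmod h).
    rewrite (H (a + h)%C) by (apply E; eapply Rlt_le_trans; [exact Hh | apply Rmin_l]).
    replace (f a + f1 (a + h)%C * (a + h - a) + f2 (a + h)%C * (0 - 0) - f a - f1 a * h)%C
      with ((f1 (a + h) - f1 a) * h)%C by ring.
    rewrite Cmod_mult. apply Rmult_le_compat_r; [apply Cmod_ge_0|].
    left. apply (Hs (a + h)%C). apply E. eapply Rlt_le_trans; [exact Hh | apply Rmin_r].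
Qed.

Lemma Cmod_sqr_sum_pos (u v : C) : u <> 0%C \/ v <> 0%C -> (Cmod u ^ 2 + Cmod v ^ 2)%R <> 0.
Proof.
  intros [H|H]; apply Cmod_gt_0 in H; apply Rgt_not_eq;
  generalize (pow2_ge_0 (Cmod u)) (pow2_ge_0 (Cmod v)) (pow_lt _ 2 H); lra.
Qed.

(** The forward direction has to split one remainder [E] between two coordinates. With increments
    [h1], [h2] and [N = |h1|^2 + |h2|^2], the shares [E h_j~ / N], multiplied by [h_j], add up to
    [E], and each tends to 0 because [max(|h1|, |h2|)^2 <= N]. *)
Lemma dif2_iff (F : C * C -> C) (a : C * C) : C2_differentiable_at F a <-> dif2 F a.
Proof.
  unfold C2_differentiable_at. change Cx with C.
  split.
  - intros (d1 & d2 & Hd).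
    set (E := fun z : C * C =>
      ((F z - F a) - (d1 * (fst z - fst a) + d2 * (snd z - snd a)))%C).
    set (N := fun z : C * C => (Cmod (fst z - fst a) ^ 2 + Cmod (snd z - snd a) ^ 2)%R).
    assert (NE : forall z : C * C,
      N z = (Cmod (fst z - fst a) ^ 2 + Cmod (snd z - snd a) ^ 2)%R) by reflexivity.
    assert (EE : forall z : C * C,
      E z = ((F z - F a) - (d1 * (fst z - fst a) + d2 * (snd z - snd a)))%C) by reflexivity.
    assert (HE : forall e, 0 < e -> locally (a : CU2) (fun z : CU2 =>
       Cmod (E z) <= e * Rmax (Cmod (fst z - fst a)) (Cmod (snd z - snd a)))).
    { intros e He. destruct (Hd e He) as (r & Hr & H).
      exists (mkposreal r Hr). intros z [Hz1 Hz2].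
      specialize (H (fst z - fst a, snd z - snd a)%C). unfold C2abs in H. simpl fst in H; simpl snd in H.
      rewrite !Cabs_Cmod in H. specialize (H (Rmax_lub_lt _ _ _ Hz1 Hz2)).
      change (Cmod ((F (fst a + (fst z - fst a), snd a + (snd z - snd a)) - F a)
        - (d1 * (fst z - fst a) + d2 * (snd z - snd a)))%C
        <= e * Rmax (Cmod (fst z - fst a)) (Cmod (snd z - snd a))) in H.
      rewrite !Cplus_minus_r in H.
      destruct z; exact H. }
    assert (Key : forall g : C * C -> C,
      (forall z, Cmod (g z) <= Rmax (Cmod (fst z - fst a)) (Cmod (snd z - snd a))) ->
      (forall d, contC CU2 (fun z => (d + E z * Cconj (g z) / RtoC (N z))%C) a)).
    { intros g Hg d. apply continuous_C_eps. intros e He.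
      generalize (HE (e / 2) ltac:(lra)). apply filter_imp. intros z Hz.
      assert (Ea : E a = 0%C) by (unfold E; ring).
      rewrite Ea.
      replace (d + E z * Cconj (g z) / N z - (d + 0 * Cconj (g a) / N a))%C
        with (E z * Cconj (g z) / N z)%C by (unfold Cdiv; ring).
      set (u := Cmod (fst z - fst a)) in *. set (v := Cmod (snd z - snd a)) in *.
      destruct (Req_dec (N z) 0) as [E0|E0].
      { rewrite E0. change (u ^ 2 + v ^ 2 = 0) in E0.
        assert (u = 0 /\ v = 0) as [U0 V0]
          by (generalize (pow2_ge_0 u) (pow2_ge_0 v); intros; split; apply Rsqr_0_uniq; unfold Rsqr; lra).
        rewrite U0, V0, Rmax_left, Rmult_0_r in Hz by lra.
        rewrite (Cmod_eq_0 (E z)) by (generalize (Cmod_ge_0 (E z)); lra).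
        unfold Cdiv. rewrite !Cmult_0_l, Cmod_0. exact He. }
      assert (HN : 0 < N z).
      { generalize (pow2_ge_0 u) (pow2_ge_0 v). change (N z) with (u ^ 2 + v ^ 2) in E0 |- *. lra. }
      rewrite Cmod_div by (intro K; apply E0; now apply RtoC_inj).
      rewrite Cmod_mult, Cmod_conj, Cmod_R, Rabs_pos_eq by lra.
      apply Rle_lt_trans with (e / 2); [|lra].
      apply Rmult_le_reg_r with (N z); [exact HN|].
      unfold Rdiv at 1. rewrite Rmult_assoc, Rinv_l, Rmult_1_r by lra.
      specialize (Hg z). fold u v in Hg.
      apply Rle_trans with (e / 2 * Rmax u v * Rmax u v).
      { apply Rmult_le_compat; try assumption; apply Cmod_ge_0. }
      rewrite Rmult_assoc. apply Rmult_le_compat_l; [lra|]. change (N z) with (u ^ 2 + v ^ 2).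
      unfold Rmax; destruct (Rle_dec u v); nra. }
    exists (fun z => (d1 + E z * Cconj (fst z - fst a) / RtoC (N z))%C),
           (fun z => (d2 + E z * Cconj (snd z - snd a) / RtoC (N z))%C).
    split; [|split].
    + apply Key. intros; apply Rmax_l.
    + apply Key. intros; apply Rmax_r.
    + apply filter_forall.
      cut (forall z : C * C, F z = (F a
        + (d1 + E z * Cconj (fst z - fst a) / N z) * (fst z - fst a)
        + (d2 + E z * Cconj (snd z - snd a) / N z) * (snd z - snd a))%C); [intro K; exact K|].
      intros z. destruct (Req_dec (N z) 0) as [E0|E0].
      { rewrite NE in E0.
        assert (K := fun c => Cmod_sqr_sum_pos (fst z - fst a) (snd z - snd a) c E0).
        replace z with a; [rewrite EE; ring|].
        destruct a as [a1 a2], z as [z1 z2]. simpl in K. symmetry. f_equal; apply Cminus_eq0.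
        - destruct (Ceq_dec (z1 - a1)%C 0%C) as [E1|E1]; [exact E1 | exfalso; tauto].
        - destruct (Ceq_dec (z2 - a2)%C 0%C) as [E2|E2]; [exact E2 | exfalso; tauto]. }
      assert (HN : RtoC (N z) <> 0%C) by (intro K; apply E0; now apply RtoC_inj).
      assert (EN : RtoC (N z) = ((fst z - fst a) * Cconj (fst z - fst a)
           + (snd z - snd a) * Cconj (snd z - snd a))%C)
        by (rewrite NE, RtoC_plus, !Cmod2_conj; reflexivity).
      transitivity (F a + (d1 * (fst z - fst a) + d2 * (snd z - snd a))
        + E z * (((fst z - fst a) * Cconj (fst z - fst a)
           + (snd z - snd a) * Cconj (snd z - snd a)) / N z))%C;
        [rewrite <- EN, EE; field; exact HN | field; exact HN].
  - intros (f1 & f2 & H1 & H2 & H). exists (f1 a), (f2 a). intros e He.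
    generalize (proj1 (continuous_C_eps CU2 f1 a) H1 (e / 2) ltac:(lra)). intro K1.
    generalize (proj1 (continuous_C_eps CU2 f2 a) H2 (e / 2) ltac:(lra)). intro K2.
    destruct (filter_and _ _ H (filter_and _ _ K1 K2)) as [r Hr].
    exists r. split; [apply cond_pos|]. intros [h1 h2] Hh.
    unfold C2abs in *. simpl fst in *; simpl snd in *. rewrite !Cabs_Cmod in *.
    destruct a as [a1 a2]. simpl fst in *; simpl snd in *.
    destruct (Hr (a1 + h1, a2 + h2)%C) as (E0 & E1 & E2).
    { split; apply ball_CU; simpl.
      - rewrite Cplus_minus_l. eapply Rle_lt_trans; [apply Rmax_l | exact Hh].
      - rewrite Cplus_minus_l. eapply Rle_lt_trans; [apply Rmax_r | exact Hh]. }
    change (Cmod ((F (a1 + h1, a2 + h2) - F (a1, a2)) - (f1 (a1, a2) * h1 + f2 (a1, a2) * h2))%C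
      <= e * Rmax (Cmod h1) (Cmod h2)).
    rewrite E0. simpl fst; simpl snd.
    match goal with |- Cmod ?X <= _ => replace X with
      ((f1 (a1 + h1, a2 + h2) - f1 (a1, a2)) * h1 + (f2 (a1 + h1, a2 + h2) - f2 (a1, a2)) * h2)%C by ring end.
    eapply Rle_trans; [apply Cmod_triangle|]. rewrite !Cmod_mult.
    replace e with (e / 2 + e / 2) by field. rewrite Rmult_plus_distr_r.
    apply Rplus_le_compat; (apply Rmult_le_compat; [apply Cmod_ge_0 | apply Cmod_ge_0 | |]).
    + left; exact E1.
    + apply Rmax_l.
    + left; exact E2.
    + apply Rmax_r.
Qed.

(** * Goursat's theorem and the Schwarz lemma *)

(* Real differentiability of [u + i v] at [(s, t)] together with the Cauchy-Riemann equations. *)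
Definition CR_at (u v : R -> R -> R) (s t : R) : Prop :=
  exists A B : R, forall eps, 0 < eps -> exists delta, 0 < delta /\
    forall s' t', Rabs (s' - s) < delta -> Rabs (t' - t) < delta ->
      Rabs (u s' t' - (u s t + (A * (s' - s) - B * (t' - t))))
        <= eps * (Rabs (s' - s) + Rabs (t' - t)) /\
      Rabs (v s' t' - (v s t + (B * (s' - s) + A * (t' - t))))
        <= eps * (Rabs (s' - s) + Rabs (t' - t)).

Lemma continuous_of_linear_bound (f : R -> R) (x a d : R) : 0 < d ->
  (forall z, Rabs (z - x) < d -> Rabs (f z - (f x + a * (z - x))) <= Rabs (z - x)) ->
  continuous f x.
Proof.
  intros Hd H. apply filterlim_locally. intros [e He].
  assert (P : 0 < 1 + Rabs a) by (generalize (Rabs_pos a); lra).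
  assert (Hm : 0 < Rmin d (e / (1 + Rabs a))).
  { apply Rmin_pos; [exact Hd | now apply Rdiv_lt_0_compat]. }
  exists (mkposreal _ Hm). intros z Hz. change (Rabs (z - x) < Rmin d (e / (1 + Rabs a))) in Hz.
  change (Rabs (f z - f x) < e).
  assert (H1 := Rlt_le_trans _ _ _ Hz (Rmin_l _ _)). assert (H2 := Rlt_le_trans _ _ _ Hz (Rmin_r _ _)).
  apply Rmult_lt_compat_r with (r := 1 + Rabs a) in H2; [|exact P].
  unfold Rdiv in H2. rewrite Rmult_assoc, Rinv_l, Rmult_1_r in H2 by lra.
  assert (T := Rabs_triang (f z - (f x + a * (z - x))) (a * (z - x))).
  replace (f z - (f x + a * (z - x)) + a * (z - x)) with (f z - f x) in T by ring.
  rewrite Rabs_mult in T. specialize (H z H1). lra.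
Qed.

Lemma CR_at_continuous (u v : R -> R -> R) (s t : R) : CR_at u v s t ->
  continuous (fun x => u x t) s /\ continuous (fun y => u s y) t /\
  continuous (fun x => v x t) s /\ continuous (fun y => v s y) t.
Proof.
  intros (A & B & H). destruct (H 1 Rlt_0_1) as (d & Hd & K).
  assert (Zs : Rabs (s - s) = 0) by (rewrite Rminus_diag; apply Rabs_R0).
  assert (Zt : Rabs (t - t) = 0) by (rewrite Rminus_diag; apply Rabs_R0).
  assert (K1 : forall z, Rabs (z - s) < d -> _) by (intros z Hz; apply (K z t Hz); rewrite Zt; exact Hd).
  assert (K2 : forall z, Rabs (z - t) < d -> _) by (intros z Hz; apply (K s z); [rewrite Zs; exact Hd | exact Hz]).
  assert (Q : forall a b c e, Rabs a <= 1 * b -> a = c -> b = e -> Rabs c <= e)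
    by (intros a b c e L <- <-; lra).
  repeat split.
  - apply (continuous_of_linear_bound _ s A d Hd). intros z Hz.
    apply (Q _ _ _ _ (proj1 (K1 z Hz))); [ring | rewrite Zt; ring].
  - apply (continuous_of_linear_bound _ t (- B) d Hd). intros z Hz.
    apply (Q _ _ _ _ (proj1 (K2 z Hz))); [ring | rewrite Zs; ring].
  - apply (continuous_of_linear_bound _ s B d Hd). intros z Hz.
    apply (Q _ _ _ _ (proj2 (K1 z Hz))); [ring | rewrite Zt; ring].
  - apply (continuous_of_linear_bound _ t A d Hd). intros z Hz.
    apply (Q _ _ _ _ (proj2 (K2 z Hz))); [ring | rewrite Zs; ring].
Qed.

(* Imaginary part of the integral of [(u + i v) (ds + i dt)] along the boundary of
   [[a, b] x [c, d]]. *)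
Definition bdry (u v : R -> R -> R) (a b c d : R) : R :=
  RInt (u b) c d - RInt (u a) c d
  - (RInt (fun s => v s d) a b - RInt (fun s => v s c) a b).

Definition CR_on (u v : R -> R -> R) (a b c d : R) : Prop :=
  forall s t, a <= s <= b -> c <= t <= d -> CR_at u v s t.

Lemma CR_on_ex_RInt (u v : R -> R -> R) (a b c d : R) : CR_on u v a b c d ->
  (forall s c' d', a <= s <= b -> c <= c' <= d' -> d' <= d -> ex_RInt (u s) c' d') /\
  (forall t a' b', c <= t <= d -> a <= a' <= b' -> b' <= b -> ex_RInt (fun s => v s t) a' b').
Proof.
  intros H. split.
  - intros s c' d' Hs Hc Hd. apply (ex_RInt_continuous (V := R_CompleteNormedModule)).
    rewrite Rmin_left, Rmax_right by lra. intros z Hz.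
    apply (CR_at_continuous u v s z). apply H; lra.
  - intros t a' b' Ht Ha Hb. apply (ex_RInt_continuous (V := R_CompleteNormedModule)).
    rewrite Rmin_left, Rmax_right by lra. intros z Hz.
    apply (CR_at_continuous u v z t). apply H; lra.
Qed.

Lemma bdry_split (u v : R -> R -> R) (a b c d m n : R) : CR_on u v a b c d ->
  a <= m <= b -> c <= n <= d ->
  bdry u v a b c d =
  bdry u v a m c n + bdry u v m b c n + (bdry u v a m n d + bdry u v m b n d).
Proof.
  intros H Hm Hn. destruct (CR_on_ex_RInt u v a b c d H) as [E1 E2]. unfold bdry.
  assert (U : forall s, a <= s <= b -> RInt (u s) c d = RInt (u s) c n + RInt (u s) n d).
  { intros s Hs. symmetry.
    apply (RInt_Chasles (V := R_CompleteNormedModule) (u s) c n d); apply E1; lra. }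
  assert (W : forall t, c <= t <= d ->
    RInt (fun s => v s t) a b = RInt (fun s => v s t) a m + RInt (fun s => v s t) m b).
  { intros t Ht. symmetry.
    apply (RInt_Chasles (V := R_CompleteNormedModule) (fun s => v s t) a m b); apply E2; lra. }
  rewrite (U a), (U b), (W c), (W d) by lra. ring.
Qed.

Lemma RInt_near_const (f : R -> R) (a b K E : R) : a <= b -> ex_RInt f a b ->
  (forall x, a <= x <= b -> Rabs (f x - K) <= E) -> Rabs (RInt f a b - K * (b - a)) <= E * (b - a).
Proof.
  intros Hab Hf H.
  assert (HK : ex_RInt (fun _ => K) a b) by apply ex_RInt_const.
  assert (E1 := RInt_minus (V := R_CompleteNormedModule) f (fun _ => K) a b Hf HK).
  rewrite RInt_const in E1.
  change (@eq R (RInt (fun x => f x - K) a b) (RInt f a b - (b - a) * K)) in E1.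
  assert (E2 : @eq R (RInt f a b - K * (b - a)) (RInt (fun x => f x - K) a b))
    by (rewrite E1; ring).
  rewrite E2, (Rmult_comm E). apply abs_RInt_le_const; [exact Hab | | exact H].
  now apply (ex_RInt_minus (V := R_NormedModule)).
Qed.

(** The affine part cancels: by the Cauchy-Riemann equations both differences of opposite sides
    contribute [A (b - a) (d - c)], so only the remainder [E] counts, twice for each pair of
    sides. *)
Lemma bdry_bound (u v : R -> R -> R) (a b c d u0 v0 A B s0 t0 E : R) : CR_on u v a b c d ->
  a <= b -> c <= d ->
  (forall s t, a <= s <= b -> c <= t <= d ->
     Rabs (u s t - (u0 + (A * (s - s0) - B * (t - t0)))) <= E /\
     Rabs (v s t - (v0 + (B * (s - s0) + A * (t - t0)))) <= E) ->
  Rabs (bdry u v a b c d) <= 2 * E * ((b - a) + (d - c)).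
Proof.
  intros H Hab Hcd HE. destruct (CR_on_ex_RInt u v a b c d H) as [E1 E2]. unfold bdry.
  assert (I1 : ex_RInt (u b) c d) by (apply E1; lra).
  assert (I2 : ex_RInt (u a) c d) by (apply E1; lra).
  assert (I3 : ex_RInt (fun s => v s d) a b) by (apply E2; lra).
  assert (I4 : ex_RInt (fun s => v s c) a b) by (apply E2; lra).
  assert (K1 := RInt_near_const (fun t => u b t - u a t) c d (A * (b - a)) (2 * E) Hcd
    (ex_RInt_minus (V := R_NormedModule) _ _ _ _ I1 I2)).
  assert (K2 := RInt_near_const (fun s => v s d - v s c) a b (A * (d - c)) (2 * E) Hab
    (ex_RInt_minus (V := R_NormedModule) _ _ _ _ I3 I4)).
  replace (RInt (u b) c d - RInt (u a) c d) with (RInt (fun t => u b t - u a t) c d)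
    by exact (RInt_minus (V := R_CompleteNormedModule) _ _ _ _ I1 I2).
  replace (RInt (fun s => v s d) a b - RInt (fun s => v s c) a b)
    with (RInt (fun s => v s d - v s c) a b)
    by exact (RInt_minus (V := R_CompleteNormedModule) _ _ _ _ I3 I4).
  assert (L1 : Rabs (RInt (fun t => u b t - u a t) c d - A * (b - a) * (d - c)) <= 2 * E * (d - c)).
  { apply K1. intros t Ht. destruct (HE b t) as [P _]; try lra. destruct (HE a t) as [Q _]; try lra.
    apply Rabs_le_between in P. apply Rabs_le_between in Q. apply Rabs_le. lra. }
  assert (L2 : Rabs (RInt (fun s => v s d - v s c) a b - A * (d - c) * (b - a)) <= 2 * E * (b - a)).
  { apply K2. intros s Hs. destruct (HE s d) as [_ P]; try lra. destruct (HE s c) as [_ Q]; try lra.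
    apply Rabs_le_between in P. apply Rabs_le_between in Q. apply Rabs_le. lra. }
  apply Rabs_le_between in L1. apply Rabs_le_between in L2. apply Rabs_le. lra.
Qed.

Lemma nested_intervals (x y : nat -> R) :
  (forall n, x n <= x (S n)) -> (forall n, y (S n) <= y n) -> (forall n, x n <= y n) ->
  exists s, forall n, x n <= s <= y n.
Proof.
  intros Hx Hy Hxy.
  assert (Mx : forall n k, x n <= x (n + k)%nat).
  { intros n k. induction k as [|k IH]; [rewrite Nat.add_0_r; lra|].
    rewrite Nat.add_succ_r. eapply Rle_trans; [exact IH | apply Hx]. }
  assert (My : forall n k, y (n + k)%nat <= y n).
  { intros n k. induction k as [|k IH]; [rewrite Nat.add_0_r; lra|].
    rewrite Nat.add_succ_r. eapply Rle_trans; [apply Hy | exact IH]. }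
  assert (Mxy : forall n m, x n <= y m).
  { intros n m. eapply Rle_trans; [apply (Mx n m)|]. eapply Rle_trans; [apply Hxy|].
    rewrite Nat.add_comm. apply My. }
  destruct (completeness (fun r => exists n, r = x n)) as [s [S1 S2]].
  - exists (y 0%nat). intros r [n ->]. apply Mxy.
  - exists (x 0%nat). now exists 0%nat.
  - exists s. intros n. split; [apply S1; now exists n|].
    apply S2. intros r [m ->]. apply Mxy.
Qed.

Lemma pow2_large (x : R) : exists n : nat, x < 2 ^ n.
Proof.
  destruct (Pow_x_infinity 2 ltac:(rewrite Rabs_right; lra) (x + 1)) as [N HN].
  exists N. specialize (HN N (le_n N)). rewrite Rabs_right in HN; [lra|].
  apply Rle_ge, pow_le; lra.
Qed.

(** Bisection: a nonzero boundary integral would keep at least a quarter of its size in one of the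
    four subrectangles at each step, while differentiability at the limit point makes it
    [o(4^-n)]. *)
Lemma goursat (u v : R -> R -> R) (a b c d : R) : a <= b -> c <= d ->
  CR_on u v a b c d -> bdry u v a b c d = 0.
Proof.
  intros Hab Hcd H.
  set (K := Rabs (bdry u v a b c d)).
  destruct (Req_dec K 0) as [E0|E0].
  { destruct (Req_dec (bdry u v a b c d) 0) as [E|E]; [exact E|].
    now apply Rabs_no_R0 in E. }
  assert (HK : 0 < K) by (unfold K in *; generalize (Rabs_pos (bdry u v a b c d)); lra).
  exfalso.
  set (L := b - a). set (M := d - c).
  set (In := fun (n : nat) (p : R * R) =>
    a <= fst p /\ fst p + L / 2 ^ n <= b /\ c <= snd p /\ snd p + M / 2 ^ n <= d).
  set (Bad := fun (n : nat) (p : R * R) => In n p /\ K / 4 ^ n <=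
     Rabs (bdry u v (fst p) (fst p + L / 2 ^ n) (snd p) (snd p + M / 2 ^ n))).
  assert (P2 : forall n, 0 < 2 ^ n) by (intro; apply pow_lt; lra).
  assert (LH : forall n, L / 2 ^ n = L / 2 ^ S n + L / 2 ^ S n)
    by (intro n; simpl; field; generalize (P2 n); lra).
  assert (MH : forall n, M / 2 ^ n = M / 2 ^ S n + M / 2 ^ S n)
    by (intro n; simpl; field; generalize (P2 n); lra).
  assert (LP : forall n, 0 <= L / 2 ^ n)
    by (intro n; apply Rdiv_le_0_compat; [unfold L; lra | apply P2]).
  assert (MP : forall n, 0 <= M / 2 ^ n)
    by (intro n; apply Rdiv_le_0_compat; [unfold M; lra | apply P2]).
  assert (Step : forall n p, Bad n p -> exists p', Bad (S n) p' /\
     fst p <= fst p' /\ fst p' + L / 2 ^ S n <= fst p + L / 2 ^ n /\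
     snd p <= snd p' /\ snd p' + M / 2 ^ S n <= snd p + M / 2 ^ n).
  { intros n [x y] [(I1 & I2 & I3 & I4) HB]. simpl fst in *; simpl snd in *.
    generalize (LP (S n)) (MP (S n)). intros L0 M0.
    rewrite (LH n), (MH n) in *.
    set (l := L / 2 ^ S n) in *. set (m := M / 2 ^ S n) in *.
    assert (HS := bdry_split u v x (x + (l + l)) y (y + (m + m)) (x + l) (y + m)).
    rewrite HS in HB; [|intros s t Hs Ht; apply H; lra | lra | lra]. clear HS.
    replace (x + (l + l)) with (x + l + l) in HB by ring.
    replace (y + (m + m)) with (y + m + m) in HB by ring.
    assert (HB4 : K / 4 ^ n = K / 4 ^ S n + K / 4 ^ S n + (K / 4 ^ S n + K / 4 ^ S n))
      by (simpl; field; apply pow_nonzero; lra).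
    rewrite HB4 in HB. clear HB4.
    assert (Tri : forall q a1 a2 a3 a4, q + q + (q + q) <= Rabs (a1 + a2 + (a3 + a4)) ->
      q <= Rabs a1 \/ q <= Rabs a2 \/ q <= Rabs a3 \/ q <= Rabs a4).
    { intros q a1 a2 a3 a4 Hq.
      generalize (Rabs_triang (a1 + a2) (a3 + a4)) (Rabs_triang a1 a2) (Rabs_triang a3 a4).
      intros. destruct (Rle_dec q (Rabs a1)); [now left|].
      destruct (Rle_dec q (Rabs a2)); [now right; left|].
      destruct (Rle_dec q (Rabs a3)); [now right; right; left|].
      right; right; right; lra. }
    destruct (Tri _ _ _ _ _ HB) as [T|[T|[T|T]]].
    - exists (x, y). unfold Bad, In. simpl fst; simpl snd. fold l m. repeat split; try lra; exact T.
    - exists (x + l, y). unfold Bad, In. simpl fst; simpl snd. fold l m. repeat split; try lra; exact T.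
    - exists (x, y + m). unfold Bad, In. simpl fst; simpl snd. fold l m. repeat split; try lra; exact T.
    - exists (x + l, y + m). unfold Bad, In. simpl fst; simpl snd. fold l m. repeat split; try lra; exact T. }
  assert (B0 : Bad 0%nat (a, c)).
  { unfold Bad, In. simpl. replace (a + L / 1) with b by (unfold L; field).
    replace (c + M / 1) with d by (unfold M; field). fold K. repeat split; lra. }
  (* Dependent choice of the nested rectangles, each given by its lower left corner together with
     the proof that it is bad. *)
  set (next := fun (n : nat) (p : {p | Bad n p}) =>
    let q := constructive_indefinite_description _ (Step n (proj1_sig p) (proj2_sig p)) in
    exist (Bad (S n)) (proj1_sig q) (proj1 (proj2_sig q))).
  set (sq := nat_rect (fun n => {p | Bad n p}) (exist _ (a, c) B0) next).
  set (x := fun n => fst (proj1_sig (sq n))). set (y := fun n => snd (proj1_sig (sq n))).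
  assert (Sx : forall n, x n <= x (S n) /\ x (S n) + L / 2 ^ S n <= x n + L / 2 ^ n /\
    y n <= y (S n) /\ y (S n) + M / 2 ^ S n <= y n + M / 2 ^ n).
  { intros n. unfold x, y. change (sq (S n)) with (next n (sq n)). unfold next.
    destruct (constructive_indefinite_description _ (Step n _ (proj2_sig (sq n)))) as [q Hq].
    simpl proj1_sig. exact (proj2 Hq). }
  destruct (nested_intervals x (fun n => x n + L / 2 ^ n)) as [s Hs].
  { intro n; apply Sx. } { intro n; apply Sx. } { intro n; generalize (LP n); lra. }
  destruct (nested_intervals y (fun n => y n + M / 2 ^ n)) as [t Ht].
  { intro n; apply Sx. } { intro n; apply Sx. } { intro n; generalize (MP n); lra. }
  assert (Bn : forall n, Bad n (x n, y n)).
  { intro n. unfold x, y. rewrite <- surjective_pairing. apply (proj2_sig (sq n)). }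
  destruct (Bn 0%nat) as [(J1 & J2 & J3 & J4) _]. simpl in J1, J2, J3, J4.
  generalize (Hs 0%nat) (Ht 0%nat); simpl; intros S0 T0.
  destruct (H s t ltac:(lra) ltac:(lra)) as (A & B & HCR).
  set (W := L + M). assert (HW : 0 <= W) by (unfold W, L, M; lra).
  assert (D : 0 < 2 * W * W + 1) by nra.
  (* With this tolerance [bdry_bound] gives at most [2 W^2 K / ((2 W^2 + 1) 4^n)], which is less
     than [K / 4^n]; the added 1 also covers [W = 0]. *)
  destruct (HCR (K / (2 * W * W + 1))) as (r & Hr & HL); [now apply Rdiv_lt_0_compat|].
  destruct (pow2_large (W / r)) as [n Hn].
  assert (Hw : W / 2 ^ n < r).
  { apply Rmult_lt_reg_r with (2 ^ n); [apply P2|]. unfold Rdiv.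
    rewrite Rmult_assoc, Rinv_l, Rmult_1_r by (generalize (P2 n); lra).
    apply Rmult_lt_reg_r with (/ r); [now apply Rinv_0_lt_compat|].
    replace (r * 2 ^ n * / r) with (2 ^ n) by (field; lra). exact Hn. }
  destruct (Bn n) as [(I1 & I2 & I3 & I4) HB]. simpl fst in *; simpl snd in *.
  specialize (Hs n). specialize (Ht n). simpl in Hs, Ht.
  generalize (LP n) (MP n). intros L0 M0.
  assert (EW : W / 2 ^ n = L / 2 ^ n + M / 2 ^ n) by (unfold W; field; generalize (P2 n); lra).
  assert (HB' := bdry_bound u v (x n) (x n + L / 2 ^ n) (y n) (y n + M / 2 ^ n) (u s t) (v s t)
    A B s t (K / (2 * W * W + 1) * (W / 2 ^ n))).
  assert (HB2 : Rabs (bdry u v (x n) (x n + L / 2 ^ n) (y n) (y n + M / 2 ^ n))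
    <= 2 * (K / (2 * W * W + 1) * (W / 2 ^ n)) * (W / 2 ^ n)).
  { rewrite EW at 2.
    replace (L / 2 ^ n + M / 2 ^ n) with (x n + L / 2 ^ n - x n + (y n + M / 2 ^ n - y n)) by ring.
    apply HB'; [intros s' t' Hs' Ht'; apply H; lra | lra | lra |].
    intros s' t' Hs' Ht'.
    assert (R1 : Rabs (s' - s) <= L / 2 ^ n) by (apply Rabs_le; lra).
    assert (R2 : Rabs (t' - t) <= M / 2 ^ n) by (apply Rabs_le; lra).
    destruct (HL s' t') as [G1 G2]; [lra | lra |].
    assert (G : K / (2 * W * W + 1) * (Rabs (s' - s) + Rabs (t' - t))
      <= K / (2 * W * W + 1) * (W / 2 ^ n)).
    { apply Rmult_le_compat_l; [left; now apply Rdiv_lt_0_compat | lra]. }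
    split; lra. }
  assert (E4 : K / 4 ^ n = K * (/ 2 ^ n * / 2 ^ n)).
  { replace 4 with (2 * 2) by ring. rewrite Rpow_mult_distr. field. generalize (P2 n); lra. }
  rewrite E4 in HB. clear E4.
  assert (Q : 0 < / 2 ^ n * / 2 ^ n)
    by (apply Rmult_lt_0_compat; apply Rinv_0_lt_compat, P2).
  assert (Lt : 2 * (K / (2 * W * W + 1) * (W / 2 ^ n)) * (W / 2 ^ n)
     < K * (/ 2 ^ n * / 2 ^ n)).
  { replace (2 * (K / (2 * W * W + 1) * (W / 2 ^ n)) * (W / 2 ^ n))
      with (K * ((2 * W * W) / (2 * W * W + 1)) * (/ 2 ^ n * / 2 ^ n))
      by (field; split; [generalize (P2 n); lra | lra]).
    apply Rmult_lt_compat_r; [exact Q|]. rewrite <- (Rmult_1_r K) at 2.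
    apply Rmult_lt_compat_l; [exact HK|].
    apply Rmult_lt_reg_r with (2 * W * W + 1); [exact D|].
    unfold Rdiv. rewrite Rmult_assoc, Rinv_l by lra. lra. }
  lra.
Qed.

(** * Logarithmic polar coordinates and the mean value inequality *)

Definition polar (s t : R) : C := (exp s * cos t, exp s * sin t).

Lemma derivable_pt_lim_bound (f : R -> R) (x l : R) : derivable_pt_lim f x l ->
  forall eps, 0 < eps -> exists d, 0 < d /\
    forall h, Rabs h < d -> Rabs (f (x + h) - f x - l * h) <= eps * Rabs h.
Proof.
  intros H e He. destruct (H e He) as [d Hd]. exists d. split; [apply cond_pos|].
  intros h Hh. destruct (Req_dec h 0) as [->|n].
  - rewrite Rplus_0_r, Rabs_R0. replace (f x - f x - l * 0) with 0 by ring. rewrite Rabs_R0. lra.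
  - replace (f (x + h) - f x - l * h) with (((f (x + h) - f x) / h - l) * h) by (field; exact n).
    rewrite Rabs_mult. apply Rmult_le_compat_r; [apply Rabs_pos | left; now apply Hd].
Qed.

Lemma Cmod_le_Rabs_sum (z : C) : Cmod z <= Rabs (fst z) + Rabs (snd z).
Proof.
  unfold Cmod. generalize (Rabs_pos (fst z)) (Rabs_pos (snd z)). intros P Q.
  rewrite <- (sqrt_Rsqr (Rabs (fst z) + Rabs (snd z))) by lra.
  apply sqrt_le_1_alt. rewrite <- (pow2_abs (fst z)), <- (pow2_abs (snd z)). unfold Rsqr. nra.
Qed.

Lemma Cmod_polar (s t : R) : Cmod (polar s t) = exp s.
Proof.
  unfold Cmod, polar; simpl fst; simpl snd.
  replace ((exp s * cos t) ^ 2 + (exp s * sin t) ^ 2)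
    with (exp s ^ 2 * (Rsqr (sin t) + Rsqr (cos t))) by (unfold Rsqr; ring).
  rewrite sin2_cos2, Rmult_1_r. rewrite sqrt_pow2; [reflexivity | left; apply exp_pos].
Qed.

Lemma polar_plus (s t h k : R) : polar (s + h) (t + k) = (polar s t * polar h k)%C.
Proof.
  unfold polar, Cmult; simpl. rewrite exp_plus, cos_plus, sin_plus. f_equal; ring.
Qed.

Lemma polar_bound_0 (eps : R) : 0 < eps -> exists d, 0 < d /\ forall h k : R,
  Rabs h < d -> Rabs k < d ->
  Cmod (polar h k - 1 - (h, k))%C <= eps * (Rabs h + Rabs k).
Proof.
  (* The error terms below add up to at most [2 e |h| + 5 e |k|], hence the 6. *)
  intros He. set (e := Rmin 1 (eps / 6)).
  assert (He0 : 0 < e) by (apply Rmin_pos; lra).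
  assert (He1 : e <= 1) by apply Rmin_l. assert (He2 : e <= eps / 6) by apply Rmin_r.
  destruct (derivable_pt_lim_bound exp 0 1 derivable_pt_lim_exp_0 e He0) as (d1 & D1 & H1).
  destruct (derivable_pt_lim_bound sin 0 (cos 0) (derivable_pt_lim_sin 0) e He0) as (d2 & D2 & H2).
  destruct (derivable_pt_lim_bound cos 0 (- sin 0) (derivable_pt_lim_cos 0) e He0) as (d3 & D3 & H3).
  exists (Rmin (Rmin d1 e) (Rmin d2 d3)). split; [apply Rmin_pos; apply Rmin_pos; assumption|].
  intros h k Hh Hk.
  assert (Hh1 : Rabs h < d1) by (eapply Rlt_le_trans; [exact Hh|]; eapply Rle_trans; [apply Rmin_l | apply Rmin_l]).
  assert (Hh2 : Rabs h < e) by (eapply Rlt_le_trans; [exact Hh|]; eapply Rle_trans; [apply Rmin_l | apply Rmin_r]).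
  assert (Hk2 : Rabs k < d2) by (eapply Rlt_le_trans; [exact Hk|]; eapply Rle_trans; [apply Rmin_r | apply Rmin_l]).
  assert (Hk3 : Rabs k < d3) by (eapply Rlt_le_trans; [exact Hk|]; eapply Rle_trans; [apply Rmin_r | apply Rmin_r]).
  specialize (H1 h Hh1). specialize (H2 k Hk2). specialize (H3 k Hk3).
  rewrite Rplus_0_l in *. rewrite exp_0 in H1. rewrite cos_0, sin_0 in *.
  eapply Rle_trans; [apply Cmod_le_Rabs_sum|]. simpl fst; simpl snd.
  set (E := exp h - 1 - 1 * h) in *. set (S := sin k - 0 - 1 * k) in *.
  set (T := cos k - 1 - - 0 * k) in *.
  replace (exp h * cos k + - (1) + - h) with (E * cos k + (1 + h) * T) by (unfold E, T; ring).
  replace (exp h * sin k + - 0 + - k) with (E * sin k + (1 + h) * S + h * k) by (unfold E, S; ring).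
  assert (Cb : Rabs (cos k) <= 1) by (apply Rabs_le, COS_bound).
  assert (Sb : Rabs (sin k) <= 1) by (apply Rabs_le, SIN_bound).
  assert (Hb : Rabs (1 + h) <= 2) by (eapply Rle_trans; [apply Rabs_triang|]; rewrite Rabs_R1; lra).
  assert (P := Rabs_pos h). assert (Q := Rabs_pos k).
  assert (B1 : Rabs (E * cos k) <= e * Rabs h * 1).
  { rewrite Rabs_mult. apply Rmult_le_compat; try apply Rabs_pos; assumption. }
  assert (B2 : Rabs (E * sin k) <= e * Rabs h * 1).
  { rewrite Rabs_mult. apply Rmult_le_compat; try apply Rabs_pos; assumption. }
  assert (B3 : Rabs ((1 + h) * T) <= 2 * (e * Rabs k)).
  { rewrite Rabs_mult. apply Rmult_le_compat; try apply Rabs_pos; assumption. }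
  assert (B4 : Rabs ((1 + h) * S) <= 2 * (e * Rabs k)).
  { rewrite Rabs_mult. apply Rmult_le_compat; try apply Rabs_pos; assumption. }
  assert (B5 : Rabs (h * k) <= e * Rabs k).
  { rewrite Rabs_mult. apply Rmult_le_compat_r; lra. }
  generalize (Rabs_triang (E * cos k) ((1 + h) * T))
    (Rabs_triang (E * sin k + (1 + h) * S) (h * k)) (Rabs_triang (E * sin k) ((1 + h) * S)).
  intros.
  apply Rle_trans with (6 * e * (Rabs h + Rabs k)).
  - assert (0 <= e * Rabs h) by (apply Rmult_le_pos; lra).
    assert (0 <= e * Rabs k) by (apply Rmult_le_pos; lra). lra.
  - apply Rmult_le_compat_r; lra.
Qed.

Lemma CR_at_polar (f : C -> C) (s t : R) : s < 0 -> dif1 f (polar s t) ->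
  CR_at (fun s t => fst (f (polar s t))) (fun s t => snd (f (polar s t))) s t.
Proof.
  intros Hs (phi & psi & Hphi & _ & Hf). set (z := polar s t) in *.
  (* By the chain rule [f (exp (s + i t))] has derivative [f'(z) z]; its real and imaginary parts
     are [A] and [B]. *)
  exists (fst (phi z * z)%C), (snd (phi z * z)%C). intros eps He.
  assert (Hz : Cmod z < 1) by (unfold z; rewrite Cmod_polar, <- exp_0; now apply exp_increasing).
  set (e1 := Rmin 1 (eps / (2 * (Cmod (phi z) + 1)))).
  assert (P0 := Cmod_ge_0 (phi z)).
  assert (E1 : 0 < e1) by (apply Rmin_pos; [lra | apply Rdiv_lt_0_compat; lra]).
  destruct (polar_bound_0 e1 E1) as (d1 & D1 & H1).
  destruct (filter_and _ _ Hf (proj1 (continuous_C_eps CU phi z) Hphi (eps / 4) ltac:(lra)))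
    as [r Hr].
  assert (Pr := cond_pos r).
  exists (Rmin d1 (r / 4)). split; [apply Rmin_pos; lra|].
  intros s' t' Hs' Ht'. set (h := s' - s) in *. set (k := t' - t) in *.
  assert (Hh : Rabs h < d1) by (eapply Rlt_le_trans; [exact Hs' | apply Rmin_l]).
  assert (Hk : Rabs k < d1) by (eapply Rlt_le_trans; [exact Ht' | apply Rmin_l]).
  assert (Hh' : Rabs h < r / 4) by (eapply Rlt_le_trans; [exact Hs' | apply Rmin_r]).
  assert (Hk' : Rabs k < r / 4) by (eapply Rlt_le_trans; [exact Ht' | apply Rmin_r]).
  specialize (H1 h k Hh Hk). set (N := Rabs h + Rabs k) in *.
  assert (N0 : 0 <= N) by (unfold N; generalize (Rabs_pos h) (Rabs_pos k); lra).
  set (w := polar s' t').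
  assert (Ew : w = (z * polar h k)%C).
  { unfold w, z. rewrite <- polar_plus. f_equal; unfold h, k; ring. }
  assert (Q1 : Cmod (w - z - z * (h, k))%C <= e1 * N).
  { rewrite Ew. replace (z * polar h k - z - z * (h, k))%C
      with (z * (polar h k - 1 - (h, k)))%C by ring.
    rewrite Cmod_mult. rewrite <- (Rmult_1_l (e1 * N)).
    apply Rmult_le_compat; try apply Cmod_ge_0; lra. }
  assert (Q2 : Cmod (w - z)%C <= 2 * N).
  { replace (w - z)%C with ((w - z - z * (h, k)) + z * (h, k))%C by ring.
    eapply Rle_trans; [apply Cmod_triangle|]. rewrite Cmod_mult.
    assert (Cmod (h, k) <= N) by apply (Cmod_le_Rabs_sum (h, k)).
    assert (Cmod z * Cmod (h, k) <= 1 * N) by (apply Rmult_le_compat; try apply Cmod_ge_0; lra).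
    assert (e1 * N <= 1 * N) by (apply Rmult_le_compat_r; [exact N0 | apply Rmin_l]). lra. }
  destruct (Hr w) as [F1 F2].
  { apply ball_CU. eapply Rle_lt_trans; [exact Q2|]. unfold N. lra. }
  assert (Q3 : Cmod (f w - f z - phi z * z * (h, k))%C <= eps * N).
  { rewrite F1. replace (f z + phi w * (w - z) + psi w * (0 - 0) - f z - phi z * z * (h, k))%C
      with ((phi w - phi z) * (w - z) + phi z * (w - z - z * (h, k)))%C by ring.
    eapply Rle_trans; [apply Cmod_triangle|]. rewrite !Cmod_mult.
    assert (Cmod (phi w - phi z) * Cmod (w - z) <= eps / 4 * (2 * N))
      by (apply Rmult_le_compat; try apply Cmod_ge_0; lra).
    assert (Cmod (phi z) * Cmod (w - z - z * (h, k)) <= (Cmod (phi z) + 1) * (e1 * N))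
      by (apply Rmult_le_compat; try apply Cmod_ge_0; lra).
    assert ((Cmod (phi z) + 1) * (e1 * N) <= eps / 2 * N).
    { rewrite <- Rmult_assoc. apply Rmult_le_compat_r; [exact N0|].
      apply Rle_trans with ((Cmod (phi z) + 1) * (eps / (2 * (Cmod (phi z) + 1)))).
      - apply Rmult_le_compat_l; [lra | apply Rmin_r].
      - apply Req_le. field. lra. }
    lra. }
  assert (Q4 := Rle_trans _ _ _ (Rmax_Cmod _) Q3).
  split.
  - eapply Rle_trans; [|eapply Rle_trans; [apply Rmax_l | exact Q4]].
    apply Req_le. f_equal. fold z w h k. generalize (f w) (f z) (phi z * z)%C.
    intros [? ?] [? ?] [? ?]. simpl. ring.
  - eapply Rle_trans; [|eapply Rle_trans; [apply Rmax_r | exact Q4]].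
    apply Req_le. f_equal. fold z w h k. generalize (f w) (f z) (phi z * z)%C.
    intros [? ?] [? ?] [? ?]. simpl. ring.
Qed.

(** In the coordinates [exp (s + i t)] a rectangle of height [2 PI] is an annulus, and its
    horizontal sides cancel by periodicity. So the integral of the real part over a circle does not
    depend on the radius, and as the radius shrinks it tends to [2 PI] times the real part at 0. *)
Lemma mean_value_Re (f : C -> C) (r M : R) : 0 < r < 1 ->
  (forall z, Cmod z < 1 -> dif1 f z) -> (forall z, Cmod z = r -> fst (f z) <= M) ->
  fst (f (RtoC 0)) <= M.
Proof.
  intros Hr Hf HM.
  set (u := fun s t => fst (f (polar s t))). set (v := fun s t => snd (f (polar s t))).
  assert (Hb : ln r < 0) by (rewrite <- ln_1; apply ln_increasing; lra).
  assert (HP := PI_RGT_0).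
  assert (Hcr : forall s t, s < 0 -> CR_at u v s t).
  { intros s t Hs. apply CR_at_polar; [exact Hs|]. apply Hf. rewrite Cmod_polar, <- exp_0.
    now apply exp_increasing. }
  assert (Hex : forall s, s < 0 -> ex_RInt (u s) 0 (2 * PI)).
  { intros s Hs. apply (ex_RInt_continuous (V := R_CompleteNormedModule)). intros z _.
    now apply (CR_at_continuous u v s z), Hcr. }
  assert (Hper : forall s, v s (2 * PI) = v s 0).
  { intro s. unfold v, polar. now rewrite cos_2PI, sin_2PI, cos_0, sin_0. }
  assert (Heq : forall a, a <= ln r -> RInt (u (ln r)) 0 (2 * PI) = RInt (u a) 0 (2 * PI)).
  { intros a Ha.
    assert (G : bdry u v a (ln r) 0 (2 * PI) = 0).
    { apply goursat; [exact Ha | lra |]. intros s t Hs _. apply Hcr. lra. }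
    unfold bdry in G.
    rewrite (RInt_ext (V := R_CompleteNormedModule) (fun s => v s (2 * PI)) (fun s => v s 0)) in G
      by (intros; apply Hper).
    lra. }
  assert (Hup : RInt (u (ln r)) 0 (2 * PI) <= M * (2 * PI)).
  { apply Rle_trans with (RInt (fun _ => M) 0 (2 * PI)).
    - apply RInt_le; [lra | now apply Hex | apply ex_RInt_const |].
      intros t _. apply HM. rewrite Cmod_polar. apply exp_ln; lra.
    - rewrite RInt_const. apply Req_le.
      change ((2 * PI - 0) * M = M * (2 * PI)). ring. }
  apply le_epsilon. intros e He.
  assert (Hc : contC CU f (RtoC 0)).
  { apply (dif_continuous CU (fun z => z) (fun _ => RtoC 0)).
    - apply continuous_id.
    - apply continuous_const.
    - apply Hf. rewrite Cmod_0. lra. }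
  destruct (proj1 (continuous_C_eps CU f (RtoC 0)) Hc e He) as [d Hd].
  assert (Pd := cond_pos d).
  set (a := Rmin (ln r) (ln (d / 2))).
  assert (Ha : a <= ln r) by apply Rmin_l.
  assert (Had : exp a < d).
  { apply Rle_lt_trans with (exp (ln (d / 2))).
    - destruct (Rmin_r (ln r) (ln (d / 2))) as [K|K]; [left; now apply exp_increasing|].
      right. unfold a. now rewrite K.
    - rewrite exp_ln; lra. }
  assert (Hn : Rabs (RInt (u a) 0 (2 * PI) - fst (f (RtoC 0)) * (2 * PI - 0)) <= e * (2 * PI - 0)).
  { apply RInt_near_const; [lra | apply Hex; lra |]. intros t _.
    assert (K : Cmod (f (polar a t) - f (RtoC 0)) < e).
    { apply Hd. apply ball_CU. unfold Cminus. replace (polar a t + - 0)%C with (polar a t) by ring.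
      rewrite Cmod_polar. exact Had. }
    left. eapply Rle_lt_trans; [|exact K].
    eapply Rle_trans; [|apply Rmax_Cmod]. eapply Rle_trans; [|apply Rmax_l].
    apply Req_le. f_equal. }
  rewrite <- (Heq a Ha) in Hn. apply Rabs_le_between in Hn. nra.
Qed.

Lemma dif1_mult (f g : C -> C) (a : C) :
  dif1 f a -> dif1 g a -> dif1 (fun z => (f z * g z)%C) a.
Proof. exact (dif_mult CU (fun z => z) (fun _ => RtoC 0) f g a (continuous_id _) (continuous_const _ _)). Qed.

Lemma dif1_const (c a : C) : dif1 (fun _ => c) a.
Proof. exact (dif_const CU (fun z => z) (fun _ => RtoC 0) c a). Qed.

Lemma dif1_id (a : C) : dif1 (fun z => z) a.
Proof. exact (dif_fst CU (fun z => z) (fun _ => RtoC 0) a). Qed.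

Lemma dif1_minus (f g : C -> C) (a : C) :
  dif1 f a -> dif1 g a -> dif1 (fun z => (f z - g z)%C) a.
Proof. exact (dif_minus CU (fun z => z) (fun _ => RtoC 0) f g a). Qed.

Lemma dif1_div (f g : C -> C) (a : C) : g a <> 0%C ->
  dif1 f a -> dif1 g a -> dif1 (fun z => (f z / g z)%C) a.
Proof. exact (dif_div CU (fun z => z) (fun _ => RtoC 0) f g a (continuous_id _) (continuous_const _ _)). Qed.

Lemma dif1_pow (f : C -> C) (n : nat) (a : C) : dif1 f a -> dif1 (fun z => (f z ^ n)%C) a.
Proof. exact (dif_pow CU (fun z => z) (fun _ => RtoC 0) f n a (continuous_id _) (continuous_const _ _)). Qed.

(** A unimodular factor [c] turns the value at 0 into its modulus, which is a real part. *)
Lemma mean_value_Cmod (f : C -> C) (r M : R) : 0 < r < 1 ->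
  (forall z, Cmod z < 1 -> dif1 f z) -> (forall z, Cmod z = r -> Cmod (f z) <= M) ->
  Cmod (f (RtoC 0)) <= M.
Proof.
  intros Hr Hf HM. set (w := f (RtoC 0)).
  destruct (Ceq_dec w 0%C) as [E|E].
  { rewrite E, Cmod_0. eapply Rle_trans; [apply Cmod_ge_0 | apply (HM (RtoC r))].
    rewrite Cmod_R. apply Rabs_pos_eq; lra. }
  set (c := (Cconj w / Cmod w)%C). apply Cmod_gt_0 in E.
  assert (Ew : RtoC (Cmod w) <> 0%C) by (intro K; apply RtoC_inj in K; lra).
  assert (Hc : Cmod c = 1).
  { unfold c. rewrite Cmod_div, Cmod_conj, Cmod_R, Rabs_pos_eq by (assumption || lra). field; lra. }
  assert (Hcw : (c * w)%C = RtoC (Cmod w)).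
  { unfold c. replace (Cconj w / Cmod w * w)%C with (w * Cconj w / Cmod w)%C by (field; exact Ew).
    rewrite <- Cmod2_conj, RtoC_pow. field. exact Ew. }
  change (Cmod w) with (fst (RtoC (Cmod w))). rewrite <- Hcw.
  apply (mean_value_Re (fun z => (c * f z)%C) r M Hr).
  - intros z Hz. apply dif1_mult; [apply dif1_const | now apply Hf].
  - intros z Hz. eapply Rle_trans; [|apply (HM z Hz)].
    rewrite <- (Rmult_1_l (Cmod (f z))), <- Hc, <- Cmod_mult.
    eapply Rle_trans; [apply Rle_abs | apply re_le_Cmod].
Qed.

Lemma continuous_C_pow (U : UniformSpace) (f : U -> C) (n : nat) (a : U) :
  contC U f a -> contC U (fun z => (f z ^ n)%C) a.
Proof.
  intros H. induction n as [|n IH].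
  - exact (continuous_const (V := CU) (RtoC 1) a).
  - exact (continuous_C_mult U f (fun z => (f z ^ n)%C) a H IH).
Qed.

Lemma dif1_continuous (f : C -> C) (a : C) : dif1 f a -> contC CU f a.
Proof.
  exact (dif_continuous CU (fun z => z) (fun _ => RtoC 0) f a
    (continuous_id _) (continuous_const _ _)).
Qed.

(* [f N / (z - b)] need not be differentiable at the zero [b] of [f], but it is bounded there,
   and the additional factor [f] restores differentiability. *)
Lemma dif1_removable (f N D : C -> C) (b : C) (n : nat) :
  dif1 f b -> f b = 0%C -> dif1 N b -> dif1 D b -> D b <> 0%C ->
  dif1 (fun z => (f z * (f z * N z / ((z - b) * D z)) ^ n)%C) b.
Proof.
  intros (phi & psi & Hphi & _ & Hf) Hb HN HD Db.
  assert (CN := dif1_continuous _ _ HN). assert (CD := dif1_continuous _ _ HD).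
  exists (fun z => (phi z * (phi z * N z / D z) ^ n)%C), (fun _ => RtoC 0).
  split; [|split; [apply continuous_const|]].
  - apply continuous_C_mult; [exact Hphi|]. apply continuous_C_pow.
    apply continuous_C_mult; [now apply continuous_C_mult | now apply continuous_C_inv].
  - generalize (filter_and _ _ Hf (continuous_C_neq0 CU D b CD Db)). apply filter_imp.
    cut (forall z : C, f z = (f b + phi z * (z - b) + psi z * (0 - 0))%C /\ D z <> 0%C ->
      (f z * (f z * N z / ((z - b) * D z)) ^ n)%C =
      (f b * (f b * N b / ((b - b) * D b)) ^ n
       + phi z * (phi z * N z / D z) ^ n * (z - b) + 0 * (0 - 0))%C); [intro K; exact K|].
    intros z [E1 E2]. rewrite Hb in *.
    destruct (Ceq_dec z b) as [->|n0]; [rewrite Hb; ring|].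
    assert (n1 : (z - b)%C <> 0%C) by (intro K; apply n0; now apply Cminus_eq0).
    assert (E3 : f z = (phi z * (z - b))%C) by (rewrite E1; ring).
    rewrite E3.
    replace (phi z * (z - b) * N z / ((z - b) * D z))%C with (phi z * N z / D z)%C
      by (field; now split).
    ring.
Qed.

Lemma Cmod2_blaschke (b z : C) :
  Cmod (1 - Cconj b * z) ^ 2 - Cmod (z - b) ^ 2 = (1 - Cmod z ^ 2) * (1 - Cmod b ^ 2).
Proof. rewrite !Cmod2_alt. destruct b, z. simpl. ring. Qed.

Lemma one_minus_conj_neq0 (b z : C) : Cmod b < 1 -> Cmod z <= 1 -> (1 - Cconj b * z)%C <> 0%C.
Proof.
  intros Hb Hz E.
  assert (K : Cmod (Cconj b * z) = 1).
  { replace (Cconj b * z)%C with (RtoC 1) by (replace (Cconj b * z)%C with (1 - (1 - Cconj b * z))%C by ring; rewrite E; ring).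
    apply Cmod_1. }
  rewrite Cmod_mult, Cmod_conj in K. generalize (Cmod_ge_0 b) (Cmod_ge_0 z). nra.
Qed.

(** Close to the unit circle a Blaschke factor is almost unimodular: the defect in [Cmod2_blaschke]
    is small there, whereas [|1 - b~ z| >= 1 - |b|]. *)
Lemma blaschke_factor_bound (b z : C) (k : R) : Cmod b < 1 -> Cmod z < 1 -> 0 < k <= 1 ->
  (1 - Cmod z ^ 2) * (1 + Cmod b) <= (1 - k) * (1 - Cmod b) ->
  (z - b)%C <> 0%C /\ k * Cmod (1 - Cconj b * z) ^ 2 <= Cmod (z - b) ^ 2.
Proof.
  intros Hb Hz Hk H.
  assert (E := Cmod2_blaschke b z).
  assert (T : 1 - Cmod b <= Cmod (1 - Cconj b * z)).
  { generalize (Cmod_triangle (1 - Cconj b * z) (Cconj b * z)).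
    replace (1 - Cconj b * z + Cconj b * z)%C with (RtoC 1) by ring.
    rewrite Cmod_1, Cmod_mult, Cmod_conj. generalize (Cmod_ge_0 b) (Cmod_ge_0 z). nra. }
  assert (P := Cmod_ge_0 b).
  set (w := Cmod (1 - Cconj b * z)) in *. set (x := Cmod z) in *. set (y := Cmod b) in *.
  assert (K1 : (1 - x ^ 2) * (1 - y ^ 2) <= (1 - k) * (w ^ 2)).
  { apply Rle_trans with ((1 - k) * ((1 - y) * (1 - y))).
    - replace ((1 - x ^ 2) * (1 - y ^ 2)) with ((1 - x ^ 2) * (1 + y) * (1 - y)) by ring.
      rewrite <- Rmult_assoc. apply Rmult_le_compat_r; lra.
    - apply Rmult_le_compat_l; [lra|]. simpl. rewrite Rmult_1_r. apply Rmult_le_compat; lra. }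
  assert (K2 : k * w ^ 2 <= Cmod (z - b) ^ 2) by lra.
  split; [|exact K2]. apply Cmod_gt_0.
  assert (0 < k * w ^ 2) by (apply Rmult_lt_0_compat; [lra | apply pow_lt; lra]).
  destruct (Req_dec (Cmod (z - b)) 0) as [E0|E0]; [rewrite E0 in K2; lra|].
  generalize (Cmod_ge_0 (z - b)); lra.
Qed.

Lemma pow_1_plus_le (n : nat) (x : R) : 0 <= x <= 1 -> (1 + x) ^ n <= 1 + x * 3 ^ n.
Proof.
  intros Hx. induction n as [|n IH]; simpl; [lra|].
  assert (1 <= 3 ^ n) by (apply pow_R1_Rle; lra).
  apply Rle_trans with ((1 + x) * (1 + x * 3 ^ n)); [apply Rmult_le_compat_l; lra|].
  assert (x * (x * 3 ^ n) <= 1 * (x * 3 ^ n))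
    by (apply Rmult_le_compat_r; [apply Rmult_le_pos; lra | lra]).
  assert (x * 1 <= x * 3 ^ n) by (apply Rmult_le_compat_l; lra). nra.
Qed.

Lemma le_1_of_le_pow (a : R) (n : nat) : (forall x, 0 < x <= 1 -> a <= (1 + x) ^ n) -> a <= 1.
Proof.
  intros H. apply le_epsilon. intros e He.
  assert (P : 0 < 3 ^ n) by (apply pow_lt; lra).
  assert (Q : 0 < Rmin 1 (e / 3 ^ n)) by (apply Rmin_pos; [lra | now apply Rdiv_lt_0_compat]).
  assert (Q1 : Rmin 1 (e / 3 ^ n) <= 1) by apply Rmin_l.
  eapply Rle_trans; [apply (H _ (conj Q Q1))|].
  eapply Rle_trans; [apply pow_1_plus_le; lra|].
  apply Rplus_le_compat_l. apply Rle_trans with (e / 3 ^ n * 3 ^ n).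
  - apply Rmult_le_compat_r; [lra | apply Rmin_r].
  - apply Req_le. field. lra.
Qed.

Lemma le_1_of_pow_bounded (a q : R) : 0 < a -> 0 <= q -> (forall n, a * q ^ n <= 1) -> q <= 1.
Proof.
  intros Ha Hq H. destruct (Rle_dec q 1) as [L|L]; [exact L|]. exfalso.
  destruct (Pow_x_infinity q ltac:(rewrite Rabs_right; lra) (/ a + 1)) as [n Hn].
  specialize (Hn n (le_n n)). rewrite Rabs_right in Hn by (apply Rle_ge, pow_le; lra).
  specialize (H n).
  assert (a * (/ a + 1) <= a * q ^ n) by (apply Rmult_le_compat_l; lra).
  replace (a * (/ a + 1)) with (1 + a) in H0 by (field; lra). lra.
Qed.

(** The functions [H n], [f] times the [n]-th power of [f] over its Blaschke product, are at most
    [(1 + x)^n] on circles close to the boundary, for every small [x > 0]. Hence [|H n (0)| <= 1],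
    that is [|f(0)| (|f(0)| / |b1 b2|)^n <= 1] for all [n], and the ratio cannot exceed 1. *)
Lemma schwarz_two_zeros (f : C -> C) (b1 b2 : C) :
  (forall z, Cmod z < 1 -> dif1 f z /\ Cmod (f z) < 1) ->
  Cmod b1 < 1 -> Cmod b2 < 1 -> b1 <> b2 -> f b1 = 0%C -> f b2 = 0%C ->
  Cmod (f (RtoC 0)) <= Cmod b1 * Cmod b2.
Proof.
  intros Hf H1 H2 H12 F1 F2.
  destruct (Ceq_dec b1 0%C) as [E1|E1]; [rewrite <- E1, F1, E1, Cmod_0; lra|].
  destruct (Ceq_dec b2 0%C) as [E2|E2]; [rewrite <- E2, F2, E2, Cmod_0; lra|].
  destruct (Ceq_dec (f (RtoC 0)) 0%C) as [E0|E0].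
  { rewrite E0, Cmod_0. apply Rmult_le_pos; apply Cmod_ge_0. }
  set (N1 := fun z : C => (1 - Cconj b1 * z)%C). set (N2 := fun z : C => (1 - Cconj b2 * z)%C).
  set (H := fun (n : nat) (z : C) => (f z * (f z * (N1 z * N2 z) / ((z - b1) * (z - b2))) ^ n)%C).
  assert (DN1 : forall z, dif1 N1 z).
  { intro z. apply dif1_minus; [apply dif1_const | apply dif1_mult; [apply dif1_const | apply dif1_id]]. }
  assert (DN2 : forall z, dif1 N2 z).
  { intro z. apply dif1_minus; [apply dif1_const | apply dif1_mult; [apply dif1_const | apply dif1_id]]. }
  assert (DM : forall b z, dif1 (fun z => (z - b)%C) z).
  { intros b z. apply dif1_minus; [apply dif1_id | apply dif1_const]. }
  assert (Neq : forall a b : C, a <> b -> (a - b)%C <> 0%C).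
  { intros a b Hab K. apply Hab. now apply Cminus_eq0. }
  assert (HD : forall n z, Cmod z < 1 -> dif1 (H n) z).
  { intros n z Hz. destruct (Hf z Hz) as [Dz _].
    destruct (Ceq_dec z b1) as [K1|K1]; [|destruct (Ceq_dec z b2) as [K2|K2]].
    - subst z. apply (dif1_removable f (fun z => (N1 z * N2 z)%C) (fun z => (z - b2)%C)); auto.
      now apply dif1_mult.
    - subst z. apply (dif_ext_loc CU _ _
        (fun z => (f z * (f z * (N1 z * N2 z) / ((z - b2) * (z - b1))) ^ n)%C)).
      + apply filter_forall. intro z. unfold H. now rewrite (Cmult_comm (z - b2)%C).
      + apply (dif1_removable f (fun z => (N1 z * N2 z)%C) (fun z => (z - b1)%C)); auto.
        now apply dif1_mult.
    - apply dif1_mult; [exact Dz|]. apply (dif1_pow (fun z => (f z * (N1 z * N2 z) / ((z - b1) * (z - b2)))%C)).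
      apply (dif1_div (fun z => (f z * (N1 z * N2 z))%C) (fun z => ((z - b1) * (z - b2))%C)).
      + apply Cmult_neq_0; now apply Neq.
      + apply dif1_mult; [exact Dz | now apply dif1_mult].
      + apply dif1_mult; apply DM. }
  assert (P1 := Cmod_ge_0 b1). assert (P2 := Cmod_ge_0 b2).
  set (m := Rmax (Cmod b1) (Cmod b2)).
  assert (Hm : m < 1) by (now apply Rmax_lub_lt).
  assert (Hm0 : 0 <= m) by (eapply Rle_trans; [exact P1 | apply Rmax_l]).
  assert (HB : forall n k, 0 < k <= 1 -> Cmod (H n (RtoC 0)) <= (1 + k) ^ n).
  { intros n x Hx.
    set (k := / (1 + x)).
    assert (Hk0 : 0 < k) by (apply Rinv_0_lt_compat; lra).
    assert (Hk1 : k < 1) by (unfold k; rewrite <- Rinv_1; apply Rinv_lt_contravar; lra).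
    (* [t] makes the hypothesis of [blaschke_factor_bound] an equality at the larger modulus [m];
       the circle has radius [sqrt (1 - t)]. *)
    set (t := (1 - k) * (1 - m) / (1 + m)).
    assert (Ht : 0 < t <= 1 - k).
    { unfold t; split.
      - apply Rdiv_lt_0_compat; [apply Rmult_lt_0_compat; lra | lra].
      - apply Rmult_le_reg_r with (1 + m); [lra|]. unfold Rdiv.
        rewrite Rmult_assoc, Rinv_l, Rmult_1_r by lra. apply Rmult_le_compat_l; lra. }
    assert (Ht2 : t * (1 + m) = (1 - k) * (1 - m)) by (unfold t; field; lra).
    assert (Hr : 0 < sqrt (1 - t) < 1).
    { split; [apply sqrt_lt_R0; lra|]. rewrite <- sqrt_1 at 2. apply sqrt_lt_1; lra. }
    apply (mean_value_Cmod (H n) (sqrt (1 - t))); [exact Hr | apply HD |].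
    intros z Hz.
    assert (Hz2 : 1 - Cmod z ^ 2 = t) by (rewrite Hz, pow2_sqrt by lra; ring).
    assert (Hz1 : Cmod z < 1) by (rewrite Hz; lra).
    assert (Hyp : forall y, 0 <= y <= m -> (1 - Cmod z ^ 2) * (1 + y) <= (1 - k) * (1 - y)).
    { intros y Hy. rewrite Hz2. apply Rle_trans with (t * (1 + m)).
      - apply Rmult_le_compat_l; lra.
      - rewrite Ht2. apply Rmult_le_compat_l; lra. }
    destruct (blaschke_factor_bound b1 z k H1 Hz1 ltac:(lra)) as [A1 B1].
    { apply Hyp. split; [exact P1 | apply Rmax_l]. }
    destruct (blaschke_factor_bound b2 z k H2 Hz1 ltac:(lra)) as [A2 B2].
    { apply Hyp. split; [exact P2 | apply Rmax_r]. }
    destruct (Hf z Hz1) as [_ Fz].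
    unfold H. rewrite Cmod_mult, Cmod_pow, Cmod_div by (now apply Cmult_neq_0).
    rewrite !Cmod_mult. fold (N1 z) in B1. fold (N2 z) in B2.
    apply Cmod_gt_0 in A1. apply Cmod_gt_0 in A2.
    assert (Q1 := Cmod_ge_0 (N1 z)). assert (Q2 := Cmod_ge_0 (N2 z)). assert (Q3 := Cmod_ge_0 (f z)).
    set (d1 := Cmod (z - b1)) in *. set (d2 := Cmod (z - b2)) in *.
    set (n1 := Cmod (N1 z)) in *. set (n2 := Cmod (N2 z)) in *. set (y := Cmod (f z)) in *.
    assert (G : n1 * n2 / (d1 * d2) <= 1 + x).
    { apply Rmult_le_reg_r with (k * (d1 * d2)).
      { apply Rmult_lt_0_compat; [exact Hk0 | now apply Rmult_lt_0_compat]. }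
      replace (n1 * n2 / (d1 * d2) * (k * (d1 * d2))) with (k * (n1 * n2)) by (field; lra).
      replace ((1 + x) * (k * (d1 * d2))) with (d1 * d2) by (unfold k; field; lra).
      apply Rsqr_incr_0_var; [|apply Rmult_le_pos; lra]. unfold Rsqr.
      replace (k * (n1 * n2) * (k * (n1 * n2))) with ((k * n1 ^ 2) * (k * n2 ^ 2)) by ring.
      replace (d1 * d2 * (d1 * d2)) with (d1 ^ 2 * d2 ^ 2) by ring.
      apply Rmult_le_compat; try assumption; apply Rmult_le_pos; try lra; apply pow2_ge_0. }
    assert (G0 : 0 <= n1 * n2 / (d1 * d2)).
    { apply Rdiv_le_0_compat; [now apply Rmult_le_pos | now apply Rmult_lt_0_compat]. }
    replace (y * (n1 * n2) / (d1 * d2)) with (y * (n1 * n2 / (d1 * d2))) by (field; lra).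
    apply Rle_trans with (1 * (1 * (1 + x)) ^ n).
    - apply Rmult_le_compat; try lra.
      + apply pow_le, Rmult_le_pos; lra.
      + apply pow_incr. split; [apply Rmult_le_pos; lra|]. apply Rmult_le_compat; lra.
    - rewrite !Rmult_1_l. lra. }
  apply Cmod_gt_0 in E0. apply Cmod_gt_0 in E1. apply Cmod_gt_0 in E2.
  set (y := Cmod (f (RtoC 0))) in *.
  assert (PB : 0 < Cmod b1 * Cmod b2) by now apply Rmult_lt_0_compat.
  assert (Q : y / (Cmod b1 * Cmod b2) <= 1).
  { apply (le_1_of_pow_bounded y); [exact E0 | apply Rdiv_le_0_compat; lra |].
    intro n. eapply Rle_trans; [|apply (le_1_of_le_pow _ n (HB n))].
    unfold H. rewrite Cmod_mult, Cmod_pow, Cmod_div.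
    - rewrite !Cmod_mult. unfold N1, N2.
      replace (1 - Cconj b1 * 0)%C with (RtoC 1) by ring.
      replace (1 - Cconj b2 * 0)%C with (RtoC 1) by ring.
      replace (0 - b1)%C with (- b1)%C by ring. replace (0 - b2)%C with (- b2)%C by ring.
      rewrite !Cmod_opp, Cmod_1. fold y. rewrite !Rmult_1_r. lra.
    - apply Cmult_neq_0; apply Neq; intro K; rewrite <- K, Cmod_0 in *; lra. }
  apply Rmult_le_reg_r with (/ (Cmod b1 * Cmod b2)); [now apply Rinv_0_lt_compat|].
  rewrite Rinv_r by lra. exact Q.
Qed.

(** Multiply by the Blaschke factor of a second point [c], apply the case of two zeros and cancel
    [|c|]. The choice [b / 2] only serves to have a nonzero point of the disc other than [b]. *)
Lemma schwarz_one_zero (f : C -> C) (b : C) :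
  (forall z, Cmod z < 1 -> dif1 f z /\ Cmod (f z) < 1) ->
  Cmod b < 1 -> f b = 0%C -> Cmod (f (RtoC 0)) <= Cmod b.
Proof.
  intros Hf Hb Fb.
  destruct (Ceq_dec b 0%C) as [E|E]; [rewrite <- E, Fb, E, Cmod_0; lra|].
  set (c := (b / 2)%C).
  assert (H2 : RtoC 2 <> 0%C) by (intro K; apply RtoC_inj in K; lra).
  assert (Hcb : c <> b).
  { intro K. apply E. transitivity (2 * (b - c))%C; [unfold c; field; exact H2 | rewrite K; ring]. }
  assert (Mc : Cmod c = Cmod b / 2).
  { unfold c. rewrite Cmod_div, Cmod_R, Rabs_pos_eq by (exact H2 || lra). reflexivity. }
  assert (P := Cmod_ge_0 b). apply Cmod_gt_0 in E.
  assert (Hc : Cmod c < 1) by lra. clearbody c.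
  assert (K := schwarz_two_zeros (fun z => (f z * ((z - c) / (1 - Cconj c * z)))%C) b c).
  cbv beta in K. rewrite Fb in K.
  assert (D0 : forall z : C, Cmod z < 1 -> (1 - Cconj c * z)%C <> 0%C)
    by (intros z Hz; apply one_minus_conj_neq0; lra).
  replace (1 - Cconj c * 0)%C with (RtoC 1) in K by ring.
  replace ((0 - c) / 1)%C with (- c)%C in K by field.
  rewrite Cmod_mult, Cmod_opp in K.
  apply Rmult_le_reg_r with (Cmod c); [lra|]. apply K.
  - intros z Hz. destruct (Hf z Hz) as [Dz Fz]. split.
    + apply dif1_mult; [exact Dz|].
      apply (dif1_div (fun z => (z - c)%C) (fun z => (1 - Cconj c * z)%C)); [now apply D0 | |].
      * apply dif1_minus; [apply dif1_id | apply dif1_const].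
      * apply dif1_minus; [apply dif1_const | apply dif1_mult; [apply dif1_const | apply dif1_id]].
    + rewrite Cmod_mult.
      assert (G : Cmod ((z - c) / (1 - Cconj c * z)) <= 1).
      { rewrite Cmod_div by now apply D0. assert (Q := D0 z Hz). apply Cmod_gt_0 in Q.
        apply Rmult_le_reg_r with (Cmod (1 - Cconj c * z)); [exact Q|].
        unfold Rdiv. rewrite Rmult_assoc, Rinv_l, Rmult_1_r, Rmult_1_l by lra.
        apply Rsqr_incr_0_var; [|lra]. unfold Rsqr.
        generalize (Cmod2_blaschke c z) (Cmod_ge_0 c) (Cmod_ge_0 z). intros B1 B2 B3.
        assert (S1 : forall x, 0 <= x -> x < 1 -> 0 <= 1 - x ^ 2)
          by (intros x X1 X2; replace (1 - x ^ 2) with ((1 - x) * (1 + x)) by ring; apply Rmult_le_pos; lra).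
        generalize (Rmult_le_pos _ _ (S1 _ B3 Hz) (S1 _ B2 Hc)). lra. }
      generalize (Rmult_le_compat_l _ _ _ (Cmod_ge_0 (f z)) G). lra.
  - exact Hb.
  - exact Hc.
  - intro K'. apply Hcb. now symmetry.
  - ring.
  - replace (c - c)%C with (RtoC 0) by ring. unfold Cdiv. ring.
Qed.

(** * Holomorphic maps of the disc and the bidisc *)

(** Squared modulus without a square root: a polynomial in the coordinates, so that identities
    between moduli reduce to [ring]. *)
Definition nsq (z : C) : R := fst z * fst z + snd z * snd z.

Lemma Cmod_sqr (z : C) : Cmod z * Cmod z = nsq z.
Proof.
  unfold Cmod, nsq. rewrite sqrt_sqrt; [ring|].
  generalize (pow2_ge_0 (fst z)) (pow2_ge_0 (snd z)). lra.
Qed.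

Lemma nsq_pos (z : C) : 0 <= nsq z.
Proof. rewrite <- Cmod_sqr. apply Rmult_le_pos; apply Cmod_ge_0. Qed.

Lemma nsq_mult (z w : C) : nsq (z * w) = nsq z * nsq w.
Proof. unfold nsq; destruct z, w; simpl; ring. Qed.

Lemma nsq_conj (z : C) : nsq (Cconj z) = nsq z.
Proof. unfold nsq; destruct z; simpl; ring. Qed.

Lemma nsq_opp (z : C) : nsq (- z) = nsq z.
Proof. unfold nsq; destruct z; simpl; ring. Qed.

Lemma nsq_RtoC (x : R) : nsq (RtoC x) = x * x.
Proof. unfold nsq; simpl; ring. Qed.

Lemma nsq_eq0 (z : C) : nsq z = 0 -> z = 0%C.
Proof.
  intro H. apply Cmod_eq_0. rewrite <- Cmod_sqr in H. now apply Rsqr_0_uniq.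
Qed.

Lemma nsq_neq0 (z : C) : z <> 0%C -> 0 < nsq z.
Proof.
  intro H. destruct (nsq_pos z) as [K|K]; [exact K|]. exfalso; apply H, nsq_eq0. now symmetry.
Qed.

Lemma nsq_pos_neq0 (z : C) : 0 < nsq z -> z <> 0%C.
Proof. intros H E. rewrite E, nsq_RtoC in H. lra. Qed.

Lemma nsq_div (z w : C) : w <> 0%C -> nsq (z / w) = nsq z / nsq w.
Proof.
  intro H. assert (K := nsq_neq0 w H).
  apply Rmult_eq_reg_r with (nsq w); [|lra].
  rewrite <- nsq_mult. replace (z / w * w)%C with z by (field; exact H). field. lra.
Qed.

Lemma nsq_le (z w : C) : nsq z <= nsq w <-> Cmod z <= Cmod w.
Proof.
  rewrite <- !Cmod_sqr. split; intro H.
  - apply Rsqr_incr_0_var; [exact H | apply Cmod_ge_0].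
  - apply Rsqr_incr_1; [exact H | apply Cmod_ge_0 | apply Cmod_ge_0].
Qed.

Lemma nsq_lt (z w : C) : nsq z < nsq w <-> Cmod z < Cmod w.
Proof. generalize (nsq_le w z). lra. Qed.

Lemma nsq_lt1 (z : C) : nsq z < 1 <-> Cmod z < 1.
Proof.
  generalize (nsq_lt z (RtoC 1)). rewrite nsq_RtoC, Cmod_1, Rmult_1_l. tauto.
Qed.

Lemma nsq_le1 (z : C) : nsq z <= 1 <-> Cmod z <= 1.
Proof.
  generalize (nsq_le z (RtoC 1)). rewrite nsq_RtoC, Cmod_1, Rmult_1_l. tauto.
Qed.

Lemma nsq_eq1 (z : C) : nsq z = 1 <-> Cmod z = 1.
Proof. generalize (nsq_le1 z) (nsq_lt1 z). lra. Qed.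

Lemma Cconj_mult_nsq (z : C) : (z * Cconj z)%C = RtoC (nsq z).
Proof. unfold nsq; destruct z; apply injective_projections; simpl; ring. Qed.

Lemma nsq_one_minus (a w : C) :
  nsq (1 - Cconj a * w) - nsq (w - a) = (1 - nsq a) * (1 - nsq w).
Proof. unfold nsq; destruct a, w; simpl; ring. Qed.

Lemma nsq_one_plus (a w : C) :
  nsq (1 + Cconj a * w) - nsq (a + w) = (1 - nsq a) * (1 - nsq w).
Proof. unfold nsq; destruct a, w; simpl; ring. Qed.

(** For [|a| < 1] the automorphism of the disc that sends 0 to [a] and [- a] to 0; its inverse is
    [mob (- a)]. *)
Definition mob (a w : C) : C := ((a + w) / (1 + Cconj a * w))%C.

Lemma mob_den_neq0 (a w : C) : nsq a * nsq w < 1 -> (1 + Cconj a * w)%C <> 0%C.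
Proof.
  intros H E.
  assert (K : nsq (Cconj a * w) = 1).
  { replace (Cconj a * w)%C with (1 + Cconj a * w - 1)%C by ring.
    rewrite E. unfold nsq; simpl; ring. }
  rewrite nsq_mult, nsq_conj in K. lra.
Qed.

Lemma nsq_mult_lt1 (a w : C) : nsq a < 1 -> nsq w <= 1 -> nsq a * nsq w < 1.
Proof. intros. generalize (nsq_pos a) (nsq_pos w). nra. Qed.

Lemma nsq_mob (a w : C) : nsq a < 1 -> nsq w <= 1 ->
  1 - nsq (mob a w) = (1 - nsq a) * (1 - nsq w) / nsq (1 + Cconj a * w).
Proof.
  intros Ha Hw. assert (K := mob_den_neq0 a w (nsq_mult_lt1 a w Ha Hw)).
  unfold mob. rewrite nsq_div by exact K. rewrite <- nsq_one_plus.
  field. apply Rgt_not_eq, nsq_neq0, K.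
Qed.

Lemma mob_le1 (a w : C) : nsq a < 1 -> nsq w <= 1 -> nsq (mob a w) <= 1.
Proof.
  intros Ha Hw. assert (K := nsq_neq0 _ (mob_den_neq0 a w (nsq_mult_lt1 a w Ha Hw))).
  assert (E := nsq_mob a w Ha Hw).
  assert (0 <= (1 - nsq a) * (1 - nsq w) / nsq (1 + Cconj a * w)); [|lra].
  apply Rdiv_le_0_compat; [apply Rmult_le_pos; lra | exact K].
Qed.

Lemma mob_lt1 (a w : C) : nsq a < 1 -> nsq w < 1 -> nsq (mob a w) < 1.
Proof.
  intros Ha Hw. assert (K := nsq_neq0 _ (mob_den_neq0 a w (nsq_mult_lt1 a w Ha (Rlt_le _ _ Hw)))).
  assert (E := nsq_mob a w Ha (Rlt_le _ _ Hw)).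
  assert (0 < (1 - nsq a) * (1 - nsq w) / nsq (1 + Cconj a * w)); [|lra].
  apply Rdiv_lt_0_compat; [apply Rmult_lt_0_compat; lra | exact K].
Qed.

Lemma mob_opp_self (a : C) : mob (- a) a = 0%C.
Proof. unfold mob. replace (- a + a)%C with (RtoC 0) by ring. unfold Cdiv. ring. Qed.

Lemma mob_0_r (a : C) : mob a 0 = a.
Proof. unfold mob. replace (1 + Cconj a * 0)%C with (RtoC 1) by ring. field. Qed.

Lemma mob_cancel (a w : C) : nsq a < 1 -> nsq w < 1 -> mob a (mob (- a) w) = w.
Proof.
  intros Ha Hw.
  assert (K1 : (1 + Cconj (- a) * w)%C <> 0%C).
  { apply mob_den_neq0. rewrite nsq_opp. apply nsq_mult_lt1; lra. }
  assert (K2 : (1 + Cconj a * mob (- a) w)%C <> 0%C).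
  { apply mob_den_neq0, nsq_mult_lt1; [exact Ha|]. left. apply mob_lt1; [now rewrite nsq_opp | exact Hw]. }
  unfold mob in *. rewrite Copp_conj in *.
  assert (K3 : (1 - a * Cconj a)%C <> 0%C).
  { rewrite Cconj_mult_nsq, <- RtoC_minus. intro E; apply RtoC_inj in E. lra. }
  field. split; [exact K1|].
  now replace (1 + - Cconj a * w + Cconj a * (- a + w))%C with (1 - a * Cconj a)%C by ring.
Qed.

(** * Compositions of holomorphic maps with values in the disc *)

Definition holo1 (f : C -> C) : Prop := forall z, nsq z < 1 -> dif1 f z /\ nsq (f z) < 1.
Definition holo2 (F : C * C -> C) : Prop :=
  forall a : C * C, nsq (fst a) < 1 -> nsq (snd a) < 1 -> dif2 F a /\ nsq (F a) < 1.

Lemma dif_mob (U : UniformSpace) (x y F : U -> C) (b : C) (a : U) :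
  contC U x a -> contC U y a -> nsq b < 1 -> nsq (F a) <= 1 ->
  dif U x y F a -> dif U x y (fun z => mob b (F z)) a.
Proof.
  intros Hx Hy Hb HF D. unfold mob.
  apply (dif_div U x y (fun z => (b + F z)%C) (fun z => (1 + Cconj b * F z)%C)); try assumption.
  - apply mob_den_neq0, nsq_mult_lt1; assumption.
  - apply dif_plus; [apply dif_const | exact D].
  - apply dif_plus; [apply dif_const | apply dif_mult; try assumption; apply dif_const].
Qed.

Lemma dif1_mob (f : C -> C) (b z : C) :
  nsq b < 1 -> nsq (f z) <= 1 -> dif1 f z -> dif1 (fun z => mob b (f z)) z.
Proof. exact (dif_mob CU (fun z => z) (fun _ => RtoC 0) f b z (continuous_id _) (continuous_const _ _)). Qed.

Lemma holo1_mob (b : C) : nsq b < 1 -> holo1 (mob b).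
Proof.
  intros Hb z Hz. split; [apply (dif1_mob (fun z => z)); [exact Hb | lra | apply dif1_id] | now apply mob_lt1].
Qed.

Lemma holo1_mob_comp (b : C) (f : C -> C) : nsq b < 1 -> holo1 f -> holo1 (fun z => mob b (f z)).
Proof.
  intros Hb Hf z Hz. destruct (Hf z Hz) as [D K]. split; [|now apply mob_lt1].
  apply dif1_mob; [exact Hb | lra | exact D].
Qed.

Lemma contC_fst (a : C * C) : contC CU2 fst a.
Proof. apply (continuous_fst (U := CU) (V := CU)). Qed.

Lemma contC_snd (a : C * C) : contC CU2 snd a.
Proof. apply (continuous_snd (U := CU) (V := CU)). Qed.

Lemma holo2_mob_comp (b : C) (F : C * C -> C) :
  nsq b < 1 -> holo2 F -> holo2 (fun a => mob b (F a)).
Proof.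
  intros Hb HF a H1 H2. destruct (HF a H1 H2) as [D K]. split; [|now apply mob_lt1].
  apply (dif_mob CU2); try assumption; [apply contC_fst | apply contC_snd | lra].
Qed.

Lemma continuous_pair (U : UniformSpace) (f g : U -> C) (a : U) :
  contC U f a -> contC U g a -> @continuous U CU2 (fun z => (f z, g z)) a.
Proof.
  intros Hf Hg. apply (proj2 (filterlim_locally (U := CU2) (fun z => (f z, g z)) (f a, g a))).
  intro e.
  assert (Kf := proj1 (filterlim_locally (U := CU) f (f a)) Hf e).
  assert (Kg := proj1 (filterlim_locally (U := CU) g (g a)) Hg e).
  generalize (filter_and _ _ Kf Kg). apply filter_imp. intros z [E1 E2]. now split.
Qed.

Lemma holo2_comp1 (F : C * C -> C) (f g : C -> C) :
  holo2 F -> holo1 f -> holo1 g -> holo1 (fun z => F (f z, g z)).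
Proof.
  intros HF Hf Hg z Hz. destruct (Hf z Hz) as [Df Kf], (Hg z Hz) as [Dg Kg].
  destruct (HF (f z, g z) Kf Kg) as [DF KF]. split; [|exact KF].
  apply (dif_comp CU CU2 (fun z => z) (fun _ => RtoC 0) fst snd F (fun z => (f z, g z))).
  - apply continuous_id.
  - apply continuous_const.
  - apply continuous_pair; now apply dif1_continuous.
  - exact Df.
  - exact Dg.
  - exact DF.
Qed.

Lemma dif2_fst_comp (f : C -> C) (a : C * C) : dif1 f (fst a) -> dif2 (fun b => f (fst b)) a.
Proof.
  intro D.
  apply (dif_comp CU2 CU fst snd (fun z => z) (fun _ => RtoC 0) f fst).
  - apply contC_fst.
  - apply contC_snd.
  - apply contC_fst.
  - apply (dif_fst CU2 fst snd).
  - apply (dif_const CU2 fst snd).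
  - exact D.
Qed.

Lemma dif2_snd_comp (f : C -> C) (a : C * C) : dif1 f (snd a) -> dif2 (fun b => f (snd b)) a.
Proof.
  intro D.
  apply (dif_comp CU2 CU fst snd (fun z => z) (fun _ => RtoC 0) f snd).
  - apply contC_fst.
  - apply contC_snd.
  - apply contC_snd.
  - apply (dif_snd CU2 fst snd).
  - apply (dif_const CU2 fst snd).
  - exact D.
Qed.

Lemma holo2_comp2 (F : C * C -> C) (f g : C -> C) :
  holo2 F -> holo1 f -> holo1 g -> holo2 (fun a => F (f (fst a), g (snd a))).
Proof.
  intros HF Hf Hg a H1 H2. destruct (Hf _ H1) as [Df Kf], (Hg _ H2) as [Dg Kg].
  destruct (HF (f (fst a), g (snd a)) Kf Kg) as [DF KF]. split; [|exact KF].
  apply (dif_comp CU2 CU2 fst snd fst snd F (fun a => (f (fst a), g (snd a)))).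
  - apply contC_fst.
  - apply contC_snd.
  - apply (continuous_pair CU2 (fun a => f (fst a)) (fun a => g (snd a))).
    + apply (dif_continuous CU2 fst snd (fun a => f (fst a)));
      [apply contC_fst | apply contC_snd | now apply dif2_fst_comp].
    + apply (dif_continuous CU2 fst snd (fun a => g (snd a)));
      [apply contC_fst | apply contC_snd | now apply dif2_snd_comp].
  - now apply dif2_fst_comp.
  - now apply dif2_snd_comp.
  - exact DF.
Qed.

Lemma holo2_swap (F : C * C -> C) : holo2 F -> holo2 (fun a => F (snd a, fst a)).
Proof.
  intros HF a H1 H2. destruct (HF (snd a, fst a) H2 H1) as [DF KF]. split; [|exact KF].
  apply (dif_comp CU2 CU2 fst snd fst snd F (fun a => (snd a, fst a))).
  - apply contC_fst.
  - apply contC_snd.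
  - apply (continuous_pair CU2 snd fst); [apply contC_snd | apply contC_fst].
  - apply (dif_snd CU2 fst snd).
  - apply (dif_fst CU2 fst snd).
  - exact DF.
Qed.

Lemma holo2_fst (f : C -> C) : holo1 f -> holo2 (fun a => f (fst a)).
Proof.
  intros Hf a H1 H2. destruct (Hf _ H1) as [D K]. split; [now apply dif2_fst_comp | exact K].
Qed.

Lemma holo1_iff (f : C -> C) : holo1 f <->
  forall z, inD z -> C_differentiable_at f z /\ inD (f z).
Proof.
  unfold inD. split; intros H z Hz.
  - rewrite Cabs_Cmod in *. apply nsq_lt1 in Hz. destruct (H z Hz) as [D K].
    split; [now apply dif1_iff | now apply nsq_lt1].
  - apply nsq_lt1 in Hz. rewrite <- Cabs_Cmod in Hz. destruct (H z Hz) as [D K].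
    rewrite Cabs_Cmod in K. split; [now apply dif1_iff | now apply nsq_lt1].
Qed.

Lemma holo2_iff (F : C * C -> C) : holo_D2_D F <-> holo2 F.
Proof.
  unfold holo_D2_D, inD2, inD. split.
  - intros H a H1 H2. apply nsq_lt1 in H1. apply nsq_lt1 in H2.
    destruct (H a) as [K D]; [now rewrite !Cabs_Cmod|]. rewrite Cabs_Cmod in K.
    split; [now apply dif2_iff | now apply nsq_lt1].
  - intros H a [H1 H2]. rewrite Cabs_Cmod in *. apply nsq_lt1 in H1. apply nsq_lt1 in H2.
    destruct (H a H1 H2) as [D K]. split; [now apply nsq_lt1 | now apply dif2_iff].
Qed.

Lemma holo_D_D2_iff (psi : C -> C * C) :
  holo_D_D2 psi <-> holo1 (fun l => fst (psi l)) /\ holo1 (fun l => snd (psi l)).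
Proof.
  rewrite !holo1_iff. unfold holo_D_D2, inD2. split.
  - intro H. split; intros z Hz; destruct (H z Hz) as ([K1 K2] & D1 & D2); now split.
  - intros [H1 H2] z Hz. destruct (H1 z Hz), (H2 z Hz). repeat split; assumption.
Qed.

(** * Nevanlinna-Pick interpolation with three points *)

(** Moduli in place of their logarithms, and the two components of a disc as separate functions;
    logarithms are taken only in the final theorem. *)
Definition cara_val (p q z : C * C) (r : R) : Prop :=
  exists F, holo2 F /\ F p = 0%C /\ F q = 0%C /\ Cmod (F z) = r.

Definition lemp_val (p q z : C * C) (r : R) : Prop :=
  exists (f g : C -> C) (l m : C), holo1 f /\ holo1 g /\ nsq l < 1 /\ nsq m < 1 /\
    (f (RtoC 0), g (RtoC 0)) = z /\ (f l, g l) = p /\ (f m, g m) = q /\ r = Cmod l * Cmod m.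

(** [F] composed with the disc is a self-map of the unit disc that vanishes at [l] and [m], and
    these differ because [p] and [q] do. *)
Lemma cara_val_le_lemp_val (p q z : C * C) (r s : R) :
  p <> q -> cara_val p q z r -> lemp_val p q z s -> r <= s.
Proof.
  intros Hpq (F & HF & Fp & Fq & <-) (f & g & l & m & Hf & Hg & Hl & Hm & E0 & E1 & E2 & ->).
  rewrite <- E0. apply (schwarz_two_zeros (fun z => F (f z, g z))).
  - intros w Hw. apply nsq_lt1 in Hw. destruct (holo2_comp1 F f g HF Hf Hg w Hw) as [D K].
    split; [exact D | now apply nsq_lt1].
  - now apply nsq_lt1.
  - now apply nsq_lt1.
  - intro K. apply Hpq. rewrite <- E1, <- E2, K. reflexivity.
  - now rewrite E1.
  - now rewrite E2.
Qed.

(* Determinant of the reduced Pick matrix of the problem [0 -> 0], [l -> p], [m -> q]. *)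
Definition pick (p q l m : C) : R :=
  (nsq l - nsq p) * (nsq m - nsq q) * nsq (1 - Cconj l * m)
  - (1 - nsq l) * (1 - nsq m) * nsq (Cconj l * m - Cconj p * q).

(** Positive semidefiniteness of the reduced Pick matrix, read off from its diagonal and its
    determinant. With the denominators cleared it stays meaningful, and closed, for [|l| = 1] or
    [|m| = 1]. *)
Definition feas (p q l m : C) : Prop :=
  nsq p <= nsq l /\ nsq q <= nsq m /\ 0 <= pick p q l m.

(** In the quotients [a = p / l], [b = q / m] the determinant condition becomes the Schwarz-Pick
    inequality: the pseudohyperbolic distance of [a], [b] is at most that of [l], [m]. *)
Lemma pick_factor (a b l m : C) :
  pick (a * l) (b * m) l m =
  nsq l * nsq m * (nsq (m - l) * nsq (1 - Cconj a * b) - nsq (b - a) * nsq (1 - Cconj l * m)).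
Proof.
  unfold pick. replace (Cconj l * m - Cconj (a * l) * (b * m))%C
    with (Cconj l * m * (1 - Cconj a * b))%C by (rewrite Cmult_conj; ring).
  rewrite !nsq_mult, nsq_conj.
  replace (nsq (b - a)) with (nsq (1 - Cconj a * b) - (1 - nsq a) * (1 - nsq b))
    by (rewrite <- nsq_one_minus; ring).
  replace (nsq (m - l)) with (nsq (1 - Cconj l * m) - (1 - nsq l) * (1 - nsq m))
    by (rewrite <- nsq_one_minus; ring).
  ring.
Qed.

Lemma Cminus_neq0 (a b : C) : a <> b -> (a - b)%C <> 0%C.
Proof. intros H K. apply H. now apply Cminus_eq0. Qed.

Lemma one_minus_neq0 (a b : C) : nsq a * nsq b < 1 -> (1 - Cconj a * b)%C <> 0%C.
Proof.
  intro H. replace (1 - Cconj a * b)%C with (1 + Cconj (- a) * b)%C by (rewrite Copp_conj; ring).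
  apply mob_den_neq0. now rewrite nsq_opp.
Qed.

(** The quotient of [mob (- a) b] by [mob (- l) m]. After division by [x], a step of the Schur
    algorithm moves [l] and [a] to 0, and multiplication by this constant takes the image of [m] to
    that of [b]; [pick_sol] undoes the changes of variable. *)
Definition pick_coef (a b l m : C) : C :=
  ((b - a) * (1 - Cconj l * m) / ((1 - Cconj a * b) * (m - l)))%C.

Definition pick_sol (a b l m : C) (x : C) : C :=
  (x * mob a (pick_coef a b l m * mob (- l) x))%C.

Lemma nsq_pick_coef (a b l m : C) : nsq a < 1 -> nsq b <= 1 -> l <> m ->
  l <> 0%C -> m <> 0%C -> 0 <= pick (a * l) (b * m) l m ->
  nsq (pick_coef a b l m) <= 1 /\
  (pick (a * l) (b * m) l m = 0 -> nsq (pick_coef a b l m) = 1).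
Proof.
  intros Ha Hb Hlm Hl Hm. rewrite pick_factor.
  assert (K1 := nsq_neq0 _ (one_minus_neq0 a b (nsq_mult_lt1 a b Ha Hb))).
  assert (K2 := nsq_neq0 _ (Cminus_neq0 m l (fun e => Hlm (eq_sym e)))).
  assert (K3 : 0 < nsq l * nsq m) by (apply Rmult_lt_0_compat; now apply nsq_neq0).
  unfold pick_coef. rewrite nsq_div, !nsq_mult
    by (apply nsq_pos_neq0; rewrite nsq_mult; now apply Rmult_lt_0_compat).
  set (u := nsq (1 - Cconj a * b)) in *. set (v := nsq (m - l)) in *.
  set (w := nsq (b - a) * nsq (1 - Cconj l * m)).
  assert (K4 : 0 < u * v) by now apply Rmult_lt_0_compat.
  intro H. split.
  - apply Rmult_le_reg_r with (u * v); [exact K4|]. unfold Rdiv.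
    rewrite Rmult_assoc, Rinv_l, Rmult_1_r, Rmult_1_l by lra.
    assert (0 <= v * u - w); [|lra].
    apply Rmult_le_reg_l with (nsq l * nsq m); [exact K3|]. rewrite Rmult_0_r. exact H.
  - intro E. apply Rmult_integral in E. destruct E as [E|E]; [lra|].
    replace w with (u * v) by lra. field. split; lra.
Qed.

Lemma pick_sol_values (a b l m : C) : nsq a < 1 -> nsq b <= 1 -> l <> m ->
  nsq l < 1 -> nsq m < 1 ->
  pick_sol a b l m 0 = 0%C /\ pick_sol a b l m l = (a * l)%C /\ pick_sol a b l m m = (b * m)%C.
Proof.
  intros Ha Hb Hlm Hl Hm. unfold pick_sol. split; [ring|]. split.
  - rewrite mob_opp_self, Cmult_0_r, mob_0_r. ring.
  - assert (K1 := one_minus_neq0 a b (nsq_mult_lt1 a b Ha Hb)).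
    assert (K2 := Cminus_neq0 m l (fun e => Hlm (eq_sym e))).
    assert (K3 := one_minus_neq0 l m (nsq_mult_lt1 l m Hl (Rlt_le _ _ Hm))).
    replace (pick_coef a b l m * mob (- l) m)%C with (mob (- a) b).
    + rewrite Cmult_comm. f_equal. destruct (Rle_lt_or_eq _ _ Hb) as [Hb'|_]; [now apply mob_cancel|].
      unfold mob. rewrite Copp_conj.
      assert (K4 : (1 - Cconj a * a)%C <> 0%C) by (apply one_minus_neq0, nsq_mult_lt1; lra).
      field. split.
      * now replace (1 + - Cconj a * b)%C with (1 - Cconj a * b)%C by ring.
      * now replace (1 + - Cconj a * b + Cconj a * (- a + b))%C with (1 - Cconj a * a)%C by ring.
    + unfold mob, pick_coef. rewrite !Copp_conj.
      replace (1 + - Cconj a * b)%C with (1 - Cconj a * b)%C by ring.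
      replace (1 + - Cconj l * m)%C with (1 - Cconj l * m)%C by ring.
      field. repeat split; assumption.
Qed.

Lemma holo1_pick_sol (a b l m : C) : nsq a < 1 -> nsq l < 1 ->
  nsq (pick_coef a b l m) <= 1 -> holo1 (pick_sol a b l m).
Proof.
  intros Ha Hl Hc z Hz. unfold pick_sol. set (c := pick_coef a b l m) in *.
  assert (Hl' : nsq (- l) < 1) by now rewrite nsq_opp.
  assert (K : nsq (mob (- l) z) < 1) by now apply mob_lt1.
  assert (K2 : nsq (c * mob (- l) z) <= 1).
  { rewrite nsq_mult. generalize (nsq_pos c) (nsq_pos (mob (- l) z)). nra. }
  split.
  - apply dif1_mult; [apply dif1_id|].
    apply (dif1_mob (fun z => (c * mob (- l) z)%C)); [exact Ha | exact K2 |].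
    apply dif1_mult; [apply dif1_const|].
    apply (dif1_mob (fun z => z)); [exact Hl' | lra | apply dif1_id].
  - rewrite nsq_mult. assert (Q := mob_le1 a _ Ha K2).
    generalize (nsq_pos z) (nsq_pos (mob a (c * mob (- l) z))). nra.
Qed.

Lemma holo1_rot (a : C) : nsq a <= 1 -> holo1 (fun z => (a * z)%C).
Proof.
  intros Ha z Hz. split.
  - apply dif1_mult; [apply dif1_const | apply dif1_id].
  - rewrite nsq_mult. generalize (nsq_pos a) (nsq_pos z). nra.
Qed.

Lemma feas_interp (p q l m : C) : l <> m -> l <> 0%C -> m <> 0%C -> nsq l < 1 -> nsq m < 1 ->
  feas p q l m -> exists f, holo1 f /\ f (RtoC 0) = 0%C /\ f l = p /\ f m = q.
Proof.
  intros Hlm Hl0 Hm0 Hl Hm (H1 & H2 & H3).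
  assert (Ep : p = (p / l * l)%C) by (field; exact Hl0).
  assert (Eq : q = (q / m * m)%C) by (field; exact Hm0).
  assert (Pl := nsq_neq0 l Hl0). assert (Pm := nsq_neq0 m Hm0).
  assert (Ha : nsq (p / l) <= 1).
  { rewrite nsq_div by exact Hl0. apply Rmult_le_reg_r with (nsq l); [exact Pl|].
    unfold Rdiv. rewrite Rmult_assoc, Rinv_l by lra. lra. }
  assert (Hb : nsq (q / m) <= 1).
  { rewrite nsq_div by exact Hm0. apply Rmult_le_reg_r with (nsq m); [exact Pm|].
    unfold Rdiv. rewrite Rmult_assoc, Rinv_l by lra. lra. }
  rewrite Ep, Eq in H3. rewrite Ep, Eq.
  set (a := (p / l)%C) in *. set (b := (q / m)%C) in *. clearbody a b.
  destruct (Rle_lt_or_eq _ _ Ha) as [Ha'|Ha'].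
  - exists (pick_sol a b l m). split; [|apply pick_sol_values; assumption].
    apply holo1_pick_sol; [exact Ha' | exact Hl |]. now apply nsq_pick_coef.
  (* If [|a| = 1] then [|1 - a~ b| = |b - a|], so the determinant is a negative multiple of
     [|b - a|^2]; hence [a = b], and a rotation interpolates. *)
  - assert (E : a = b).
    { rewrite pick_factor in H3.
      assert (K3 : 0 < nsq l * nsq m) by now apply Rmult_lt_0_compat.
      assert (K4 : 0 < (1 - nsq l) * (1 - nsq m)) by (apply Rmult_lt_0_compat; lra).
      assert (E1 := nsq_one_minus a b). assert (E2 := nsq_one_minus l m).
      rewrite Ha' in E1. replace (nsq (1 - Cconj a * b)) with (nsq (b - a)) in H3 by lra.
      assert (H4 : 0 <= nsq (b - a) * (nsq (m - l) - nsq (1 - Cconj l * m))).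
      { apply Rmult_le_reg_l with (nsq l * nsq m); [exact K3|]. rewrite Rmult_0_r.
        eapply Rle_trans; [exact H3|]. apply Req_le. ring. }
      assert (H5 := nsq_pos (b - a)).
      symmetry. apply Cminus_eq0, nsq_eq0. nra. }
    exists (fun z => (a * z)%C). split; [now apply holo1_rot|]. rewrite <- E.
    repeat split. ring.
Qed.

(** At [l = m] the determinant equals [- (1 - |l|^2)^2 |l|^2 |q - p|^2]. *)
Lemma feas_neq (p q l m : C) : l <> 0%C -> nsq l < 1 -> feas p q l m -> l = m -> p = q.
Proof.
  intros Hl0 Hl (H1 & H2 & H3) <-. symmetry. apply Cminus_eq0, nsq_eq0.
  assert (P := nsq_neq0 l Hl0). unfold pick in H3.
  assert (E : (Cconj l * l)%C = RtoC (nsq l)) by (rewrite Cmult_comm; apply Cconj_mult_nsq).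
  rewrite E in H3. rewrite <- RtoC_minus, nsq_RtoC in H3.
  set (x := nsq l) in *.
  assert (H4 : 0 <= (x - nsq p) * (x - nsq q) - nsq (x - Cconj p * q)).
  { apply Rmult_le_reg_l with ((1 - x) * (1 - x)); [apply Rmult_lt_0_compat; lra|]. lra. }
  replace ((x - nsq p) * (x - nsq q) - nsq (x - Cconj p * q)) with (- (x * nsq (q - p))) in H4
    by (unfold nsq; destruct p, q; simpl; ring).
  generalize (nsq_pos (q - p)). nra.
Qed.

(* In the tight case the interpolant is a rotation of the Blaschke product [x (x + al) / (1 + al~ x)]. *)
Lemma pick_tight (p q l m : C) : l <> m -> l <> 0%C -> m <> 0%C -> nsq l < 1 -> nsq m < 1 ->
  nsq p < nsq l -> nsq q < nsq m -> pick p q l m = 0 ->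
  exists k al, nsq k = 1 /\ nsq al < 1 /\ p = (k * (l * mob al l))%C /\ q = (k * (m * mob al m))%C.
Proof.
  intros Hlm Hl0 Hm0 Hl Hm Hp Hq H.
  assert (Ep : p = (p / l * l)%C) by (field; exact Hl0).
  assert (Eq : q = (q / m * m)%C) by (field; exact Hm0).
  assert (Pl := nsq_neq0 l Hl0). assert (Pm := nsq_neq0 m Hm0).
  assert (Ha : nsq (p / l) < 1).
  { rewrite nsq_div by exact Hl0. apply Rmult_lt_reg_r with (nsq l); [exact Pl|].
    unfold Rdiv. rewrite Rmult_assoc, Rinv_l by lra. lra. }
  assert (Hb : nsq (q / m) < 1).
  { rewrite nsq_div by exact Hm0. apply Rmult_lt_reg_r with (nsq m); [exact Pm|].
    unfold Rdiv. rewrite Rmult_assoc, Rinv_l by lra. lra. }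
  rewrite Ep, Eq in H. rewrite Ep, Eq.
  set (a := (p / l)%C) in *. set (b := (q / m)%C) in *. clearbody a b. clear Ep Eq Hp Hq p q.
  assert (Hc : nsq (pick_coef a b l m) = 1).
  { apply nsq_pick_coef; try assumption; lra. }
  assert (K1 := one_minus_neq0 a b (nsq_mult_lt1 a b Ha (Rlt_le _ _ Hb))).
  assert (K2 := Cminus_neq0 m l (fun e => Hlm (eq_sym e))).
  assert (K3 := one_minus_neq0 l m (nsq_mult_lt1 l m Hl (Rlt_le _ _ Hm))).
  assert (Eb : b = ((a * (1 - Cconj l * m) + pick_coef a b l m * (m - l))
     / ((1 - Cconj l * m) + Cconj a * pick_coef a b l m * (m - l)))%C).
  { assert (K4 : (1 - Cconj a * a)%C <> 0%C) by (apply one_minus_neq0, nsq_mult_lt1; lra).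
    unfold pick_coef. field. split; [exact K2|split; [exact K1|]].
    assert (Q := Cmult_neq_0 _ _ K3 K4). intro E. apply Q. rewrite <- E. ring. }
  set (c := pick_coef a b l m) in *. clearbody c.
  assert (Ec : (c * Cconj c)%C = RtoC 1) by (rewrite Cconj_mult_nsq, Hc; reflexivity).
  assert (Nc : c <> 0%C) by (apply nsq_pos_neq0; lra).
  assert (Ncc : Cconj c <> 0%C) by (apply nsq_pos_neq0; rewrite nsq_conj; lra).
  (* For [|c| = 1] the function [mob a (c * mob (- l) x)] has numerator [d (x + al)] and denominator
     [c d~ (1 + al~ x)], where [al = (a - c l) / d]; this gives the witnesses [al] and
     [k = d / (c d~)]. *)
  set (d := (c - a * Cconj l)%C).
  assert (Ecc : Cconj c = (/ c)%C) by (rewrite <- (Cmult_1_l (/ c)%C), <- Ec; field; exact Nc).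
  assert (ED : nsq d - nsq (a - c * l) = (1 - nsq a) * (1 - nsq l)).
  { unfold d. transitivity (nsq c + nsq a * nsq l - nsq a - nsq c * nsq l).
    - unfold nsq; destruct a, c, l; simpl; ring.
    - rewrite Hc. ring. }
  assert (PD : 0 < nsq d).
  { generalize (nsq_pos (a - c * l)) (Rmult_lt_0_compat (1 - nsq a) (1 - nsq l)). lra. }
  assert (Nd := nsq_pos_neq0 d PD).
  assert (Edc : Cconj d = (Cconj c - Cconj a * l)%C)
    by (unfold d; rewrite Cminus_conj, Cmult_conj, Cconj_conj; reflexivity).
  assert (Ndc : Cconj d <> 0%C) by (apply nsq_pos_neq0; now rewrite nsq_conj).
  assert (Ell : (1 - Cconj l * l)%C <> 0%C) by (apply one_minus_neq0, nsq_mult_lt1; lra).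
  assert (Hal : nsq ((a - c * l) / d) < 1).
  { rewrite nsq_div by exact Nd. apply Rmult_lt_reg_r with (nsq d); [exact PD|].
    unfold Rdiv. rewrite Rmult_assoc, Rinv_l by lra.
    generalize (Rmult_lt_0_compat (1 - nsq a) (1 - nsq l)). lra. }
  exists (d / (c * Cconj d))%C, ((a - c * l) / d)%C.
  split; [|split; [exact Hal|]].
  { rewrite nsq_div by now apply Cmult_neq_0. rewrite nsq_mult, nsq_conj, Hc. field. lra. }
  assert (Hden : forall x, nsq x < 1 ->
    (1 + Cconj ((a - c * l) / d) * x)%C <> 0%C /\
    (1 + Cconj ((a - c * l) / d) * x)%C =
      ((Cconj c - Cconj a * l + (Cconj a - Cconj c * Cconj l) * x) / Cconj d)%C).
  { intros x Hx. split; [apply mob_den_neq0, nsq_mult_lt1; lra|].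
    rewrite Cdiv_conj by exact Nd. rewrite Cminus_conj, Cmult_conj, Edc.
    field. now rewrite <- Edc. }
  split.
  - destruct (Hden l Hl) as [Q1 Q2]. unfold mob.
    rewrite Q2 in *.
    replace (Cconj c - Cconj a * l + (Cconj a - Cconj c * Cconj l) * l)%C
      with (Cconj c * (1 - Cconj l * l))%C in * by ring.
    replace ((a - c * l) / d + l)%C with (a * (1 - Cconj l * l) / d)%C by (unfold d; field; exact Nd).
    rewrite Ecc. field. repeat split; assumption.
  - destruct (Hden m Hm) as [Q1 Q2]. unfold mob.
    rewrite Q2 in *.
    replace (Cconj c - Cconj a * l + (Cconj a - Cconj c * Cconj l) * m)%C
      with (Cconj c * (1 - Cconj l * m) + Cconj a * (m - l))%C in * by ring.
    replace ((a - c * l) / d + m)%C with ((a * (1 - Cconj l * m) + c * (m - l)) / d)%C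
      by (unfold d; field; exact Nd).
    assert (Q3 : (Cconj c * (1 - Cconj l * m) + Cconj a * (m - l))%C <> 0%C).
    { intro E. apply Q1. rewrite E. unfold Cdiv. ring. }
    replace (Cconj c * (1 - Cconj l * m) + Cconj a * (m - l))%C
      with (((1 - Cconj l * m) + Cconj a * c * (m - l)) / c)%C in *
      by (rewrite Ecc; field; exact Nc).
    assert (Q4 : (1 - Cconj l * m + Cconj a * c * (m - l))%C <> 0%C).
    { intro E. apply Q3. rewrite E. unfold Cdiv. ring. }
    rewrite Eb at 1. field. repeat split; assumption.
Qed.

(** * Extremal functions on the bidisc *)

Definition O2 : C * C := (RtoC 0, RtoC 0).

Lemma holo1_mult (f g : C -> C) : holo1 f -> holo1 g -> holo1 (fun z => (f z * g z)%C).
Proof.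
  intros Hf Hg z Hz. destruct (Hf z Hz) as [D K], (Hg z Hz) as [D' K']. split.
  - now apply dif1_mult.
  - rewrite nsq_mult. generalize (nsq_pos (f z)) (nsq_pos (g z)). nra.
Qed.

Lemma cara_val_product (p q : C * C) : nsq (fst p) < 1 -> nsq (fst q) < 1 ->
  cara_val p q O2 (Cmod (fst p) * Cmod (fst q)).
Proof.
  intros Hp Hq. exists (fun a => (mob (- fst p) (fst a) * mob (- fst q) (fst a))%C).
  split; [|split; [|split]].
  - apply (holo2_fst (fun z => (mob (- fst p) z * mob (- fst q) z)%C)).
    apply holo1_mult; apply holo1_mob; now rewrite nsq_opp.
  - rewrite mob_opp_self. ring.
  - rewrite mob_opp_self. ring.
  - simpl. rewrite !mob_0_r, Cmod_mult, !Cmod_opp. reflexivity.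
Qed.

Lemma cara_val_same_fst (p q : C * C) : nsq (fst p) < 1 -> fst p = fst q ->
  cara_val p q O2 (Cmod (fst p)).
Proof.
  intros Hp E. exists (fun a => mob (- fst p) (fst a)). split; [|split; [|split]].
  - apply (holo2_fst (mob (- fst p))). apply holo1_mob; now rewrite nsq_opp.
  - apply mob_opp_self.
  - rewrite E. apply mob_opp_self.
  - simpl. rewrite mob_0_r, Cmod_opp. reflexivity.
Qed.

(** The map [w -> 1 / (1 - w)] takes the disc onto the half-plane [Re > 1/2]; convexity of the
    latter makes the averages in [cara_mean] admissible. *)
Lemma Re_inv_one_minus (w : C) : nsq w < 1 -> (1 - w)%C <> 0%C /\ 1 / 2 < fst (/ (1 - w))%C.
Proof.
  intro H.
  assert (K : (1 - w)%C <> 0%C).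
  { intro E. replace w with (1 - (1 - w))%C in H by ring. rewrite E in H.
    revert H. unfold nsq; simpl. lra. }
  split; [exact K|]. assert (P := nsq_neq0 _ K).
  replace (fst (/ (1 - w))%C) with ((1 - fst w) / nsq (1 - w)).
  - apply Rmult_lt_reg_r with (nsq (1 - w)); [exact P|].
    unfold Rdiv. rewrite (Rmult_assoc (1 - fst w)), Rinv_l by lra.
    revert H. unfold nsq; destruct w; simpl. lra.
  - unfold Cinv. simpl fst. f_equal. unfold nsq; destruct w; simpl; ring.
Qed.

Lemma one_minus_inv_lt1 (w : C) : 1 / 2 < fst w -> w <> 0%C /\ nsq (1 - / w) < 1.
Proof.
  intro H. assert (K : w <> 0%C) by (intro E; rewrite E in H; simpl in H; lra).
  split; [exact K|]. assert (P := nsq_neq0 _ K).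
  replace (1 - / w)%C with ((w - 1) / w)%C by (field; exact K).
  rewrite nsq_div by exact K. apply Rmult_lt_reg_r with (nsq w); [exact P|].
  unfold Rdiv. rewrite Rmult_assoc, Rinv_l by lra.
  unfold nsq; destruct w; simpl in *. lra.
Qed.

(** For [d <> 0], [v] is the square of the direction [d / |d|]. Used with [d = a1 - a2], the
    identity makes the denominators of the two averaged fractions agree. *)
Lemma unimodular_square_direction (d : C) : exists v, nsq v = 1 /\ Cconj d = (Cconj v * d)%C.
Proof.
  destruct (Ceq_dec d 0%C) as [->|E].
  - exists (RtoC 1). split; [rewrite nsq_RtoC; ring|]. apply injective_projections; simpl; ring.
  - assert (E' : Cconj d <> 0%C) by (apply nsq_pos_neq0; rewrite nsq_conj; now apply nsq_neq0).
    exists (d / Cconj d)%C. split.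
    + rewrite nsq_div, nsq_conj by exact E'. field. apply Rgt_not_eq. now apply nsq_neq0.
    + rewrite Cdiv_conj, Cconj_conj by exact E'. field. exact E.
Qed.

(** With [c_j = v~ k_j~], the expression [v (1 - 1 / cara_mean)] is the weighted harmonic mean of
    the overview, [v] having been factored out. *)
Definition cara_mean (t : R) (c1 c2 : C) (a : C * C) : C :=
  (RtoC t * / (1 - c1 * fst a) + RtoC (1 - t) * / (1 - c2 * snd a))%C.

Lemma holo2_cara_mean (t : R) (v c1 c2 : C) : 0 <= t <= 1 ->
  nsq v = 1 -> nsq c1 = 1 -> nsq c2 = 1 ->
  holo2 (fun a => (v * (1 - / cara_mean t c1 c2 a))%C).
Proof.
  intros Ht Hv H1 H2 a Ha Hb.
  assert (K1 : nsq (c1 * fst a) < 1) by (rewrite nsq_mult, H1; lra).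
  assert (K2 : nsq (c2 * snd a) < 1) by (rewrite nsq_mult, H2; lra).
  destruct (Re_inv_one_minus _ K1) as [N1 R1]. destruct (Re_inv_one_minus _ K2) as [N2 R2].
  assert (HW : 1 / 2 < fst (cara_mean t c1 c2 a)).
  { assert (E : forall x w, fst (RtoC x * w)%C = x * fst w) by (intros x [w1 w2]; simpl; ring).
    unfold cara_mean.
    set (w1 := (/ (1 - c1 * fst a))%C) in *. set (w2 := (/ (1 - c2 * snd a))%C) in *.
    change (1 / 2 < fst (RtoC t * w1)%C + fst (RtoC (1 - t) * w2)%C). rewrite !E.
    destruct (Req_dec t 0) as [->|Nt]; [lra|].
    assert (t * (1 / 2) < t * fst w1) by (apply Rmult_lt_compat_l; lra).
    assert ((1 - t) * (1 / 2) <= (1 - t) * fst w2) by (apply Rmult_le_compat_l; lra).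
    lra. }
  destruct (one_minus_inv_lt1 _ HW) as [NW LW]. split; [|rewrite nsq_mult, Hv; lra].
  assert (Cf := contC_fst a). assert (Cs := contC_snd a).
  apply (dif_mult CU2 fst snd (fun _ => v)); try assumption; [apply dif_const|].
  apply (dif_minus CU2 fst snd (fun _ => RtoC 1)); [apply dif_const|].
  apply (dif_inv CU2 fst snd (cara_mean t c1 c2)); try assumption.
  apply (dif_plus CU2 fst snd (fun a => (RtoC t * / (1 - c1 * fst a))%C)
    (fun a => (RtoC (1 - t) * / (1 - c2 * snd a))%C)).
  - apply (dif_mult CU2 fst snd (fun _ => RtoC t)); try assumption; [apply dif_const|].
    apply (dif_inv CU2 fst snd (fun a => (1 - c1 * fst a)%C)); try assumption.
    apply (dif_minus CU2 fst snd (fun _ => RtoC 1)); [apply dif_const|].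
    apply (dif_mult CU2 fst snd (fun _ => c1)); try assumption; [apply dif_const | apply dif_fst].
  - apply (dif_mult CU2 fst snd (fun _ => RtoC (1 - t))); try assumption; [apply dif_const|].
    apply (dif_inv CU2 fst snd (fun a => (1 - c2 * snd a)%C)); try assumption.
    apply (dif_minus CU2 fst snd (fun _ => RtoC 1)); [apply dif_const|].
    apply (dif_mult CU2 fst snd (fun _ => c2)); try assumption; [apply dif_const | apply dif_snd].
Qed.

(* Along the two Blaschke products the weighted harmonic mean is again such a product, with the
   mean parameter; the latter takes the value [- x y] at [x] and at [y]. *)
Lemma cara_mean_value (t : R) (v k1 k2 a1 a2 x y : C) :
  nsq v = 1 -> nsq k1 = 1 -> nsq k2 = 1 -> nsq a1 < 1 -> nsq a2 < 1 -> 0 <= t <= 1 -> nsq x < 1 ->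
  Cconj (a1 - a2) = (Cconj v * (a1 - a2))%C ->
  (RtoC t * a1 + RtoC (1 - t) * a2 + x * y * Cconj (RtoC t * a1 + RtoC (1 - t) * a2))%C = (- (x + y))%C ->
  (v * (1 - / cara_mean t (Cconj v * Cconj k1) (Cconj v * Cconj k2)
      (k1 * (x * mob a1 x), k2 * (x * mob a2 x))))%C = (- (x * y))%C.
Proof.
  intros Hv H1 H2 Ha1 Ha2 Ht Hx Hd Hs.
  assert (Vv : (v * Cconj v)%C = RtoC 1) by (rewrite Cconj_mult_nsq, Hv; reflexivity).
  assert (V1 : (k1 * Cconj k1)%C = RtoC 1) by (rewrite Cconj_mult_nsq, H1; reflexivity).
  assert (V2 : (k2 * Cconj k2)%C = RtoC 1) by (rewrite Cconj_mult_nsq, H2; reflexivity).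
  unfold cara_mean; simpl fst; simpl snd.
  assert (G : forall k b, nsq b < 1 -> (k * Cconj k)%C = RtoC 1 ->
    (1 + Cconj b * x + - (Cconj v * (x * (b + x))))%C <> 0%C /\
    (/ (1 - Cconj v * Cconj k * (k * (x * mob b x))))%C =
    ((1 + Cconj b * x) / (1 + Cconj b * x + - (Cconj v * (x * (b + x)))))%C).
  { intros k b Hb Hk.
    assert (Q := mob_den_neq0 b x (nsq_mult_lt1 b x Hb (Rlt_le _ _ Hx))).
    assert (E : (Cconj v * Cconj k * (k * (x * mob b x)))%C = (Cconj v * (x * mob b x))%C).
    { transitivity ((k * Cconj k) * (Cconj v * (x * mob b x)))%C; [ring|]. rewrite Hk. ring. }
    rewrite E.
    assert (S : nsq (Cconj v * (x * mob b x)) < 1).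
    { rewrite !nsq_mult, nsq_conj, Hv. assert (M := mob_lt1 b x Hb Hx).
      generalize (nsq_pos x) (nsq_pos (mob b x)). nra. }
    destruct (Re_inv_one_minus _ S) as [N _].
    assert (F : (1 + Cconj b * x + - (Cconj v * (x * (b + x))))%C
      = ((1 + Cconj b * x) * (1 - Cconj v * (x * mob b x)))%C) by (unfold mob; field; exact Q).
    rewrite F. split; [now apply Cmult_neq_0|]. field. split; assumption. }
  destruct (G k1 a1 Ha1 V1) as [N1 ->]. destruct (G k2 a2 Ha2 V2) as [N2 ->]. clear G.
  (* Here the choice of [v] enters: [a_j~ - v~ a_j] has the same value for both [j], so both
     fractions have the denominator [D]. *)
  assert (Eb : (1 + Cconj a2 * x + - (Cconj v * (x * (a2 + x))))%C
    = (1 + Cconj a1 * x + - (Cconj v * (x * (a1 + x))))%C).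
  { rewrite Cminus_conj in Hd.
    replace (Cconj a2) with (Cconj a1 - Cconj v * (a1 - a2))%C by (rewrite <- Hd; ring). ring. }
  rewrite Eb in *. clear N2.
  set (D := (1 + Cconj a1 * x + - (Cconj v * (x * (a1 + x))))%C) in *.
  set (al := (RtoC t * a1 + RtoC (1 - t) * a2)%C) in *.
  assert (Ec : Cconj al = (RtoC t * Cconj a1 + RtoC (1 - t) * Cconj a2)%C).
  { unfold al. rewrite Cplus_conj, !Cmult_conj. f_equal; f_equal; apply injective_projections; simpl; ring. }
  assert (Et : RtoC (1 - t) = (1 - RtoC t)%C) by apply RtoC_minus.
  assert (ED : D = (1 + Cconj al * x - Cconj v * (x * (al + x)))%C).
  { rewrite Ec. unfold al. rewrite Et.
    transitivity (RtoC t * D + (1 - RtoC t) * D)%C; [ring|].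
    rewrite <- Eb at 2. unfold D. ring. }
  assert (Nal : (1 + Cconj al * x)%C <> 0%C).
  { apply mob_den_neq0, nsq_mult_lt1; [|lra]. apply nsq_lt1. unfold al.
    eapply Rle_lt_trans; [apply Cmod_triangle|]. rewrite !Cmod_mult, !Cmod_R, !Rabs_pos_eq by lra.
    apply nsq_lt1 in Ha1. apply nsq_lt1 in Ha2.
    destruct (Req_dec t 0) as [->|Nt]; [lra|].
    assert (t * Cmod a1 < t * 1) by (apply Rmult_lt_compat_l; lra).
    assert ((1 - t) * Cmod a2 <= (1 - t) * 1) by (apply Rmult_le_compat_l; lra). lra. }
  replace (RtoC t * ((1 + Cconj a1 * x) / D) + RtoC (1 - t) * ((1 + Cconj a2 * x) / D))%C
    with ((1 + Cconj al * x) / D)%C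
    by (rewrite Ec, Et; field; exact N1).
  replace (v * (1 - / ((1 + Cconj al * x) / D)))%C with ((v * (1 + Cconj al * x) - v * D) / (1 + Cconj al * x))%C
    by (field; split; assumption).
  replace (v * (1 + Cconj al * x) - v * D)%C with ((v * Cconj v) * (x * (al + x)))%C
    by (rewrite ED; ring).
  rewrite Vv.
  (* This is [Hs] solved for [al + x]. *)
  replace (al + x)%C with (- y * (1 + Cconj al * x))%C.
  - field. exact Nal.
  - transitivity (al + x - ((al + x * y * Cconj al) + (x + y)))%C; [ring|]. rewrite Hs. ring.
Qed.

Lemma cara_val_extremal (t : R) (k1 k2 a1 a2 l m : C) (p q : C * C) :
  nsq k1 = 1 -> nsq k2 = 1 -> nsq a1 < 1 -> nsq a2 < 1 -> 0 <= t <= 1 ->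
  nsq l < 1 -> nsq m < 1 ->
  (RtoC t * a1 + RtoC (1 - t) * a2 + l * m * Cconj (RtoC t * a1 + RtoC (1 - t) * a2))%C = (- (l + m))%C ->
  p = (k1 * (l * mob a1 l), k2 * (l * mob a2 l))%C ->
  q = (k1 * (m * mob a1 m), k2 * (m * mob a2 m))%C ->
  cara_val p q O2 (Cmod l * Cmod m).
Proof.
  intros H1 H2 Ha1 Ha2 Ht Hl Hm Hs -> ->.
  destruct (unimodular_square_direction (a1 - a2)%C) as (v & Hv & Hd).
  set (F := fun a => (v * (1 - / cara_mean t (Cconj v * Cconj k1) (Cconj v * Cconj k2) a))%C).
  assert (HF : holo2 F).
  { apply holo2_cara_mean; try assumption; rewrite nsq_mult, !nsq_conj, Hv; lra. }
  assert (Hlm : nsq (l * m) < 1).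
  { rewrite nsq_mult. apply nsq_mult_lt1; lra. }
  exists (fun a => mob (l * m) (F a)). split; [|split; [|split]].
  - now apply holo2_mob_comp.
  - replace (F _) with (- (l * m))%C.
    + unfold mob. rewrite Cplus_opp_r. unfold Cdiv. ring.
    + symmetry. now apply cara_mean_value.
  - replace (F _) with (- (m * l))%C.
    + unfold mob. rewrite (Cmult_comm m l), Cplus_opp_r. unfold Cdiv. ring.
    + symmetry. apply cara_mean_value; try assumption.
      now rewrite (Cmult_comm m l), (Cplus_comm m l).
  - replace (F O2) with (RtoC 0).
    + rewrite mob_0_r. apply Cmod_mult.
    + unfold F, cara_mean, O2; simpl fst; simpl snd.
      rewrite !Cmult_0_r. replace (1 - 0)%C with (RtoC 1) by ring.
      replace (RtoC t * / 1 + RtoC (1 - t) * / 1)%C with (RtoC 1)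
        by (rewrite RtoC_minus; field). field.
Qed.

(** * Existence of a minimiser *)

(** Compactness one coordinate at a time. Decreasing nonempty sets replace a sequence: closeness to
    [x] can be added as a constraint, the family stays decreasing and nonempty, and the next
    coordinate is treated alike. [x] is an upper limit, the supremum of the [y] such that every
    [S n] contains a point with [y <= c s]. *)
Lemma cluster_coordinate (T : Type) (S : nat -> T -> Prop) (c : T -> R) (M : R) :
  (forall n s, S (Datatypes.S n) s -> S n s) -> (forall n, exists s, S n s) ->
  (forall n s, S n s -> Rabs (c s) <= M) ->
  exists x, forall n, exists s, S n s /\ Rabs (c s - x) < / (INR n + 1).
Proof.
  intros Hd Hn Hb.
  assert (Hmono : forall n k s, S (n + k)%nat s -> S n s).
  { intros n k. induction k as [|k IH]; intros s Hs; [now rewrite Nat.add_0_r in Hs|].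
    apply IH, Hd. now rewrite Nat.add_succ_r in Hs. }
  destruct (completeness (fun y => forall n, exists s, S n s /\ y <= c s)) as [x [X1 X2]].
  - exists M. intros y Hy. destruct (Hy 0%nat) as (s & Hs & Hys).
    specialize (Hb _ _ Hs). apply Rabs_le_between in Hb. lra.
  - exists (- M). intro n. destruct (Hn n) as [s Hs]. exists s. split; [exact Hs|].
    specialize (Hb _ _ Hs). apply Rabs_le_between in Hb. lra.
  - exists x. intro n. set (e := / (INR n + 1)).
    assert (He : 0 < e) by (apply Rinv_0_lt_compat; generalize (pos_INR n); lra).
    apply NNPP. intro Hno.
    assert (Hy : exists y, x - e < y /\ forall k, exists s, S k s /\ y <= c s).
    { apply NNPP. intro K. assert (x <= x - e); [|lra]. apply X2. intros y Hy.
      destruct (Rle_dec y (x - e)) as [L|L]; [exact L|]. exfalso. apply K. exists y. split; [lra | exact Hy]. }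
    destruct Hy as (y & Hy1 & Hy2).
    (* Without a point of [S n] within [e] of [x], every point of [S n] with [c s > x - e] has
       [c s >= x + e], so [x + e] would belong to the set whose supremum is [x]. *)
    assert (x + e <= x); [|lra]. apply X1. intro k.
    destruct (Hy2 (n + k)%nat) as (s & Hs & Hys).
    exists s. split; [rewrite Nat.add_comm in Hs; now apply (Hmono k n)|].
    destruct (Rle_dec (x + e) (c s)) as [L|L]; [exact L|]. exfalso. apply Hno.
    exists s. split; [now apply (Hmono n k)|]. apply Rabs_lt_between. fold e. lra.
Qed.

Lemma is_lim_seq_of_bound (u : nat -> R) (x : R) :
  (forall n, Rabs (u n - x) <= / (INR n + 1)) -> is_lim_seq u x.
Proof.
  intro H. apply is_lim_seq_spec. intro e.
  destruct (archimed_cor1 e (cond_pos e)) as (N & HN & HN0).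
  exists N. intros n Hn. eapply Rle_lt_trans; [apply H|]. eapply Rle_lt_trans; [|exact HN].
  apply Rinv_le_contravar; [now apply lt_0_INR|]. apply le_INR in Hn. lra.
Qed.

Lemma cluster_R4 (S : nat -> R * R * (R * R) -> Prop) (M : R) :
  (forall n s, S (Datatypes.S n) s -> S n s) -> (forall n, exists s, S n s) ->
  (forall n a b c d, S n (a, b, (c, d)) -> Rabs a <= M /\ Rabs b <= M /\ Rabs c <= M /\ Rabs d <= M) ->
  exists (a b c d : nat -> R) (a0 b0 c0 d0 : R), (forall n, S n (a n, b n, (c n, d n))) /\
    is_lim_seq a a0 /\ is_lim_seq b b0 /\ is_lim_seq c c0 /\ is_lim_seq d d0.
Proof.
  intros Hd Hn Hb.
  assert (Hinv : forall n, / (INR (Datatypes.S n) + 1) <= / (INR n + 1)).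
  { intro n. apply Rinv_le_contravar; [generalize (pos_INR n); lra|]. rewrite S_INR. lra. }
  destruct (cluster_coordinate _ S (fun s => fst (fst s)) M Hd Hn) as [a0 H1].
  { intros n [[a b] [c d]] Hs. now apply (Hb n a b c d). }
  set (S1 := fun n s => S n s /\ Rabs (fst (fst s) - a0) < / (INR n + 1)).
  destruct (cluster_coordinate _ S1 (fun s => snd (fst s)) M) as [b0 H2].
  { intros n s [Hs Hs']. split; [now apply Hd | eapply Rlt_le_trans; [exact Hs' | apply Hinv]]. }
  { exact H1. }
  { intros n [[a b] [c d]] [Hs _]. now apply (Hb n a b c d). }
  set (S2 := fun n s => S1 n s /\ Rabs (snd (fst s) - b0) < / (INR n + 1)).
  destruct (cluster_coordinate _ S2 (fun s => fst (snd s)) M) as [c0 H3].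
  { intros n s [[Hs Hs'] Hs'']. split; [split; [now apply Hd|]|];
    (eapply Rlt_le_trans; [eassumption | apply Hinv]). }
  { exact H2. }
  { intros n [[a b] [c d]] [[Hs _] _]. now apply (Hb n a b c d). }
  set (S3 := fun n s => S2 n s /\ Rabs (fst (snd s) - c0) < / (INR n + 1)).
  destruct (cluster_coordinate _ S3 (fun s => snd (snd s)) M) as [d0 H4].
  { intros n s [[[Hs Hs'] Hs''] Hs''']. split; [split; [split; [now apply Hd|]|]|];
    (eapply Rlt_le_trans; [eassumption | apply Hinv]). }
  { exact H3. }
  { intros n [[a b] [c d]] [[[Hs _] _] _]. now apply (Hb n a b c d). }
  set (u := fun n => proj1_sig (constructive_indefinite_description _ (H4 n))).
  assert (Hu : forall n, S3 n (u n) /\ Rabs (snd (snd (u n)) - d0) < / (INR n + 1))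
    by (intro n; exact (proj2_sig (constructive_indefinite_description _ (H4 n)))).
  exists (fun n => fst (fst (u n))), (fun n => snd (fst (u n))),
    (fun n => fst (snd (u n))), (fun n => snd (snd (u n))), a0, b0, c0, d0.
  split; [|repeat split; apply is_lim_seq_of_bound; intro n; left; now destruct (Hu n) as [[[[? ?] ?] ?] ?]].
  intro n. destruct (Hu n) as [[[[Hs _] _] _] _]. now rewrite <- !surjective_pairing.
Qed.

Definition feas2 (p q : C * C) (l m : C) : Prop :=
  feas (fst p) (fst q) l m /\ feas (snd p) (snd q) l m.

(** Minimality over the closed bidisc, where compactness applies; a minimiser with [|l| = 1] or
    [|m| = 1] gives no analytic disc and is analysed separately. *)
Definition is_min (p q : C * C) (l m : C) : Prop :=
  nsq l <= 1 /\ nsq m <= 1 /\ feas2 p q l m /\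
  forall l' m', nsq l' <= 1 -> nsq m' <= 1 -> feas2 p q l' m' ->
    nsq l * nsq m <= nsq l' * nsq m'.

Lemma is_lim_seq_nonneg (u : nat -> R) (x : R) :
  is_lim_seq u x -> (forall n, 0 <= u n) -> 0 <= x.
Proof.
  intros H K. apply (is_lim_seq_le (fun _ => 0) u 0 x K); [apply is_lim_seq_const | exact H].
Qed.

Definition clim (z : nat -> C) (w : C) : Prop :=
  is_lim_seq (fun n => fst (z n)) (fst w) /\ is_lim_seq (fun n => snd (z n)) (snd w).

Lemma clim_const (w : C) : clim (fun _ => w) w.
Proof. split; apply is_lim_seq_const. Qed.

Lemma clim_minus (z z' : nat -> C) (w w' : C) :
  clim z w -> clim z' w' -> clim (fun n => (z n - z' n)%C) (w - w')%C.
Proof.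
  intros [H1 H2] [K1 K2].
  split; [exact (is_lim_seq_minus' _ _ _ _ H1 K1) | exact (is_lim_seq_minus' _ _ _ _ H2 K2)].
Qed.

Lemma clim_mult (z z' : nat -> C) (w w' : C) :
  clim z w -> clim z' w' -> clim (fun n => (z n * z' n)%C) (w * w')%C.
Proof.
  intros [H1 H2] [K1 K2]. split.
  - exact (is_lim_seq_minus' _ _ _ _ (is_lim_seq_mult' _ _ _ _ H1 K1) (is_lim_seq_mult' _ _ _ _ H2 K2)).
  - exact (is_lim_seq_plus' _ _ _ _ (is_lim_seq_mult' _ _ _ _ H1 K2) (is_lim_seq_mult' _ _ _ _ H2 K1)).
Qed.

Lemma clim_conj (z : nat -> C) (w : C) : clim z w -> clim (fun n => Cconj (z n)) (Cconj w).
Proof. intros [H1 H2]. split; [exact H1 | exact (proj1 (is_lim_seq_opp _ _) H2)]. Qed.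

Lemma clim_nsq (z : nat -> C) (w : C) : clim z w -> is_lim_seq (fun n => nsq (z n)) (nsq w).
Proof.
  intros [H1 H2].
  exact (is_lim_seq_plus' _ _ _ _ (is_lim_seq_mult' _ _ _ _ H1 H1) (is_lim_seq_mult' _ _ _ _ H2 H2)).
Qed.

Lemma feas_closed (p q : C) (z w : nat -> C) (l m : C) : clim z l -> clim w m ->
  (forall n, feas p q (z n) (w n)) -> feas p q l m.
Proof.
  intros Hz Hw H. assert (Nz := clim_nsq z l Hz). assert (Nw := clim_nsq w m Hw).
  unfold feas in *. repeat split.
  - apply Rge_le, Rminus_ge, Rle_ge.
    apply (is_lim_seq_nonneg (fun n => nsq (z n) - nsq p)).
    + apply is_lim_seq_minus'; [exact Nz | apply is_lim_seq_const].
    + intro n. generalize (proj1 (H n)). lra.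
  - apply Rge_le, Rminus_ge, Rle_ge.
    apply (is_lim_seq_nonneg (fun n => nsq (w n) - nsq q)).
    + apply is_lim_seq_minus'; [exact Nw | apply is_lim_seq_const].
    + intro n. generalize (proj1 (proj2 (H n))). lra.
  - assert (Hzw : clim (fun n => (Cconj (z n) * w n)%C) (Cconj l * m)%C)
      by (apply clim_mult; [now apply clim_conj | exact Hw]).
    apply (is_lim_seq_nonneg (fun n => pick p q (z n) (w n))).
    + unfold pick. apply is_lim_seq_minus'; apply is_lim_seq_mult'.
      * apply is_lim_seq_mult'; apply is_lim_seq_minus'; try apply is_lim_seq_const; assumption.
      * apply (clim_nsq (fun n => (1 - Cconj (z n) * w n)%C)). apply clim_minus; [apply clim_const | exact Hzw].
      * apply is_lim_seq_mult'; apply is_lim_seq_minus'; try apply is_lim_seq_const; assumption.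
      * apply (clim_nsq (fun n => (Cconj (z n) * w n - Cconj p * q)%C)).
        apply clim_minus; [exact Hzw | apply clim_const].
    + intro n. apply (proj2 (proj2 (H n))).
Qed.

Lemma Rabs_le_of_nsq (z : C) : nsq z <= 1 -> Rabs (fst z) <= 1 /\ Rabs (snd z) <= 1.
Proof. unfold nsq. intro H. split; apply Rabs_le; nra. Qed.

Lemma nsq_mult_nonneg (l m : C) : 0 <= nsq l * nsq m.
Proof. apply Rmult_le_pos; apply nsq_pos. Qed.

Lemma minimizer_exists (p q : C * C) :
  nsq (fst p) <= 1 -> nsq (snd p) <= 1 -> nsq (fst q) <= 1 -> nsq (snd q) <= 1 ->
  exists l m, is_min p q l m.
Proof.
  intros P1 P2 Q1 Q2.
  set (Ok := fun l m : C => nsq l <= 1 /\ nsq m <= 1 /\ feas2 p q l m).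
  (* Both terms of [pick] vanish at [(1, 1)], so the set to minimise over is nonempty. *)
  assert (Hone : forall a b, nsq a <= 1 -> nsq b <= 1 -> feas a b 1 1).
  { intros a b Ha Hb. unfold feas, pick. rewrite nsq_RtoC. repeat split; try lra.
    replace (1 - Cconj 1 * 1)%C with (RtoC 0) by (apply injective_projections; simpl; ring).
    rewrite nsq_RtoC. lra. }
  assert (H1 : Ok 1%C 1%C).
  { unfold Ok. rewrite nsq_RtoC. split; [lra|split; [lra|]]. split; now apply Hone. }
  destruct (completeness (fun y => forall l m, Ok l m -> y <= nsq l * nsq m)) as [r [R1 R2]].
  { exists 1. intros y Hy. specialize (Hy _ _ H1). rewrite nsq_RtoC in Hy. lra. }
  { exists 0. intros l m _. apply nsq_mult_nonneg. }
  assert (Hr : forall l m, Ok l m -> r <= nsq l * nsq m).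
  { intros l m Hlm. apply R2. intros y Hy. now apply Hy. }
  destruct (cluster_R4 (fun n s => Ok (fst s) (snd s) /\
     nsq (fst s) * nsq (snd s) <= r + / (INR n + 1)) 1) as (a & b & c & d & a0 & b0 & c0 & d0 & HS & La & Lb & Lc & Ld).
  - intros n s [K1 K2]. split; [exact K1|]. eapply Rle_trans; [exact K2|].
    apply Rplus_le_compat_l, Rinv_le_contravar; [generalize (pos_INR n); lra|]. rewrite S_INR. lra.
  - intro n. apply NNPP. intro K.
    assert (E : r + / (INR n + 1) <= r).
    { apply R1. intros l m Hlm.
      destruct (Rle_dec (r + / (INR n + 1)) (nsq l * nsq m)) as [L|L]; [exact L|].
      exfalso. apply K. exists (l, m). split; [exact Hlm | simpl; lra]. }
    assert (0 < / (INR n + 1)) by (apply Rinv_0_lt_compat; generalize (pos_INR n); lra). lra.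
  - intros n x y z w [(K1 & K2 & _) _]. simpl in K1, K2.
    apply Rabs_le_of_nsq in K1. apply Rabs_le_of_nsq in K2. simpl in *. tauto.
  - assert (Hz : clim (fun n => (a n, b n)) (a0, b0)) by now split.
    assert (Hw : clim (fun n => (c n, d n)) (c0, d0)) by now split.
    assert (Nz := clim_nsq _ _ Hz). assert (Nw := clim_nsq _ _ Hw).
    exists (a0, b0), (c0, d0). split; [|split; [|split]].
    + apply Rge_le, Rminus_ge, Rle_ge.
      apply (is_lim_seq_nonneg (fun n => 1 - nsq (a n, b n))).
      * apply is_lim_seq_minus'; [apply is_lim_seq_const | exact Nz].
      * intro n. destruct (HS n) as [(K & _) _]. simpl in K. lra.
    + apply Rge_le, Rminus_ge, Rle_ge.
      apply (is_lim_seq_nonneg (fun n => 1 - nsq (c n, d n))).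
      * apply is_lim_seq_minus'; [apply is_lim_seq_const | exact Nw].
      * intro n. destruct (HS n) as [(_ & K & _) _]. simpl in K. lra.
    + split; apply (feas_closed _ _ _ _ _ _ Hz Hw);
      intro n; destruct (HS n) as [(_ & _ & K1 & K2) _]; assumption.
    + intros l' m' H1' H2' H3'. apply Rle_trans with r; [|apply Hr; unfold Ok; tauto].
      apply (is_lim_seq_le (fun n => nsq (a n, b n) * nsq (c n, d n)) (fun n => r + / (INR n + 1))
        (nsq (a0, b0) * nsq (c0, d0)) r).
      * intro n. apply (proj2 (HS n)).
      * now apply is_lim_seq_mult'.
      * replace r with (r + 0) at 1 by ring. apply is_lim_seq_plus'; [apply is_lim_seq_const|].
        apply is_lim_seq_of_bound. intro n.
        assert (0 < / (INR n + 1)) by (apply Rinv_0_lt_compat; generalize (pos_INR n); lra).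
        rewrite Rminus_0_r, Rabs_pos_eq by lra. lra.
Qed.

(** * First order conditions at a minimiser *)

(** Derivative of [pick] at [h = 0] when [l], [m] move to [l (1 + h z1)], [m (1 + h z2)]; [u] is the
    logarithmic derivative of [nu]. *)
Definition pick_deriv (p q l m z1 z2 : C) : R :=
  let nu := (Cconj l * m)%C in
  let u := (Cconj z1 + z2)%C in
  2 * fst z1 * nsq l * (nsq m - nsq q) * nsq (1 - nu)
  + 2 * fst z2 * nsq m * (nsq l - nsq p) * nsq (1 - nu)
  - 2 * (nsq l - nsq p) * (nsq m - nsq q) * fst (Cconj (1 - nu) * (nu * u))%C
  + 2 * fst z1 * nsq l * (1 - nsq m) * nsq (nu - Cconj p * q)
  + 2 * fst z2 * nsq m * (1 - nsq l) * nsq (nu - Cconj p * q)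
  - 2 * (1 - nsq l) * (1 - nsq m) * fst (Cconj (nu - Cconj p * q) * (nu * u))%C.

(** Multiplicative variation: [fst z] is the logarithmic derivative of the modulus at [h = 0], so
    the sign of [fst z1 + fst z2] decides whether [|l m|] decreases. *)
Definition bump (l z : C) (h : R) : C := (l * (1 + h * z))%C.

Lemma nsq_bump (l z : C) (h : R) :
  nsq (bump l z h) = nsq l * (1 + 2 * h * fst z + h * h * nsq z).
Proof. unfold bump. rewrite nsq_mult. f_equal. unfold nsq; destruct z; simpl; ring. Qed.

Lemma is_derive_nsq_bump (l z : C) :
  is_derive (fun h => nsq (bump l z h)) 0 (2 * nsq l * fst z).
Proof.
  apply (is_derive_ext (fun h => nsq l * (1 + 2 * h * fst z + h * h * nsq z))).
  - intro h. symmetry. apply nsq_bump.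
  - auto_derive; [exact I | ring].
Qed.

Lemma is_derive_nsq_affine (c nu u v : C) (s : R) :
  is_derive (fun h : R => nsq (c + s * (nu * (1 + h * u + h * h * v)))) 0
    (2 * s * fst (Cconj (c + s * nu) * (nu * u))%C).
Proof.
  unfold nsq. destruct c, nu, u, v. simpl.
  auto_derive; [exact I | ring].
Qed.

Lemma conj_bump_mult (l m z1 z2 : C) (h : R) :
  (Cconj (bump l z1 h) * bump m z2 h)%C =
  (Cconj l * m * (1 + h * (Cconj z1 + z2) + h * h * (Cconj z1 * z2)))%C.
Proof. unfold bump. destruct l, m, z1, z2. apply injective_projections; simpl; ring. Qed.

Lemma bump_0 (l z : C) : bump l z 0 = l.
Proof. unfold bump. ring. Qed.

Lemma is_derive_pick (p q l m z1 z2 : C) :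
  is_derive (fun h => pick p q (bump l z1 h) (bump m z2 h)) 0 (pick_deriv p q l m z1 z2).
Proof.
  set (nu := (Cconj l * m)%C). set (u := (Cconj z1 + z2)%C). set (v := (Cconj z1 * z2)%C).
  assert (D1 := is_derive_nsq_bump l z1). assert (D2 := is_derive_nsq_bump m z2).
  assert (D3 : is_derive (fun h => nsq (1 - Cconj (bump l z1 h) * bump m z2 h)) 0
    (2 * -1 * fst (Cconj (1 - nu) * (nu * u))%C)).
  { replace (1 - nu)%C with (1 + RtoC (-1) * nu)%C by ring.
    apply (is_derive_ext (fun h : R => nsq (1 + RtoC (-1) * (nu * (1 + h * u + h * h * v)))%C)).
    - intro h. f_equal. rewrite conj_bump_mult. fold nu u v. ring.
    - apply is_derive_nsq_affine. }
  assert (D4 : is_derive (fun h => nsq (Cconj (bump l z1 h) * bump m z2 h - Cconj p * q)) 0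
    (2 * 1 * fst (Cconj (nu - Cconj p * q) * (nu * u))%C)).
  { replace (nu - Cconj p * q)%C with (- (Cconj p * q) + RtoC 1 * nu)%C by ring.
    apply (is_derive_ext (fun h : R => nsq (- (Cconj p * q) + RtoC 1 * (nu * (1 + h * u + h * h * v)))%C)).
    - intro h. f_equal. rewrite conj_bump_mult. fold nu u v. ring.
    - apply is_derive_nsq_affine. }
  unfold pick. cbv zeta.
  set (f1 := fun h => nsq (bump l z1 h)) in *. set (f2 := fun h => nsq (bump m z2 h)) in *.
  set (f3 := fun h => nsq (1 - Cconj (bump l z1 h) * bump m z2 h)%C) in *.
  set (f4 := fun h => nsq (Cconj (bump l z1 h) * bump m z2 h - Cconj p * q)%C) in *.
  assert (E1 : f1 0 = nsq l) by (unfold f1; now rewrite bump_0).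
  assert (E2 : f2 0 = nsq m) by (unfold f2; now rewrite bump_0).
  assert (E3 : f3 0 = nsq (1 - nu)) by (unfold f3; now rewrite !bump_0).
  assert (E4 : f4 0 = nsq (nu - Cconj p * q)) by (unfold f4; now rewrite !bump_0).
  apply (is_derive_ext (fun h => (f1 h - nsq p) * (f2 h - nsq q) * f3 h
    - (1 - f1 h) * (1 - f2 h) * f4 h)); [reflexivity|].
  change (is_derive f1 0 (2 * nsq l * fst z1)) in D1.
  change (is_derive f2 0 (2 * nsq m * fst z2)) in D2.
  change (is_derive f3 0 (2 * -1 * fst (Cconj (1 - nu) * (nu * u))%C)) in D3.
  change (is_derive f4 0 (2 * 1 * fst (Cconj (nu - Cconj p * q) * (nu * u))%C)) in D4.
  clearbody f1 f2 f3 f4.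
  auto_derive.
  - repeat split; first [exact I | eexists; eassumption].
  - change (Derive (fun x : R => f1 x) 0) with (Derive f1 0).
    change (Derive (fun x : R => f2 x) 0) with (Derive f2 0).
    change (Derive (fun x : R => f3 x) 0) with (Derive f3 0).
    change (Derive (fun x : R => f4 x) 0) with (Derive f4 0).
    rewrite (is_derive_unique _ _ _ D1), (is_derive_unique _ _ _ D2),
      (is_derive_unique _ _ _ D3), (is_derive_unique _ _ _ D4), E1, E2, E3, E4.
    unfold pick_deriv. fold nu u. ring.
Qed.

(* [pick_deriv] in terms of the parameter [al] of a tight interpolant; affine in [al]. *)
Definition tight_deriv (al l m z1 z2 : C) : R :=
  let nu := (Cconj l * m)%C in
  fst z1 * (1 - nsq m) * nsq (1 - nu) * (1 + nsq l + 2 * fst (Cconj al * l)%C)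
  + fst z2 * (1 - nsq l) * nsq (1 - nu) * (1 + nsq m + 2 * fst (Cconj al * m)%C)
  - (1 - nsq l) * (1 - nsq m) *
    fst (Cconj (1 - nu) * ((Cconj z1 + z2) * (1 + nu + al * Cconj l + Cconj al * m)))%C.

Lemma fst_mult_RtoC (w : C) (r : R) : fst (w * RtoC r)%C = fst w * r.
Proof. destruct w; simpl; ring. Qed.

(** [|l|^2 - |p|^2], [|m|^2 - |q|^2] and [nu - p~ q] all contain the factor [e = 1 - |al|^2]. Once
    it is divided out, [E6], [E7] and [E8] absorb the remaining terms in [e], and everything
    quadratic in [al] cancels. *)
Lemma pick_deriv_tight (k al l m z1 z2 : C) : nsq k = 1 -> nsq al < 1 -> nsq l < 1 -> nsq m < 1 ->
  l <> 0%C -> m <> 0%C ->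
  exists K, 0 < K /\
  pick_deriv (k * (l * mob al l)) (k * (m * mob al m)) l m z1 z2 = K * tight_deriv al l m z1 z2.
Proof.
  intros Hk Hal Hl Hm Hl0 Hm0.
  set (nu := (Cconj l * m)%C).
  set (d1 := (1 + Cconj al * l)%C). set (d2 := (1 + Cconj al * m)%C).
  assert (N1 : d1 <> 0%C) by (apply mob_den_neq0, nsq_mult_lt1; lra).
  assert (N2 : d2 <> 0%C) by (apply mob_den_neq0, nsq_mult_lt1; lra).
  assert (P1 := nsq_neq0 _ N1). assert (P2 := nsq_neq0 _ N2).
  assert (Pl := nsq_neq0 _ Hl0). assert (Pm := nsq_neq0 _ Hm0).
  set (e := 1 - nsq al).
  assert (E1 : nsq l - nsq (k * (l * mob al l)) = nsq l * (e * (1 - nsq l)) / nsq d1).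
  { rewrite !nsq_mult, Hk. assert (E := nsq_mob al l Hal (Rlt_le _ _ Hl)).
    fold d1 e in E. unfold Rdiv. rewrite (Rmult_assoc (nsq l)). fold (e * (1 - nsq l) / nsq d1).
    rewrite <- E. ring. }
  assert (E2 : nsq m - nsq (k * (m * mob al m)) = nsq m * (e * (1 - nsq m)) / nsq d2).
  { rewrite !nsq_mult, Hk. assert (E := nsq_mob al m Hal (Rlt_le _ _ Hm)).
    fold d2 e in E. unfold Rdiv. rewrite (Rmult_assoc (nsq m)). fold (e * (1 - nsq m) / nsq d2).
    rewrite <- E. ring. }
  assert (V : (k * Cconj k)%C = RtoC 1) by (rewrite Cconj_mult_nsq, Hk; reflexivity).
  assert (M1 : Cconj d1 <> 0%C) by (apply nsq_pos_neq0; now rewrite nsq_conj).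
  assert (M2 : Cconj d2 <> 0%C) by (apply nsq_pos_neq0; now rewrite nsq_conj).
  assert (C1 : Cconj d1 = (1 + al * Cconj l)%C).
  { unfold d1. rewrite Cplus_conj, Cmult_conj, Cconj_conj. f_equal. apply injective_projections; simpl; ring. }
  assert (Ee : RtoC e = (1 - al * Cconj al)%C) by (unfold e; rewrite RtoC_minus, <- Cconj_mult_nsq; reflexivity).
  assert (E3 : (nu - Cconj (k * (l * mob al l)) * (k * (m * mob al m)))%C
     = (nu * (RtoC e * (1 - nu)) / (Cconj d1 * d2))%C).
  { transitivity (nu * (1 - (k * Cconj k) * (Cconj (mob al l) * mob al m)))%C.
    - rewrite !Cmult_conj. unfold nu. ring.
    - rewrite V. unfold mob. fold d1 d2. rewrite Cdiv_conj, Cplus_conj by exact N1.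
      transitivity (nu * (Cconj d1 * d2 - (Cconj al + Cconj l) * (al + m)) / (Cconj d1 * d2))%C;
        [field; now split|].
      f_equal. f_equal. rewrite C1, Ee. unfold d2, nu. ring. }
  set (P := (k * (l * mob al l))%C) in *. set (Q := (k * (m * mob al m))%C) in *.
  assert (E4 : nsq (nu - Cconj P * Q) = nsq l * nsq m * (e * e * nsq (1 - nu)) / (nsq d1 * nsq d2)).
  { rewrite E3, nsq_div by now apply Cmult_neq_0. rewrite !nsq_mult, nsq_RtoC, nsq_conj.
    unfold nu at 1. rewrite nsq_mult, nsq_conj. field. split; lra. }
  assert (E5 : forall u : C, fst (Cconj (nu - Cconj P * Q) * (nu * u))%C
     = nsq l * nsq m * e / (nsq d1 * nsq d2) * fst (Cconj (1 - nu) * (u * (Cconj d1 * d2)))%C).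
  { intro u. rewrite Rmult_comm, <- fst_mult_RtoC. f_equal. rewrite E3.
    rewrite Cdiv_conj, !Cmult_conj, Cconj_conj by now apply Cmult_neq_0.
    replace (Cconj (RtoC e)) with (RtoC e) by (apply injective_projections; simpl; ring).
    rewrite RtoC_div, !RtoC_mult, <- !Cconj_mult_nsq.
    2: { apply Rgt_not_eq, Rmult_lt_0_compat; assumption. }
    unfold nu. rewrite Cmult_conj, Cconj_conj. field. repeat split; assumption. }
  exists (2 * (nsq l * nsq m * e / (nsq d1 * nsq d2))). split.
  { apply Rmult_lt_0_compat; [lra|]. apply Rdiv_lt_0_compat; [|now apply Rmult_lt_0_compat].
    apply Rmult_lt_0_compat; [now apply Rmult_lt_0_compat | unfold e; lra]. }
  unfold pick_deriv, tight_deriv. fold nu.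
  rewrite E1, E2, E4, E5.
  set (u := (Cconj z1 + z2)%C).
  assert (E6 : fst (Cconj (1 - nu) * (u * (1 + nu + al * Cconj l + Cconj al * m)))%C
     = fst (Cconj (1 - nu) * (u * (Cconj d1 * d2)))%C + e * fst (Cconj (1 - nu) * (nu * u))%C).
  { rewrite (Rmult_comm e), <- fst_mult_RtoC, Ee, C1. unfold d2.
    match goal with |- fst ?X = fst ?Y + fst ?Z => change (fst X = fst (Y + Z)%C) end.
    f_equal. unfold nu. ring. }
  rewrite E6.
  assert (E7 : 1 + nsq l + 2 * fst (Cconj al * l)%C = nsq d1 + e * nsq l).
  { unfold d1, e, nsq; destruct al, l; simpl; ring. }
  assert (E8 : 1 + nsq m + 2 * fst (Cconj al * m)%C = nsq d2 + e * nsq m).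
  { unfold d2, e, nsq; destruct al, m; simpl; ring. }
  rewrite E7, E8.
  generalize (fst (Cconj (1 - nu) * (u * (Cconj d1 * d2)))%C) (fst (Cconj (1 - nu) * (nu * u))%C).
  intros X Y. field. split; lra.
Qed.

(* The parameter [al] for which [x (x + al) / (1 + al~ x)] takes equal values at [l] and [m]. *)
Definition alpha_eq (l m : C) : C :=
  ((l * m * Cconj (l + m) - (l + m)) / RtoC (1 - nsq (l * m)))%C.

Lemma alpha_eq_spec (l m : C) : nsq (l * m) < 1 ->
  (alpha_eq l m + l * m * Cconj (alpha_eq l m))%C = (- (l + m))%C.
Proof.
  intro H. assert (N : RtoC (1 - nsq (l * m)) <> 0%C) by (intro E; apply RtoC_inj in E; lra).
  unfold alpha_eq. rewrite Cdiv_conj by exact N.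
  replace (Cconj (RtoC (1 - nsq (l * m)))) with (RtoC (1 - nsq (l * m)))
    by (apply injective_projections; simpl; ring).
  rewrite Cminus_conj, Cmult_conj, Cconj_conj.
  transitivity (- (l + m) * (1 - (l * m) * Cconj (l * m)) / RtoC (1 - nsq (l * m)))%C.
  - field. exact N.
  - rewrite Cconj_mult_nsq, <- RtoC_minus. field. exact N.
Qed.

(* Every real-linear functional of [al - alpha_eq l m] is, up to a positive factor, the derivative in
   a direction that preserves [|l m|] to first order. *)
Lemma tight_deriv_direction (l m eps : C) : nsq l < 1 -> nsq m < 1 -> l <> m ->
  exists z1 z2 K, 0 < K /\ fst z1 + fst z2 = 0 /\ forall al,
    tight_deriv al l m z1 z2 = K * fst (Cconj (al - alpha_eq l m) * eps)%C.
Proof.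
  intros Hl Hm Hlm.
  assert (Hlm1 : nsq (l * m) < 1) by (rewrite nsq_mult; apply nsq_mult_lt1; lra).
  set (nu := (Cconj l * m)%C).
  assert (NS : 0 < nsq (1 - nu)).
  { apply nsq_neq0, one_minus_neq0, nsq_mult_lt1; lra. }
  set (S := nsq (1 - nu)) in *.
  (* Along [z1 = x], [z2 = - x + i y] the derivative involves [al] only through [Re (al~ m1)] and
     [Im (al~ m2)], see [L]. The choice of [x] and [y] comes from the identity [Re (d~ m1) Re (eps
     m2~) - Im (d~ m2) Im (eps m1~) = Re (m1 m2~) Re (d~ eps)]. *)
  set (m1 := (l * RtoC (1 - nsq m) - m * RtoC (1 - nsq l))%C).
  set (m2 := (l * RtoC (1 + nsq m) - m * RtoC (1 + nsq l))%C).
  set (x := fst (eps * Cconj m2)%C / (2 * S)).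
  set (y := snd (eps * Cconj m1)%C / ((1 - nsq l) * (1 - nsq m))).
  set (K := fst (m1 * Cconj m2)%C).
  assert (HK : 0 < K).
  { replace K with ((1 - nsq (l * m)) * nsq (l - m)).
    - apply Rmult_lt_0_compat; [lra|]. apply nsq_neq0. now apply Cminus_neq0.
    - unfold K, m1, m2, nsq. destruct l, m. simpl. ring. }
  exists (RtoC x), ((- x)%R, y), K. split; [exact HK|]. split; [simpl; ring|].
  assert (Ha := alpha_eq_spec l m Hlm1). set (a := alpha_eq l m) in *. clearbody a.
  (* At [a = alpha_eq l m] both expressions vanish: they are the real and imaginary parts of its
     defining equation multiplied by [(l - m)~]. *)
  assert (A1 : nsq l - nsq m + fst (Cconj a * m1)%C = 0).
  { assert (Q : (l + m + a + l * m * Cconj a)%C = 0%C) by (replace (l + m + a + l * m * Cconj a)%C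
      with (l + m + (a + l * m * Cconj a))%C by ring; rewrite Ha; ring).
    transitivity (fst ((l + m + a + l * m * Cconj a) * Cconj (l - m))%C).
    - unfold m1, nsq. destruct l, m, a. simpl. ring.
    - rewrite Q, Cmult_0_l. reflexivity. }
  assert (A2 : 2 * snd nu - snd (Cconj a * m2)%C = 0).
  { assert (Q : (l + m + a + l * m * Cconj a)%C = 0%C) by (replace (l + m + a + l * m * Cconj a)%C
      with (l + m + (a + l * m * Cconj a))%C by ring; rewrite Ha; ring).
    transitivity (snd ((l + m + a + l * m * Cconj a) * Cconj (l - m))%C).
    - unfold m2, nu, nsq. destruct l, m, a. simpl. ring.
    - rewrite Q, Cmult_0_l. reflexivity. }
  intro al.
  assert (L : tight_deriv al l m (RtoC x) ((- x)%R, y) =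
    2 * S * x * (nsq l - nsq m + fst (Cconj al * m1)%C)
    + (1 - nsq l) * (1 - nsq m) * y * (2 * snd nu - snd (Cconj al * m2)%C)).
  { unfold tight_deriv. fold nu S.
    replace (Cconj (RtoC x) + ((- x)%R, y))%C with ((0, y) : C)
      by (apply injective_projections; simpl; ring).
    clearbody x y S. unfold m1, m2, nu, nsq. destruct l, m, al. simpl. ring. }
  rewrite L.
  replace (2 * S * x) with (fst (eps * Cconj m2)%C) by (unfold x; field; lra).
  replace ((1 - nsq l) * (1 - nsq m) * y) with (snd (eps * Cconj m1)%C) by (unfold y; field; lra).
  replace (nsq l - nsq m + fst (Cconj al * m1)%C) with (fst (Cconj (al - a) * m1)%C).
  2: { rewrite <- (Rplus_0_r (nsq l - nsq m + _)), <- Ropp_0, <- A1, Cminus_conj.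
    generalize (nsq l) (nsq m) m1 (Cconj al) (Cconj a). intros r1 r2 w b c. destruct w, b, c. simpl. ring. }
  replace (2 * snd nu - snd (Cconj al * m2)%C) with (- snd (Cconj (al - a) * m2)%C).
  2: { rewrite <- (Rplus_0_r (2 * snd nu - _)), <- Ropp_0, <- A2, Cminus_conj.
    generalize (snd nu) m2 (Cconj al) (Cconj a). intros r w b c. destruct w, b, c. simpl. ring. }
  unfold K. clear. generalize (al - a)%C. intro d. destruct d, eps, m1, m2. simpl. ring.
Qed.

(** For nonzero vectors the bisector [s = |w2| w1 + |w1| w2] decides: it vanishes exactly when they
    are opposite, and otherwise has positive inner product with both. Applied to
    [al_j - alpha_eq l m], this yields either the weight [t] or a direction of descent. *)
Lemma two_vectors (w1 w2 : C) :
  (exists t, 0 <= t <= 1 /\ (RtoC t * w1 + RtoC (1 - t) * w2)%C = 0%C) \/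
  (exists eps, 0 < fst (Cconj w1 * eps)%C /\ 0 < fst (Cconj w2 * eps)%C).
Proof.
  destruct (Ceq_dec w1 0%C) as [->|N1].
  { left. exists 1. split; [lra|]. rewrite Rminus_diag. ring. }
  destruct (Ceq_dec w2 0%C) as [->|N2].
  { left. exists 0. split; [lra|]. rewrite Rminus_0_r. ring. }
  apply Cmod_gt_0 in N1. apply Cmod_gt_0 in N2.
  set (c1 := Cmod w1) in *. set (c2 := Cmod w2) in *.
  set (s := (RtoC c2 * w1 + RtoC c1 * w2)%C).
  assert (E1 : fst (Cconj w1 * s)%C * (2 * c2) = nsq s).
  { assert (Q1 := Cmod_sqr w1). assert (Q2 := Cmod_sqr w2). fold c1 in Q1. fold c2 in Q2.
    unfold s, nsq in *. clearbody c1 c2. destruct w1 as [a b], w2 as [c d]. simpl in *.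
    transitivity (2 * (c2 * c2) * (a * a + b * b) + 2 * (c1 * c2) * (a * c + b * d)); [ring|].
    transitivity ((c2 * c2) * (a * a + b * b) + 2 * (c1 * c2) * (a * c + b * d) + (c1 * c1) * (c * c + d * d)); [|ring].
    rewrite <- Q1, <- Q2. ring. }
  assert (E2 : fst (Cconj w2 * s)%C * (2 * c1) = nsq s).
  { assert (Q1 := Cmod_sqr w1). assert (Q2 := Cmod_sqr w2). fold c1 in Q1. fold c2 in Q2.
    unfold s, nsq in *. clearbody c1 c2. destruct w1 as [a b], w2 as [c d]. simpl in *.
    transitivity (2 * (c1 * c1) * (c * c + d * d) + 2 * (c1 * c2) * (a * c + b * d)); [ring|].
    transitivity ((c2 * c2) * (a * a + b * b) + 2 * (c1 * c2) * (a * c + b * d) + (c1 * c1) * (c * c + d * d)); [|ring].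
    rewrite <- Q1, <- Q2. ring. }
  destruct (Ceq_dec s 0%C) as [Es|Ns].
  - left. exists (c2 / (c1 + c2)). split.
    + split; [apply Rdiv_le_0_compat; lra|].
      apply Rmult_le_reg_r with (c1 + c2); [lra|]. unfold Rdiv. rewrite Rmult_assoc, Rinv_l; lra.
    + replace (1 - c2 / (c1 + c2)) with (c1 / (c1 + c2)) by (field; lra).
      transitivity (s * RtoC (/ (c1 + c2)))%C; [|rewrite Es; ring].
      unfold s, Rdiv. rewrite !RtoC_mult. ring.
  - right. apply nsq_neq0 in Ns. exists s. split.
    + apply Rmult_lt_reg_r with (2 * c2); [lra|]. rewrite E1. lra.
    + apply Rmult_lt_reg_r with (2 * c1); [lra|]. rewrite E2. lra.
Qed.

Lemma eventually_pos_right (f : R -> R) (d : R) : is_derive f 0 d ->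
  0 < f 0 \/ (f 0 = 0 /\ 0 < d) -> at_right 0 (fun h => 0 < f h).
Proof.
  intros Hd H. apply is_derive_Reals in Hd.
  assert (Hb : exists e, 0 < e /\ forall h, 0 < h < e -> 0 < f h).
  { destruct H as [H|[H Hp]].
    - destruct (derivable_pt_lim_bound f 0 d Hd 1 Rlt_0_1) as (e & He & K).
      assert (P := Rabs_pos d).
      exists (Rmin e (f 0 / (2 + Rabs d))). split.
      { apply Rmin_pos; [exact He | apply Rdiv_lt_0_compat; lra]. }
      intros h [H1 H2].
      assert (H3 : h < e) by (eapply Rlt_le_trans; [exact H2 | apply Rmin_l]).
      assert (H4 : h < f 0 / (2 + Rabs d)) by (eapply Rlt_le_trans; [exact H2 | apply Rmin_r]).
      specialize (K h). rewrite Rplus_0_l, (Rabs_pos_eq h) in K by lra.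
      specialize (K H3). apply Rabs_le_between in K.
      assert (h * (2 + Rabs d) < f 0).
      { apply Rmult_lt_compat_r with (r := 2 + Rabs d) in H4; [|lra].
        unfold Rdiv in H4. rewrite Rmult_assoc, Rinv_l, Rmult_1_r in H4 by lra. exact H4. }
      assert (- (Rabs d * h) <= d * h).
      { rewrite <- Ropp_mult_distr_l_reverse. apply Rmult_le_compat_r; [lra|].
        generalize (Rle_abs (- d)). rewrite Rabs_Ropp. lra. }
      lra.
    - destruct (derivable_pt_lim_bound f 0 d Hd (d / 2) ltac:(lra)) as (e & He & K).
      exists e. split; [exact He|]. intros h [H1 H2].
      specialize (K h). rewrite Rplus_0_l, (Rabs_pos_eq h) in K by lra.
      specialize (K H2). apply Rabs_le_between in K.
      assert (0 < d / 2 * h) by (apply Rmult_lt_0_compat; lra). lra. }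
  destruct Hb as (e & He & K). exists (mkposreal e He). intros h Hh Hp.
  change (Rabs (h - 0) < e) in Hh. rewrite Rminus_0_r, Rabs_pos_eq in Hh by lra. apply K; lra.
Qed.

Lemma is_derive_nsq_product (l m z1 z2 : C) :
  is_derive (fun h => nsq l * nsq m - nsq (bump l z1 h) * nsq (bump m z2 h)) 0
    (- (2 * nsq l * nsq m * (fst z1 + fst z2))).
Proof.
  apply (is_derive_ext (fun h => nsq l * nsq m -
    nsq l * (1 + 2 * h * fst z1 + h * h * nsq z1) * (nsq m * (1 + 2 * h * fst z2 + h * h * nsq z2)))).
  - intro h. now rewrite !nsq_bump.
  - auto_derive; [exact I | ring].
Qed.

Lemma at_right_nsq_bump_gt (w z : C) (a : R) : a < nsq w \/ (a = nsq w /\ 0 < nsq w * fst z) ->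
  at_right 0 (fun h => 0 < nsq (bump w z h) - a).
Proof.
  intros Ha. apply (eventually_pos_right _ (2 * nsq w * fst z - 0)).
  - apply (is_derive_minus (K := R_AbsRing) (V := R_NormedModule) (fun h => nsq (bump w z h)) (fun _ => a)).
    + apply is_derive_nsq_bump.
    + apply (is_derive_const (K := R_AbsRing) (V := R_NormedModule)).
  - rewrite bump_0. destruct Ha as [Ha|[Ha Ha']]; [left; lra | right; split; lra].
Qed.

Lemma at_right_nsq_bump_lt1 (w z : C) : nsq w < 1 \/ (nsq w = 1 /\ fst z < 0) ->
  at_right 0 (fun h => 0 < 1 - nsq (bump w z h)).
Proof.
  intros Ha. apply (eventually_pos_right _ (0 - 2 * nsq w * fst z)).
  - apply (is_derive_minus (K := R_AbsRing) (V := R_NormedModule) (fun _ => 1) (fun h => nsq (bump w z h))).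
    + apply (is_derive_const (K := R_AbsRing) (V := R_NormedModule)).
    + apply is_derive_nsq_bump.
  - rewrite bump_0. destruct Ha as [Ha|[Ha Ha']]; [left; lra | right; rewrite Ha; split; lra].
Qed.

Lemma bump_improves (p q : C * C) (l m z1 z2 : C) :
  nsq l < 1 -> nsq m < 1 -> l <> 0%C -> m <> 0%C ->
  nsq (fst p) < nsq l -> nsq (snd p) < nsq l -> nsq (fst q) < nsq m -> nsq (snd q) < nsq m ->
  fst z1 + fst z2 < 0 ->
  (0 < pick (fst p) (fst q) l m \/
    (pick (fst p) (fst q) l m = 0 /\ 0 < pick_deriv (fst p) (fst q) l m z1 z2)) ->
  (0 < pick (snd p) (snd q) l m \/
    (pick (snd p) (snd q) l m = 0 /\ 0 < pick_deriv (snd p) (snd q) l m z1 z2)) ->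
  exists l' m', nsq l' <= 1 /\ nsq m' <= 1 /\ feas2 p q l' m' /\
    nsq l' * nsq m' < nsq l * nsq m.
Proof.
  intros Hl Hm Hl0 Hm0 Hp1 Hp2 Hq1 Hq2 Hz H1 H2.
  assert (Pk : forall a b, (0 < pick a b l m \/ (pick a b l m = 0 /\ 0 < pick_deriv a b l m z1 z2)) ->
    at_right 0 (fun h => 0 < pick a b (bump l z1 h) (bump m z2 h))).
  { intros a b Hab. apply (eventually_pos_right _ _ (is_derive_pick a b l m z1 z2)).
    now rewrite !bump_0. }
  assert (Ob : at_right 0 (fun h => 0 < nsq l * nsq m - nsq (bump l z1 h) * nsq (bump m z2 h))).
  { apply (eventually_pos_right _ _ (is_derive_nsq_product l m z1 z2)). right.
    rewrite !bump_0. split; [ring|].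
    assert (0 < nsq l * nsq m) by (apply Rmult_lt_0_compat; now apply nsq_neq0). nra. }
  destruct (filter_ex (F := at_right 0) _ (filter_and _ _ (filter_and _ _ (Pk _ _ H1) (Pk _ _ H2))
    (filter_and _ _ (filter_and _ _
      (filter_and _ _ (at_right_nsq_bump_gt l z1 _ (or_introl Hp1)) (at_right_nsq_bump_gt l z1 _ (or_introl Hp2)))
      (filter_and _ _ (at_right_nsq_bump_gt m z2 _ (or_introl Hq1)) (at_right_nsq_bump_gt m z2 _ (or_introl Hq2))))
      (filter_and _ _ Ob (filter_and _ _ (at_right_nsq_bump_lt1 l z1 (or_introl Hl))
        (at_right_nsq_bump_lt1 m z2 (or_introl Hm)))))))
    as (h & (K1 & K2) & ((K3 & K4) & (K5 & K6)) & K7 & K8 & K9).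
  exists (bump l z1 h), (bump m z2 h). unfold feas2, feas. repeat split; lra.
Qed.

Lemma cara_val_swap (p q : C * C) (r : R) :
  cara_val (snd p, fst p) (snd q, fst q) O2 r -> cara_val p q O2 r.
Proof.
  intros (F & HF & E1 & E2 & E3). exists (fun a => F (snd a, fst a)).
  split; [now apply holo2_swap|]. now repeat split.
Qed.

(** Moving [z1] by [- d] turns a variation that is neutral for [|l m|] into one that decreases it;
    by linearity, positive derivatives stay positive for small [d]. *)
Lemma pick_deriv_shift (p q l m z1 z2 : C) (d : R) :
  pick_deriv p q l m (z1 - RtoC d) z2 = pick_deriv p q l m z1 z2 - d * pick_deriv p q l m 1 0.
Proof.
  unfold pick_deriv. cbv zeta.
  generalize (nsq (1 - Cconj l * m)%C) (nsq (Cconj l * m - Cconj p * q)%C)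
    (Cconj (Cconj l * m - Cconj p * q))%C (Cconj (1 - Cconj l * m))%C (Cconj l * m)%C
    (nsq l) (nsq m) (nsq p) (nsq q).
  intros s t [a b] [c e] [f g] r1 r2 r3 r4. destruct z1, z2. simpl. ring.
Qed.

Lemma small_shift (d1 d2 e1 e2 : R) : 0 < d1 -> 0 < d2 ->
  exists d, 0 < d /\ 0 < d1 - d * e1 /\ 0 < d2 - d * e2.
Proof.
  intros H1 H2. assert (P1 := Rabs_pos e1). assert (P2 := Rabs_pos e2).
  set (M := 1 + Rabs e1 + Rabs e2). assert (HM : 0 < M) by (unfold M; lra).
  assert (P : 0 < Rmin d1 d2) by now apply Rmin_pos.
  exists (Rmin d1 d2 / (2 * M)). set (d := Rmin d1 d2 / (2 * M)).
  assert (Hd : 0 < d) by (apply Rdiv_lt_0_compat; lra).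
  assert (E : d * M = Rmin d1 d2 / 2) by (unfold d; field; lra).
  generalize (Rmin_l d1 d2) (Rmin_r d1 d2). intros L1 L2.
  assert (d * e1 <= d * M) by (apply Rmult_le_compat_l; [lra|]; generalize (Rle_abs e1); unfold M; lra).
  assert (d * e2 <= d * M) by (apply Rmult_le_compat_l; [lra|]; generalize (Rle_abs e2); unfold M; lra).
  repeat split; lra.
Qed.

(** If a diagonal entry vanishes, nonnegativity of the determinant forces [l~ m = p_1~ q_1], so
    [|l m|] is the modulus at 0 of a product of two Moebius maps in the first coordinate. *)
Lemma cara_val_degenerate (p q : C * C) (l m : C) : p <> O2 -> q <> O2 ->
  nsq (fst p) < 1 -> nsq (fst q) < 1 -> nsq l < 1 -> nsq m < 1 ->
  feas (fst p) (fst q) l m -> nsq (fst p) = nsq l \/ nsq (fst q) = nsq m ->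
  cara_val p q O2 (Cmod l * Cmod m).
Proof.
  intros Hp Hq Hp1 Hq1 Hl Hm (F1 & F2 & F3) E.
  replace (Cmod l * Cmod m) with (Cmod (fst p) * Cmod (fst q)); [now apply cara_val_product|].
  assert (K : nsq (Cconj l * m - Cconj (fst p) * fst q) = 0).
  { unfold pick in F3.
    assert (0 < (1 - nsq l) * (1 - nsq m)) by (apply Rmult_lt_0_compat; lra).
    assert (P := nsq_pos (Cconj l * m - Cconj (fst p) * fst q)).
    destruct E as [E|E]; rewrite E in F3; nra. }
  apply nsq_eq0, Cminus_eq0 in K.
  rewrite <- (Cmod_conj l), <- (Cmod_conj (fst p)), <- !Cmod_mult, K. reflexivity.
Qed.

(** When [al] is the parameter with equal values at [l] and [m], the first coordinates of [p] and
    [q] are both [- k l m], and one Moebius map in that coordinate suffices. *)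
Lemma cara_val_single (k al l m : C) (p q : C * C) : nsq k = 1 -> nsq al < 1 ->
  nsq l < 1 -> nsq m < 1 -> al = alpha_eq l m ->
  fst p = (k * (l * mob al l))%C -> fst q = (k * (m * mob al m))%C ->
  cara_val p q O2 (Cmod l * Cmod m).
Proof.
  intros Hk Hal Hl Hm Ea Ep Eq.
  assert (Hlm : nsq (l * m) < 1) by (rewrite nsq_mult; apply nsq_mult_lt1; lra).
  assert (S := alpha_eq_spec l m Hlm). rewrite <- Ea in S.
  assert (V : forall x y : C, nsq x < 1 -> (al + x * y * Cconj al)%C = (- (x + y))%C ->
    (k * (x * mob al x))%C = (- (k * (x * y)))%C).
  { intros x y Hx Hxy. assert (N := mob_den_neq0 al x (nsq_mult_lt1 al x Hal (Rlt_le _ _ Hx))).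
    unfold mob. replace (al + x)%C with (- y * (1 + Cconj al * x))%C; [field; exact N|].
    transitivity (al + x - ((al + x * y * Cconj al) + (x + y)))%C; [ring|]. rewrite Hxy. ring. }
  rewrite (V l m Hl S) in Ep.
  rewrite (V m l Hm) in Eq by (rewrite (Cmult_comm m l), (Cplus_comm m l); exact S).
  replace (Cmod l * Cmod m) with (Cmod (fst p)).
  - apply cara_val_same_fst.
    + rewrite Ep, nsq_opp, nsq_mult, Hk. lra.
    + rewrite Ep, Eq. ring.
  - rewrite Ep, Cmod_opp, !Cmod_mult. apply nsq_eq1 in Hk. rewrite Hk. ring.
Qed.

Lemma feas2_nonzero (p q : C * C) (l m : C) : p <> q -> p <> O2 -> q <> O2 ->
  nsq l < 1 -> feas2 p q l m -> l <> m /\ l <> 0%C /\ m <> 0%C.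
Proof.
  intros Hpq Hp Hq Hl [F1 F2].
  assert (Hz : forall (a : C * C) (b : C), a <> O2 -> nsq (fst a) <= nsq b -> nsq (snd a) <= nsq b -> b <> 0%C).
  { intros [a1 a2] b Ha K1 K2 E. simpl in *. rewrite E, nsq_RtoC in *. apply Ha.
    unfold O2. f_equal; apply nsq_eq0; [generalize (nsq_pos a1) | generalize (nsq_pos a2)]; lra. }
  assert (Hl0 : l <> 0%C) by (apply (Hz p l Hp); [apply F1 | apply F2]).
  split; [|split; [exact Hl0 | apply (Hz q m Hq); [apply F1 | apply F2]]].
  intro E. apply Hpq. destruct p, q. f_equal.
  - exact (feas_neq _ _ l m Hl0 Hl F1 E).
  - exact (feas_neq _ _ l m Hl0 Hl F2 E).
Qed.

Lemma interior_minimizer (p q : C * C) (l m : C) : p <> q -> p <> O2 -> q <> O2 ->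
  nsq (fst p) < 1 -> nsq (snd p) < 1 -> nsq (fst q) < 1 -> nsq (snd q) < 1 ->
  nsq l < 1 -> nsq m < 1 -> is_min p q l m -> cara_val p q O2 (Cmod l * Cmod m).
Proof.
  intros Hpq Hp Hq Hp1 Hp2 Hq1 Hq2 Hl Hm (_ & _ & HF & Hmin).
  destruct (feas2_nonzero p q l m Hpq Hp Hq Hl HF) as (Hlm & Hl0 & Hm0).
  destruct HF as [F1 F2].
  destruct (Req_dec (nsq (fst p)) (nsq l)) as [E|D1]; [apply cara_val_degenerate; tauto|].
  destruct (Req_dec (nsq (fst q)) (nsq m)) as [E|D2]; [apply cara_val_degenerate; tauto|].
  assert (Sw : forall a : C * C, a <> O2 -> (snd a, fst a) <> O2).
  { intros [a1 a2] Ha E. apply Ha. unfold O2 in *. now inversion E. }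
  destruct (Req_dec (nsq (snd p)) (nsq l)) as [E|D3].
  { apply cara_val_swap, cara_val_degenerate; simpl; auto. }
  destruct (Req_dec (nsq (snd q)) (nsq m)) as [E|D4].
  { apply cara_val_swap, cara_val_degenerate; simpl; auto. }
  destruct F1 as (A1 & A2 & A3), F2 as (B1 & B2 & B3).
  assert (L1 : nsq (fst p) < nsq l) by lra. assert (L2 : nsq (fst q) < nsq m) by lra.
  assert (L3 : nsq (snd p) < nsq l) by lra. assert (L4 : nsq (snd q) < nsq m) by lra.
  assert (No : forall z1 z2, fst z1 + fst z2 < 0 ->
    (0 < pick (fst p) (fst q) l m \/ (pick (fst p) (fst q) l m = 0 /\ 0 < pick_deriv (fst p) (fst q) l m z1 z2)) ->
    (0 < pick (snd p) (snd q) l m \/ (pick (snd p) (snd q) l m = 0 /\ 0 < pick_deriv (snd p) (snd q) l m z1 z2)) ->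
    False).
  { intros z1 z2 Hz12 K1 K2.
    destruct (bump_improves p q l m z1 z2) as (l' & m' & M1 & M2 & M3 & M4); try assumption.
    specialize (Hmin l' m' M1 M2 M3). lra. }
  (* The direction given by [tight_deriv_direction] leaves [|l m|] stationary and a small shift
     makes it decrease, so no [eps] is positive on every tight coordinate. *)
  assert (No2 : forall eps,
    (0 < pick (fst p) (fst q) l m \/ (pick (fst p) (fst q) l m = 0 /\
       exists k al, nsq k = 1 /\ nsq al < 1 /\ fst p = (k * (l * mob al l))%C /\ fst q = (k * (m * mob al m))%C /\
         0 < fst (Cconj (al - alpha_eq l m) * eps)%C)) ->
    (0 < pick (snd p) (snd q) l m \/ (pick (snd p) (snd q) l m = 0 /\
       exists k al, nsq k = 1 /\ nsq al < 1 /\ snd p = (k * (l * mob al l))%C /\ snd q = (k * (m * mob al m))%C /\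
         0 < fst (Cconj (al - alpha_eq l m) * eps)%C)) -> False).
  { intros eps K1 K2.
    destruct (tight_deriv_direction l m eps Hl Hm Hlm) as (z1 & z2 & K & HK & Ez & HD).
    assert (Pd : forall a b,
      (0 < pick a b l m \/ (pick a b l m = 0 /\
       exists k al, nsq k = 1 /\ nsq al < 1 /\ a = (k * (l * mob al l))%C /\ b = (k * (m * mob al m))%C /\
         0 < fst (Cconj (al - alpha_eq l m) * eps)%C)) ->
      0 < pick a b l m \/ (pick a b l m = 0 /\ 0 < pick_deriv a b l m z1 z2)).
    { intros a b [Q|[Q1 (k & al & Hk & Hal & Ea & Eb & Q2)]]; [now left|].
      right. split; [exact Q1|]. rewrite Ea, Eb.
      destruct (pick_deriv_tight k al l m z1 z2 Hk Hal Hl Hm Hl0 Hm0) as (K' & HK' & ->).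
      rewrite HD. apply Rmult_lt_0_compat; [exact HK'|]. now apply Rmult_lt_0_compat. }
    apply Pd in K1. apply Pd in K2.
    set (d1 := pick_deriv (fst p) (fst q) l m z1 z2) in *.
    set (d2 := pick_deriv (snd p) (snd q) l m z1 z2) in *.
    (* The default 1 stands in for a derivative that is not positive: that coordinate is slack, and
       its derivative is never consulted. *)
    destruct (small_shift (if Rlt_dec 0 d1 then d1 else 1) (if Rlt_dec 0 d2 then d2 else 1)
      (pick_deriv (fst p) (fst q) l m 1 0) (pick_deriv (snd p) (snd q) l m 1 0)) as (d & Hd & S1 & S2).
    { destruct (Rlt_dec 0 d1); lra. } { destruct (Rlt_dec 0 d2); lra. }
    apply (No (z1 - RtoC d)%C z2).
    - simpl. lra.
    - destruct K1 as [K1|[K1 K1']]; [now left|]. right. split; [exact K1|].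
      rewrite pick_deriv_shift. fold d1. destruct (Rlt_dec 0 d1); [exact S1 | contradiction].
    - destruct K2 as [K2|[K2 K2']]; [now left|]. right. split; [exact K2|].
      rewrite pick_deriv_shift. fold d2. destruct (Rlt_dec 0 d2); [exact S2 | contradiction]. }
  assert (Hlm1 : nsq (l * m) < 1) by (rewrite nsq_mult; apply nsq_mult_lt1; lra).
  assert (Self : forall w : C, w <> 0%C -> 0 < fst (Cconj w * w)%C).
  { intros w Hw. replace (fst (Cconj w * w)%C) with (nsq w); [now apply nsq_neq0|].
    unfold nsq; destruct w; simpl; ring. }
  (* Cases by which determinants vanish. If neither does, any decreasing direction contradicts
     minimality; if just one does, [eps = al - alpha_eq l m] itself improves unless it is 0. *)
  destruct (Rle_lt_or_eq _ _ A3) as [T1|T1]; destruct (Rle_lt_or_eq _ _ B3) as [T2|T2].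
  - exfalso. now apply (No2 0%C); left.
  - symmetry in T2.
    destruct (pick_tight _ _ l m Hlm Hl0 Hm0 Hl Hm L3 L4 T2) as (k & al & Hk & Hal & Ep & Eq).
    destruct (Ceq_dec al (alpha_eq l m)) as [E|N].
    + apply cara_val_swap, (cara_val_single k al); assumption.
    + exfalso. apply (No2 (al - alpha_eq l m)%C); [now left|]. right. split; [exact T2|].
      exists k, al. repeat (split; [assumption|]). now apply Self, Cminus_neq0.
  - symmetry in T1.
    destruct (pick_tight _ _ l m Hlm Hl0 Hm0 Hl Hm L1 L2 T1) as (k & al & Hk & Hal & Ep & Eq).
    destruct (Ceq_dec al (alpha_eq l m)) as [E|N].
    + apply (cara_val_single k al); assumption.
    + exfalso. apply (No2 (al - alpha_eq l m)%C); [|now left]. right. split; [exact T1|].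
      exists k, al. repeat (split; [assumption|]). now apply Self, Cminus_neq0.
  - symmetry in T1. symmetry in T2.
    destruct (pick_tight _ _ l m Hlm Hl0 Hm0 Hl Hm L1 L2 T1) as (k1 & a1 & Hk1 & Ha1 & Ep1 & Eq1).
    destruct (pick_tight _ _ l m Hlm Hl0 Hm0 Hl Hm L3 L4 T2) as (k2 & a2 & Hk2 & Ha2 & Ep2 & Eq2).
    destruct (two_vectors (a1 - alpha_eq l m)%C (a2 - alpha_eq l m)%C) as [(t & Ht & E)|(eps & E1 & E2)].
    + assert (Em : (RtoC t * a1 + RtoC (1 - t) * a2)%C = alpha_eq l m).
      { apply Cminus_eq0. rewrite <- E, RtoC_minus. ring. }
      apply (cara_val_extremal t k1 k2 a1 a2 l m); try assumption.
      * rewrite Em. now apply alpha_eq_spec.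
      * rewrite <- Ep1, <- Ep2. apply surjective_pairing.
      * rewrite <- Eq1, <- Eq2. apply surjective_pairing.
    + exfalso. apply (No2 eps); right; (split; [assumption|]).
      * exists k1, a1. now repeat (split; [assumption|]).
      * exists k2, a2. now repeat (split; [assumption|]).
Qed.

(** * Minimisers on the boundary *)

(** Given the Schwarz inequality, this is equality of supremum and infimum, in a form that does not
    ask for either to be attained and survives small perturbations of the poles. *)
Definition approx_eq (p q z : C * C) : Prop :=
  forall eps, 0 < eps -> exists r s, cara_val p q z r /\ lemp_val p q z s /\ s < r + eps.

Definition swap (a : C * C) : C * C := (snd a, fst a).

Lemma swap_swap (a : C * C) : swap (swap a) = a.
Proof. now destruct a. Qed.

Lemma pick_sym (p q l m : C) : pick q p m l = pick p q l m.
Proof.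
  unfold pick. rewrite <- (nsq_conj (1 - Cconj m * l)), <- (nsq_conj (Cconj m * l - _)).
  rewrite !Cminus_conj, !Cmult_conj, !Cconj_conj.
  replace (Cconj (RtoC 1)) with (RtoC 1) by (apply injective_projections; simpl; ring).
  rewrite (Cmult_comm m), (Cmult_comm q). ring.
Qed.

Lemma feas2_sym (p q : C * C) (l m : C) : feas2 p q l m -> feas2 q p m l.
Proof. unfold feas2, feas. rewrite !(pick_sym _ _ l m). tauto. Qed.

Lemma feas2_swap (p q : C * C) (l m : C) : feas2 p q l m -> feas2 (swap p) (swap q) l m.
Proof. unfold feas2. simpl. tauto. Qed.

Lemma is_min_sym (p q : C * C) (l m : C) : is_min p q l m -> is_min q p m l.
Proof.
  intros (H1 & H2 & H3 & H4). split; [exact H2|split; [exact H1|]].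
  split; [now apply feas2_sym|]. intros l' m' K1 K2 K3.
  rewrite (Rmult_comm (nsq m)), (Rmult_comm (nsq l')).
  apply H4; [exact K2 | exact K1 | now apply feas2_sym].
Qed.

Lemma is_min_swap (p q : C * C) (l m : C) : is_min p q l m -> is_min (swap p) (swap q) l m.
Proof.
  intros (H1 & H2 & H3 & H4). split; [exact H1|split; [exact H2|]].
  split; [now apply feas2_swap|]. intros l' m' K1 K2 K3.
  apply H4; [exact K1 | exact K2 |].
  rewrite <- (swap_swap p), <- (swap_swap q). now apply feas2_swap.
Qed.

Lemma lemp_val_swap (p q z : C * C) (s : R) :
  lemp_val (swap p) (swap q) (swap z) s -> lemp_val p q z s.
Proof.
  intros (f & g & l & m & Hf & Hg & Hl & Hm & E0 & E1 & E2 & Es).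
  exists g, f, l, m. destruct p, q, z. unfold swap in *. simpl in *.
  inversion E0. inversion E1. inversion E2. repeat (split; [assumption|]).
  repeat split; congruence.
Qed.

Lemma approx_eq_sym (p q z : C * C) : approx_eq q p z -> approx_eq p q z.
Proof.
  intros H eps He. destruct (H eps He) as (r & s & (F & HF & E1 & E2 & E3) & HL & Hrs).
  exists r, s. split; [exists F; tauto|]. split; [|exact Hrs].
  destruct HL as (f & g & l & m & Hf & Hg & Hl & Hm & K0 & K1 & K2 & Ks).
  exists f, g, m, l. repeat (split; [assumption|]). rewrite Ks. apply Rmult_comm.
Qed.

Lemma approx_eq_swap (p q : C * C) : approx_eq (swap p) (swap q) O2 -> approx_eq p q O2.
Proof.
  intros H eps He. destruct (H eps He) as (r & s & HC & HL & Hrs).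
  exists r, s. split; [now apply cara_val_swap|]. split; [now apply lemp_val_swap | exact Hrs].
Qed.

Lemma lemp_val_of_feas2 (p q : C * C) (l m : C) : p <> q -> p <> O2 -> q <> O2 ->
  nsq l < 1 -> nsq m < 1 -> feas2 p q l m -> lemp_val p q O2 (Cmod l * Cmod m).
Proof.
  intros Hpq Hp Hq Hl Hm HF.
  destruct (feas2_nonzero p q l m Hpq Hp Hq Hl HF) as (N1 & N2 & N3).
  destruct (feas_interp _ _ l m N1 N2 N3 Hl Hm (proj1 HF)) as (f & Hf & f0 & f1 & f2).
  destruct (feas_interp _ _ l m N1 N2 N3 Hl Hm (proj2 HF)) as (g & Hg & g0 & g1 & g2).
  exists f, g, l, m. rewrite f0, g0, f1, g1, f2, g2, <- !surjective_pairing.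
  now repeat (split; [assumption || reflexivity|]).
Qed.

(* Pairs [(l, m)] near the degenerate pair [(1, m0)], [|m0| = |q2|]. *)
Lemma boundary_feasible (p q : C * C) (m0 : C) (c : R) :
  nsq (fst p) < 1 -> nsq (snd p) < 1 -> nsq (snd q) < 1 ->
  nsq (fst q) < nsq (snd q) -> nsq m0 = nsq (snd q) -> 0 < c ->
  (1 - nsq (snd q)) * nsq (m0 - Cconj (snd p) * snd q) <
    c * nsq (snd q) * (1 - nsq (snd p)) * nsq (1 - m0) ->
  at_right 0 (fun h => nsq (bump 1 (-1) h) < 1 /\ nsq (bump m0 c h) < 1 /\
    feas2 p q (bump 1 (-1) h) (bump m0 c h)).
Proof.
  intros Hp1 Hp2 Hq2 Hq Hm0 Hc H.
  assert (N1 : nsq 1 = 1) by (rewrite nsq_RtoC; ring).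
  assert (Q0 : 0 < nsq (snd q)) by (generalize (nsq_pos (fst q)); lra).
  assert (E1 : (Cconj 1 * m0)%C = m0) by (apply injective_projections; simpl; ring).
  assert (S0 : 0 < nsq (1 - m0)).
  { rewrite <- E1. apply nsq_neq0, one_minus_neq0. rewrite N1, Hm0. lra. }
  assert (P1 : at_right 0 (fun h => 0 < pick (fst p) (fst q) (bump 1 (-1) h) (bump m0 c h))).
  { apply (eventually_pos_right _ _ (is_derive_pick _ _ 1 m0 (-1) c)). left.
    rewrite !bump_0. unfold pick. rewrite N1, Hm0, E1.
    assert (0 < (1 - nsq (fst p)) * (nsq (snd q) - nsq (fst q)) * nsq (1 - m0)); [|lra].
    apply Rmult_lt_0_compat; [apply Rmult_lt_0_compat; lra | exact S0]. }
  (* At [(1, m0)] both terms of the second determinant vanish; the hypothesis on [c] says that its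
     derivative in the direction [(-1, c)] is positive. *)
  assert (P2 : at_right 0 (fun h => 0 < pick (snd p) (snd q) (bump 1 (-1) h) (bump m0 c h))).
  { apply (eventually_pos_right _ _ (is_derive_pick _ _ 1 m0 (-1) c)). right.
    rewrite !bump_0. unfold pick, pick_deriv. cbv zeta. rewrite N1, Hm0, E1. split; [ring|].
    change (fst (RtoC (-1))) with (-1). change (fst (RtoC c)) with c. lra. }
  assert (U1 := at_right_nsq_bump_gt 1%C (RtoC (-1)) (nsq (fst p)) ltac:(left; rewrite N1; lra)).
  assert (U2 := at_right_nsq_bump_gt 1%C (RtoC (-1)) (nsq (snd p)) ltac:(left; rewrite N1; lra)).
  assert (U3 := at_right_nsq_bump_gt m0 (RtoC c) (nsq (fst q)) ltac:(left; lra)).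
  assert (U4 : at_right 0 (fun h => 0 < nsq (bump m0 c h) - nsq (snd q))).
  { apply at_right_nsq_bump_gt. right. split; [lra|]. simpl. apply Rmult_lt_0_compat; lra. }
  assert (D1 := at_right_nsq_bump_lt1 1%C (RtoC (-1)) ltac:(right; rewrite N1; simpl; lra)).
  assert (D2 := at_right_nsq_bump_lt1 m0 (RtoC c) ltac:(left; lra)).
  generalize (filter_and _ _ (filter_and _ _ P1 P2) (filter_and _ _ (filter_and _ _ D1 D2)
    (filter_and _ _ (filter_and _ _ U1 U2) (filter_and _ _ U3 U4)))).
  apply filter_imp. intros h ((K1 & K2) & (K3 & K4) & (K5 & K6) & K7 & K8).
  unfold feas2, feas. repeat split; lra.
Qed.

(** At the boundary point [w~] the Poisson kernel of [p] exceeds that of [q]; such a point exists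
    because the kernels are distinct and have the same mean. On the circle the difference of the two
    sides is a constant minus [2 Re (w V)], so [w] is taken with [w V = - |V|]. *)
Lemma poisson_direction (p q : C) : nsq p < 1 -> nsq q < 1 -> p <> q ->
  exists w, nsq w = 1 /\
    (1 - nsq q) * nsq (w - Cconj p) < (1 - nsq p) * nsq (1 - w * q).
Proof.
  intros Hp Hq Hpq.
  set (V := (RtoC (1 - nsq p) * q - RtoC (1 - nsq q) * p)%C).
  assert (E : nsq V = (nsq p - nsq q) * (nsq p - nsq q) + (1 - nsq p) * (1 - nsq q) * nsq (p - q)).
  { unfold V, nsq. destruct p, q. simpl. ring. }
  assert (P : 0 < (1 - nsq p) * (1 - nsq q) * nsq (p - q)).
  { apply Rmult_lt_0_compat; [apply Rmult_lt_0_compat; lra | now apply nsq_neq0, Cminus_neq0]. }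
  assert (HV : Rabs (nsq p - nsq q) < Cmod V).
  { apply Rsqr_incrst_0; [|apply Rabs_pos | apply Cmod_ge_0].
    rewrite <- Rsqr_abs. unfold Rsqr. rewrite Cmod_sqr, E. lra. }
  assert (V0 : 0 < Cmod V) by (generalize (Rabs_pos (nsq p - nsq q)); lra).
  assert (VC : RtoC (Cmod V) <> 0%C) by (intro K; apply RtoC_inj in K; lra).
  exists (- Cconj V / RtoC (Cmod V))%C.
  set (w := (- Cconj V / RtoC (Cmod V))%C).
  assert (Ew : nsq w = 1).
  { unfold w. rewrite nsq_div, nsq_opp, nsq_conj, nsq_RtoC, Cmod_sqr by exact VC.
    rewrite <- Cmod_sqr. field. lra. }
  split; [exact Ew|].
  assert (EV : fst (w * V)%C = - Cmod V).
  { replace (w * V)%C with (- RtoC (Cmod V))%C; [reflexivity|].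
    unfold w. transitivity (- (V * Cconj V) / RtoC (Cmod V))%C; [|field; exact VC].
    rewrite Cconj_mult_nsq, <- Cmod_sqr, RtoC_mult. field. exact VC. }
  assert (EQ : (1 - nsq p) * nsq (1 - w * q) - (1 - nsq q) * nsq (w - Cconj p)
    = (1 - nsq p) * (1 + nsq w * nsq q) - (1 - nsq q) * (nsq w + nsq p) - 2 * fst (w * V)%C).
  { unfold V. generalize w. intros [w1 w2]. unfold nsq. destruct p, q. simpl. ring. }
  rewrite Ew, EV in EQ. generalize (Rle_abs (nsq p - nsq q)). lra.
Qed.

(** If [|l| = 1], the minimum of [|l m|] is at least [|q_2|]. For [p_2 = q_2] this value is reached
    by a Moebius map of the second coordinate and approached by discs with parameters near
    [(1, q_2)]; for [p_2 <> q_2] the Poisson direction gives feasible pairs with a smaller product,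
    so the case does not occur. *)
Lemma boundary_minimizer (p q : C * C) (l m : C) : p <> q -> p <> O2 -> q <> O2 ->
  nsq (fst p) < 1 -> nsq (snd p) < 1 -> nsq (fst q) < 1 -> nsq (snd q) < 1 ->
  nsq (fst q) < nsq (snd q) -> is_min p q l m -> nsq l = 1 -> approx_eq p q O2.
Proof.
  intros Hpq Hp Hq Hp1 Hp2 Hq1 Hq2 Hlt (M1 & M2 & M3 & M4) El.
  assert (Q0 : 0 < nsq (snd q)) by (generalize (nsq_pos (fst q)); lra).
  assert (Hmin : nsq (snd q) <= nsq l * nsq m) by (rewrite El, Rmult_1_l; apply M3).
  destruct (Ceq_dec (snd p) (snd q)) as [E|N].
  - intros eps He.
    assert (S0 : 0 < nsq (1 - snd q)).
    { apply nsq_neq0. replace (snd q) with (Cconj 1 * snd q)%C by (apply injective_projections; simpl; ring).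
      apply one_minus_neq0. rewrite (nsq_RtoC 1). lra. }
    (* For [p_2 = q_2] and [m0 = q_2] the condition of [boundary_feasible] amounts to [c > 1]; 2 is
       one such value, and the product tends to [|q_2|] as [h] tends to 0. *)
    assert (B := boundary_feasible p q (snd q) 2 Hp1 Hp2 Hq2 Hlt eq_refl ltac:(lra)).
    assert (Ob : at_right 0 (fun h => 0 < nsq (snd q) + eps * eps - nsq (bump 1 (-1) h) * nsq (bump (snd q) 2 h))).
    { apply (eventually_pos_right _ (- (2 * nsq 1 * nsq (snd q) * (fst (RtoC (-1)) + fst (RtoC 2))))).
      - apply (is_derive_ext (fun h => eps * eps + (nsq 1 * nsq (snd q) - nsq (bump 1 (-1) h) * nsq (bump (snd q) 2 h)))).
        + intro h. rewrite (nsq_RtoC 1). ring_simplify. reflexivity.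
        + match goal with |- is_derive _ _ ?d => replace d with (0 + d) by ring end.
          apply (is_derive_plus (K := R_AbsRing) (V := R_NormedModule) (fun _ => eps * eps)).
          * apply (is_derive_const (K := R_AbsRing) (V := R_NormedModule)).
          * apply is_derive_nsq_product.
      - left. rewrite !bump_0, nsq_RtoC. generalize (Rmult_lt_0_compat _ _ He He). lra. }
    destruct (filter_ex (F := at_right 0) _ (filter_and _ _ Ob (B ltac:(
      rewrite E; replace (snd q - Cconj (snd q) * snd q)%C with (snd q * (1 - Cconj (snd q)))%C by ring;
      replace (1 - Cconj (snd q))%C with (Cconj (1 - snd q)) by (apply injective_projections; simpl; ring);
      rewrite nsq_mult, nsq_conj;
      generalize (Rmult_lt_0_compat _ _ (Rmult_lt_0_compat _ _ Q0 (proj2 (Rlt_0_minus _ _) Hq2)) S0); lra))))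
      as (h & K1 & K2 & K3 & K4).
    exists (Cmod (snd q)), (Cmod (bump 1 (-1) h) * Cmod (bump (snd q) 2 h)).
    split; [|split].
    + rewrite <- E. apply cara_val_swap.
      exact (cara_val_same_fst (snd p, fst p) (snd q, fst q) Hp2 E).
    + now apply lemp_val_of_feas2.
    + apply Rsqr_incrst_0.
      * unfold Rsqr. rewrite <- !Cmod_sqr in K1. assert (P := Cmod_ge_0 (snd q)).
        generalize (Rmult_le_pos _ _ P (Rlt_le _ _ He)). lra.
      * apply Rmult_le_pos; apply Cmod_ge_0.
      * generalize (Cmod_ge_0 (snd q)). lra.
  - exfalso.
    destruct (poisson_direction (snd p) (snd q) Hp2 Hq2 N) as (w & Ew & Hw).
    set (X := nsq (snd q) * (1 - nsq (snd p)) * nsq (1 - w * snd q)).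
    set (Y := (1 - nsq (snd q)) * nsq (w * snd q - Cconj (snd p) * snd q)).
    assert (EY : Y = nsq (snd q) * ((1 - nsq (snd q)) * nsq (w - Cconj (snd p)))).
    { unfold Y. replace (w * snd q - Cconj (snd p) * snd q)%C with ((w - Cconj (snd p)) * snd q)%C by ring.
      rewrite nsq_mult. ring. }
    assert (Y0 : 0 <= Y) by (apply Rmult_le_pos; [lra | apply nsq_pos]).
    assert (HXY : Y < X).
    { rewrite EY. unfold X. rewrite Rmult_assoc. apply Rmult_lt_compat_l; [exact Q0 | exact Hw]. }
    (* Strictly between [Y / X] and 1: above [Y / X] for feasibility, below 1 so that the product
       decreases. *)
    set (c := (X + Y) / (2 * X)).
    assert (Hc : 0 < c) by (apply Rdiv_lt_0_compat; lra).
    assert (Hc1 : c < 1).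
    { apply Rmult_lt_reg_r with (2 * X); [lra|]. unfold c, Rdiv. rewrite Rmult_assoc, Rinv_l; lra. }
    assert (HcX : Y < c * X).
    { replace (c * X) with ((X + Y) / 2) by (unfold c; field; lra). lra. }
    assert (Em : nsq (w * snd q) = nsq (snd q)) by (rewrite nsq_mult, Ew; ring).
    assert (B := boundary_feasible p q (w * snd q) c Hp1 Hp2 Hq2 Hlt Em Hc
      ltac:(fold Y; unfold X in HcX; lra)).
    assert (Ob : at_right 0 (fun h => 0 < nsq 1 * nsq (w * snd q) - nsq (bump 1 (-1) h) * nsq (bump (w * snd q) c h))).
    { apply (eventually_pos_right _ _ (is_derive_nsq_product 1 (w * snd q) (-1) c)). right.
      rewrite !bump_0, nsq_RtoC, Em. split; [ring|].
      change (fst (RtoC (-1))) with (-1). change (fst (RtoC c)) with c.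
      generalize (Rmult_lt_0_compat _ _ Q0 (proj2 (Rlt_0_minus _ _) Hc1)). lra. }
    destruct (filter_ex (F := at_right 0) _ (filter_and _ _ Ob B)) as (h & K1 & K2 & K3 & K4).
    specialize (M4 _ _ (Rlt_le _ _ K2) (Rlt_le _ _ K3) K4).
    rewrite nsq_RtoC, Em in K1. lra.
Qed.

(** Unequal moduli within each pole are what the boundary case asks for, up to exchanging the
    coordinates or the poles. *)
Lemma approx_eq_generic (p q : C * C) : p <> q -> p <> O2 -> q <> O2 ->
  nsq (fst p) < 1 -> nsq (snd p) < 1 -> nsq (fst q) < 1 -> nsq (snd q) < 1 ->
  nsq (fst p) <> nsq (snd p) -> nsq (fst q) <> nsq (snd q) -> approx_eq p q O2.
Proof.
  intros Hpq Hp Hq Hp1 Hp2 Hq1 Hq2 Np Nq.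
  destruct (minimizer_exists p q) as (l & m & HM); try lra.
  assert (Sw : forall a : C * C, a <> O2 -> swap a <> O2).
  { intros [a1 a2] Ha E. apply Ha. unfold O2, swap in *. now inversion E. }
  assert (Bd : forall p q l m, p <> q -> p <> O2 -> q <> O2 ->
    nsq (fst p) < 1 -> nsq (snd p) < 1 -> nsq (fst q) < 1 -> nsq (snd q) < 1 ->
    nsq (fst q) <> nsq (snd q) -> is_min p q l m -> nsq l = 1 -> approx_eq p q O2).
  { clear -Sw. intros p q l m Hpq Hp Hq Hp1 Hp2 Hq1 Hq2 Nq HM El.
    destruct (Rlt_or_le (nsq (fst q)) (nsq (snd q))) as [L|L].
    - now apply (boundary_minimizer p q l m).
    - apply approx_eq_swap. apply (boundary_minimizer (swap p) (swap q) l m); simpl; auto.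
      + intro E. apply Hpq. rewrite <- (swap_swap p), E. apply swap_swap.
      + lra.
      + now apply is_min_swap. }
  destruct (Req_dec (nsq l) 1) as [El|Nl]; [now apply (Bd p q l m)|].
  destruct (Req_dec (nsq m) 1) as [Em|Nm].
  { apply approx_eq_sym. apply (Bd q p m l); auto. now apply is_min_sym. }
  assert (Hl : nsq l < 1) by (destruct HM as [M1 _]; lra).
  assert (Hm : nsq m < 1) by (destruct HM as (_ & M2 & _); lra).
  assert (M3 : feas2 p q l m) by apply HM.
  intros eps He. exists (Cmod l * Cmod m), (Cmod l * Cmod m).
  split; [now apply interior_minimizer|]. split; [now apply lemp_val_of_feas2 | lra].
Qed.

(** * The general case *)

(** Each of the two equations excludes at most one [d > 1], so one of three candidates is left. *)
Lemma exists_generic_scale (p q : C * C) (e : R) : p <> O2 -> q <> O2 -> 0 < e ->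
  exists d, 1 < d <= 1 + e /\ nsq (d * fst p) <> nsq (snd p) /\ nsq (d * fst q) <> nsq (snd q).
Proof.
  intros Hp Hq He.
  assert (Inj : forall (a : C * C) (d d' : R), a <> O2 -> 1 < d -> 1 < d' ->
    nsq (d * fst a) = nsq (snd a) -> nsq (d' * fst a) = nsq (snd a) -> d = d').
  { intros [a1 a2] d d' Ha Hd Hd' K1 K2. simpl in *. rewrite nsq_mult, nsq_RtoC in K1, K2.
    destruct (Req_dec (nsq a1) 0) as [E|E].
    - exfalso. apply Ha. rewrite E, Rmult_0_r in K1. unfold O2.
      f_equal; apply nsq_eq0; congruence.
    - assert (F : (d - d') * ((d + d') * nsq a1) = 0) by lra.
      apply Rmult_integral in F. destruct F as [F|F]; [lra|].
      apply Rmult_integral in F. destruct F; lra. }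
  set (P := fun d : R => nsq (d * fst p) = nsq (snd p)).
  set (Q := fun d : R => nsq (d * fst q) = nsq (snd q)).
  assert (G : forall d d', 1 < d -> 1 < d' -> d <> d' -> ~ (P d /\ P d') /\ ~ (Q d /\ Q d')).
  { intros d d' Hd Hd' N. split; intros [K1 K2]; apply N; [apply (Inj p) | apply (Inj q)]; assumption. }
  set (d1 := 1 + e). set (d2 := 1 + e / 2). set (d3 := 1 + e / 3).
  destruct (G d1 d2) as [G1 G2]; [unfold d1, d2; lra..|].
  destruct (G d1 d3) as [G3 G4]; [unfold d1, d3; lra..|].
  destruct (G d2 d3) as [G5 G6]; [unfold d2, d3; lra..|].
  apply NNPP. intro K.
  assert (B : forall d, 1 < d <= 1 + e -> P d \/ Q d).
  { intros d Hd. apply NNPP. intro N. apply K. exists d. tauto. }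
  assert (B1 := B d1 ltac:(unfold d1; lra)). assert (B2 := B d2 ltac:(unfold d2; lra)).
  assert (B3 := B d3 ltac:(unfold d3; lra)). tauto.
Qed.

(* Schwarz-Pick for [F (., y)]: the point is close to the zero [(d x, y)] in the hyperbolic metric. *)
Lemma cara_shift_bound (F : C * C -> C) (a : C * C) (d : R) : holo2 F ->
  nsq (snd a) < 1 -> Cmod (fst a) < 1 -> 1 < d <= 1 + (1 - Cmod (fst a)) / 2 ->
  F (RtoC d * fst a, snd a)%C = 0%C ->
  Cmod (F a) <= 2 * (d - 1) / (1 - Cmod (fst a)).
Proof.
  destruct a as [x y]. simpl. intros HF Hy Hx Hd E0.
  assert (Hx2 : nsq x < 1) by now apply nsq_lt1.
  assert (Hy2 : forall z : C, nsq z < 1 -> dif1 (fun _ => y) z /\ nsq y < 1)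
    by (intros z _; split; [apply dif1_const | exact Hy]).
  assert (Hg : holo1 (fun z => F (mob x z, y))).
  { apply (holo2_comp1 F (mob x) (fun _ => y)); [exact HF | now apply holo1_mob | exact Hy2]. }
  assert (P := Cmod_ge_0 x).
  assert (Hdx : Cmod (RtoC d * x) < 1).
  { rewrite Cmod_mult, Cmod_R, Rabs_pos_eq by lra.
    assert (d * Cmod x <= (1 + (1 - Cmod x) / 2) * Cmod x) by (apply Rmult_le_compat_r; lra). nra. }
  assert (Hdx2 : nsq (RtoC d * x) < 1) by now apply nsq_lt1.
  set (b := mob (- x) (RtoC d * x)).
  assert (Hb : nsq b < 1) by (apply mob_lt1; [now rewrite nsq_opp | exact Hdx2]).
  assert (S : Cmod (F (mob x (RtoC 0), y)) <= Cmod b).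
  { apply (schwarz_one_zero (fun z => F (mob x z, y))).
    - intros z Hz. apply nsq_lt1 in Hz. destruct (Hg z Hz) as [D K]. split; [exact D | now apply nsq_lt1].
    - now apply nsq_lt1.
    - unfold b. now rewrite mob_cancel. }
  rewrite mob_0_r in S. eapply Rle_trans; [exact S|].
  assert (Nd : (1 + Cconj (- x) * (RtoC d * x))%C <> 0%C).
  { apply mob_den_neq0. rewrite nsq_opp. apply nsq_mult_lt1; lra. }
  (* The bound on [d] gives [d |x|^2 <= d |x| <= (1 + |x|) / 2]. *)
  assert (L : (1 - Cmod x) / 2 <= Cmod (1 + Cconj (- x) * (RtoC d * x))).
  { assert (T := Cmod_triangle (1 + Cconj (- x) * (RtoC d * x)) (Cconj x * (RtoC d * x))).
    replace (1 + Cconj (- x) * (RtoC d * x) + Cconj x * (RtoC d * x))%C with (RtoC 1) in T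
      by (rewrite Copp_conj; ring).
    rewrite Cmod_1, !Cmod_mult, Cmod_conj, Cmod_R, Rabs_pos_eq in T by lra.
    assert (d * Cmod x <= (1 + (1 - Cmod x) / 2) * Cmod x) by (apply Rmult_le_compat_r; lra).
    assert (Cmod x * (d * Cmod x) <= 1 * (d * Cmod x))
      by (apply Rmult_le_compat_r; [apply Rmult_le_pos; lra | lra]).
    rewrite Cmod_mult, Cmod_R, Rabs_pos_eq in * by lra. nra. }
  unfold b, mob. rewrite Cmod_div by exact Nd.
  replace (- x + RtoC d * x)%C with (RtoC (d - 1) * x)%C by (rewrite RtoC_minus; ring).
  rewrite Cmod_mult, (Cmod_R (d - 1)), Rabs_pos_eq by lra.
  set (D := Cmod (1 + Cconj (- x) * (RtoC d * x))) in *.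
  apply Rmult_le_reg_r with D; [lra|]. unfold Rdiv at 1. rewrite Rmult_assoc, Rinv_l, Rmult_1_r by lra.
  apply Rle_trans with (2 * (d - 1) / (1 - Cmod x) * ((1 - Cmod x) / 2)).
  - replace (2 * (d - 1) / (1 - Cmod x) * ((1 - Cmod x) / 2)) with ((d - 1) * 1) by (field; lra).
    apply Rmult_le_compat_l; lra.
  - apply Rmult_le_compat_l; [|exact L]. apply Rdiv_le_0_compat; lra.
Qed.

Lemma dif2_const (c : C) (a : C * C) : dif2 (fun _ => c) a.
Proof. exact (dif_const CU2 fst snd c a). Qed.

(* Affine interpolation in one coordinate [x] turns small values at [p], [q] into zeros. *)
Lemma cara_correct_coord (x : C * C -> C) (p q : C * C) (F : C * C -> C) (eta : R) :
  (forall a, dif2 x a) -> (forall a, nsq (fst a) < 1 -> nsq (snd a) < 1 -> nsq (x a) < 1) ->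
  nsq (fst p) < 1 -> nsq (snd p) < 1 -> nsq (fst q) < 1 -> nsq (snd q) < 1 -> x p <> x q ->
  holo2 F -> Cmod (F p) <= eta -> Cmod (F q) <= eta ->
  exists r, cara_val p q O2 r /\ Cmod (F O2) <= r + 8 * eta / Cmod (x p - x q).
Proof.
  intros Dx Bx Hp1 Hp2 Hq1 Hq2 Hx HF Ep Eq.
  assert (Nx := Cminus_neq0 _ _ Hx). assert (Px := proj1 (Cmod_gt_0 _) Nx).
  set (dl := Cmod (x p - x q)) in *.
  set (L := fun a => ((F p * (x a - x q) - F q * (x a - x p)) / (x p - x q))%C).
  assert (He : 0 <= eta) by (eapply Rle_trans; [apply Cmod_ge_0 | exact Ep]).
  (* A bound for [L], since [|x a - x q|] and [|x a - x p|] are at most 2. [F - L] vanishes at [p]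
     and [q], and division by [1 + M] brings it back into the disc; the total loss at 0 is at most
     [2 M]. *)
  set (M := 4 * eta / dl).
  assert (HM : 0 <= M) by (apply Rdiv_le_0_compat; lra).
  assert (HL : forall a, nsq (fst a) < 1 -> nsq (snd a) < 1 -> Cmod (L a) <= M).
  { intros a Ha Hb. unfold L. rewrite Cmod_div by exact Nx. fold dl.
    unfold M, Rdiv. apply Rmult_le_compat_r; [left; now apply Rinv_0_lt_compat|].
    assert (B : forall b c, Cmod b < 1 -> Cmod c < 1 -> Cmod (b - c)%C <= 2).
    { intros b c K1 K2. eapply Rle_trans; [apply Cmod_triangle|]. rewrite Cmod_opp. lra. }
    assert (B1 : Cmod (x a - x q)%C <= 2) by (apply B; apply nsq_lt1; now apply Bx).
    assert (B2 : Cmod (x a - x p)%C <= 2) by (apply B; apply nsq_lt1; now apply Bx).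
    eapply Rle_trans; [apply Cmod_triangle|]. rewrite Cmod_opp, !Cmod_mult.
    assert (Cmod (F p) * Cmod (x a - x q) <= eta * 2) by (apply Rmult_le_compat; try apply Cmod_ge_0; assumption).
    assert (Cmod (F q) * Cmod (x a - x p) <= eta * 2) by (apply Rmult_le_compat; try apply Cmod_ge_0; assumption).
    lra. }
  assert (Z : nsq 0 < 1) by (rewrite nsq_RtoC; lra).
  set (G := fun a => ((F a - L a) * / RtoC (1 + M))%C).
  assert (N1 : RtoC (1 + M) <> 0%C) by (intro K; apply RtoC_inj in K; lra).
  assert (MG : forall a, Cmod (G a) = Cmod (F a - L a) / (1 + M)).
  { intro a. unfold G. rewrite Cmod_mult, Cmod_inv, Cmod_R, Rabs_pos_eq by (assumption || lra). reflexivity. }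
  assert (HG : holo2 G).
  { intros a Ha Hb. destruct (HF a Ha Hb) as [DF KF]. split.
    - assert (Cf := contC_fst a). assert (Cs := contC_snd a).
      apply (dif_mult CU2 fst snd (fun a => (F a - L a)%C) (fun _ => (/ RtoC (1 + M))%C)); try assumption;
        [|apply dif2_const].
      apply (dif_minus CU2 fst snd F L); [exact DF|].
      apply (dif_mult CU2 fst snd (fun a => (F p * (x a - x q) - F q * (x a - x p))%C)
        (fun _ => (/ (x p - x q))%C)); try assumption; [|apply dif2_const].
      apply (dif_minus CU2 fst snd (fun a => (F p * (x a - x q))%C) (fun a => (F q * (x a - x p))%C)).
      + apply (dif_mult CU2 fst snd (fun _ => F p) (fun a => (x a - x q)%C)); try assumption; [apply dif2_const|].
        apply (dif_minus CU2 fst snd x (fun _ => x q)); [apply Dx | apply dif2_const].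
      + apply (dif_mult CU2 fst snd (fun _ => F q) (fun a => (x a - x p)%C)); try assumption; [apply dif2_const|].
        apply (dif_minus CU2 fst snd x (fun _ => x p)); [apply Dx | apply dif2_const].
    - apply nsq_lt1. rewrite MG. apply nsq_lt1 in KF.
      apply Rmult_lt_reg_r with (1 + M); [lra|]. unfold Rdiv. rewrite Rmult_assoc, Rinv_l by lra.
      assert (T := Cmod_triangle (F a) (- L a)). rewrite Cmod_opp in T.
      change (Cmod (F a - L a) <= Cmod (F a) + Cmod (L a)) in T.
      generalize (HL a Ha Hb). lra. }
  exists (Cmod (G O2)). split.
  - exists G. split; [exact HG|]. unfold G, L. split; [|split; [|reflexivity]].
    + replace (F p - (F p * (x p - x q) - F q * (x p - x p)) / (x p - x q))%C with (RtoC 0)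
        by (field; exact Nx). ring.
    + replace (F q - (F p * (x q - x q) - F q * (x q - x p)) / (x p - x q))%C with (RtoC 0)
        by (field; exact Nx). ring.
  - rewrite MG. destruct (HF O2 Z Z) as [_ KF]. apply nsq_lt1 in KF.
    assert (T := Cmod_triangle (F O2 - L O2) (L O2)).
    replace (F O2 - L O2 + L O2)%C with (F O2) in T by ring.
    assert (HLO := HL O2 Z Z).
    replace (8 * eta / dl) with (2 * M) by (unfold M; field; lra).
    set (r := Cmod (F O2)) in *. set (s := Cmod (F O2 - L O2)) in *.
    assert (P := Cmod_ge_0 (F O2)). fold r in P.
    apply Rle_trans with ((r - M) / (1 + M) + 2 * M).
    + apply Rmult_le_reg_r with (1 + M); [lra|].
      replace (((r - M) / (1 + M) + 2 * M) * (1 + M)) with (r - M + 2 * M * (1 + M)) by (field; lra).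
      assert (r * M <= 1 * M) by (apply Rmult_le_compat_r; lra).
      generalize (Rmult_le_pos _ _ HM HM). lra.
    + apply Rplus_le_compat_r. unfold Rdiv. apply Rmult_le_compat_r; [left; apply Rinv_0_lt_compat; lra | lra].
Qed.

(** [K] depends only on [p] and [q], through a coordinate in which they differ, so the scale can be
    chosen after it. *)
Lemma cara_correct (p q : C * C) :
  nsq (fst p) < 1 -> nsq (snd p) < 1 -> nsq (fst q) < 1 -> nsq (snd q) < 1 -> p <> q ->
  exists K, 0 < K /\ forall F eta, holo2 F -> Cmod (F p) <= eta -> Cmod (F q) <= eta ->
    exists r, cara_val p q O2 r /\ Cmod (F O2) <= r + K * eta.
Proof.
  intros Hp1 Hp2 Hq1 Hq2 Hpq.
  assert (G : forall x : C * C -> C, (forall a, dif2 x a) ->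
    (forall a, nsq (fst a) < 1 -> nsq (snd a) < 1 -> nsq (x a) < 1) -> x p <> x q ->
    exists K, 0 < K /\ forall F eta, holo2 F -> Cmod (F p) <= eta -> Cmod (F q) <= eta ->
    exists r, cara_val p q O2 r /\ Cmod (F O2) <= r + K * eta).
  { intros x Dx Bx Nx. assert (Px := proj1 (Cmod_gt_0 _) (Cminus_neq0 _ _ Nx)).
    exists (8 / Cmod (x p - x q)). split; [apply Rdiv_lt_0_compat; lra|].
    intros F eta HF Ep Eq.
    replace (8 / Cmod (x p - x q) * eta) with (8 * eta / Cmod (x p - x q)) by (field; lra).
    now apply cara_correct_coord. }
  destruct (Ceq_dec (fst p) (fst q)) as [E|N].
  - apply (G snd).
    + intro a. apply (dif_snd CU2 fst snd).
    + intros a _ Ha. exact Ha.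
    + intro E2. apply Hpq. destruct p, q. simpl in *. now subst.
  - apply (G fst); [|intros a Ha _; exact Ha | exact N].
    intro a. apply (dif_fst CU2 fst snd).
Qed.

Lemma approx_eq_O2 (p q : C * C) : p <> q -> p <> O2 -> q <> O2 ->
  nsq (fst p) < 1 -> nsq (snd p) < 1 -> nsq (fst q) < 1 -> nsq (snd q) < 1 ->
  approx_eq p q O2.
Proof.
  intros Hpq Hp Hq Hp1 Hp2 Hq1 Hq2 eps He.
  destruct (cara_correct p q Hp1 Hp2 Hq1 Hq2 Hpq) as (K & HK & HC).
  assert (A1 := proj1 (nsq_lt1 _) Hp1). assert (A2 := proj1 (nsq_lt1 _) Hq1).
  set (e1 := (1 - Cmod (fst p)) / 2). set (e2 := (1 - Cmod (fst q)) / 2).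
  (* The first bound keeps the scaled poles in the bidisc, the second makes the correction [K * eta]
     at most [eps / 2]. *)
  set (e0 := Rmin (Rmin e1 e2) (eps * Rmin e1 e2 / (2 * K))).
  assert (E1 : 0 < e1) by (unfold e1; lra). assert (E2 : 0 < e2) by (unfold e2; lra).
  assert (E3 : 0 < Rmin e1 e2) by now apply Rmin_pos.
  assert (E4 : 0 < e0).
  { apply Rmin_pos; [exact E3|]. apply Rdiv_lt_0_compat; [now apply Rmult_lt_0_compat | lra]. }
  destruct (exists_generic_scale p q e0 Hp Hq E4) as (d & Hd & Np & Nq).
  assert (L1 : e0 <= Rmin e1 e2) by apply Rmin_l.
  assert (L2 : e0 <= eps * Rmin e1 e2 / (2 * K)) by apply Rmin_r.
  assert (L3 := Rmin_l e1 e2). assert (L4 := Rmin_r e1 e2).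
  assert (Nd : RtoC d <> 0%C) by (intro E; apply RtoC_inj in E; lra).
  assert (Sc : forall x : C, Cmod x < 1 -> d <= 1 + (1 - Cmod x) / 2 -> nsq (RtoC d * x) < 1).
  { intros x Hx Hdx. apply nsq_lt1. rewrite Cmod_mult, Cmod_R, Rabs_pos_eq by lra.
    assert (d * Cmod x <= (1 + (1 - Cmod x) / 2) * Cmod x)
      by (apply Rmult_le_compat_r; [apply Cmod_ge_0 | lra]).
    generalize (Cmod_ge_0 x). nra. }
  set (p' := (RtoC d * fst p, snd p)%C). set (q' := (RtoC d * fst q, snd q)%C).
  assert (Cancel : forall x y : C, (RtoC d * x)%C = (RtoC d * y)%C -> x = y).
  { intros x y E. replace x with (RtoC d * x / RtoC d)%C by (field; exact Nd).
    rewrite E. field. exact Nd. }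
  assert (Hpq' : p' <> q').
  { intro E. apply Hpq. unfold p', q' in E. destruct p, q. simpl in E.
    inversion E as [[F1 F2]]. f_equal. apply Cancel. apply injective_projections; assumption. }
  assert (Hnz : forall a : C * C, a <> O2 -> (RtoC d * fst a, snd a)%C <> O2).
  { intros [a1 a2] Ha E. apply Ha. unfold O2 in *. simpl in E.
    assert (F1 := f_equal fst E). assert (F2 := f_equal snd E). simpl fst in F1. simpl snd in F2.
    f_equal; [|exact F2]. apply Cancel. rewrite F1. ring. }
  assert (S1 : nsq (RtoC d * fst p) < 1) by (apply Sc; [exact A1 | fold e1; lra]).
  assert (S2 : nsq (RtoC d * fst q) < 1) by (apply Sc; [exact A2 | fold e2; lra]).
  destruct (approx_eq_generic p' q' Hpq' (Hnz p Hp) (Hnz q Hq) S1 Hp2 S2 Hq2 Np Nq (eps / 2)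
    ltac:(lra)) as (r & s & (F & HF & Fp & Fq & Fr) & HLs & Hrs).
  set (eta := (d - 1) / Rmin e1 e2).
  assert (Sh : forall a : C * C, nsq (snd a) < 1 -> Cmod (fst a) < 1 ->
    Rmin e1 e2 <= (1 - Cmod (fst a)) / 2 -> F (RtoC d * fst a, snd a)%C = 0%C -> Cmod (F a) <= eta).
  { intros a Ha Hb Hm E.
    eapply Rle_trans; [apply (cara_shift_bound F a d HF Ha Hb); [lra | exact E]|].
    replace (2 * (d - 1) / (1 - Cmod (fst a))) with ((d - 1) / ((1 - Cmod (fst a)) / 2)) by (field; lra).
    unfold eta, Rdiv. apply Rmult_le_compat_l; [lra|].
    apply Rinv_le_contravar; [exact E3 | exact Hm]. }
  destruct (HC F eta HF) as (r' & HC1 & HC2).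
  { apply Sh; [exact Hp2 | exact A1 | exact L3 | exact Fp]. }
  { apply Sh; [exact Hq2 | exact A2 | exact L4 | exact Fq]. }
  exists r', s. split; [exact HC1|]. split.
  - destruct HLs as (f & g & l & m & Hf & Hg & Hl & Hm & K0 & K1 & K2 & Ks).
    exists (fun z => (RtoC (/ d) * f z)%C), g, l, m.
    assert (Id : RtoC (/ d) = (/ RtoC d)%C) by (apply RtoC_inv; lra).
    assert (B0 : forall w x y z : C, (w, x) = (RtoC d * y, z)%C -> ((RtoC (/ d) * w)%C, x) = (y, z)).
    { intros w x y z E. assert (G1 := f_equal fst E). assert (G2 := f_equal snd E).
      simpl fst in G1. simpl snd in G2. rewrite G1, G2, Id. f_equal. field. exact Nd. }
    repeat split; try assumption.
    + destruct (Hf z H) as [D _]. apply dif1_mult; [apply dif1_const | exact D].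
    + destruct (Hf z H) as [_ B]. rewrite nsq_mult, nsq_RtoC.
      assert (Di : 0 < / d < 1).
      { split; [apply Rinv_0_lt_compat; lra|]. rewrite <- Rinv_1. apply Rinv_lt_contravar; lra. }
      assert (Dd : / d * / d <= 1 * 1) by (apply Rmult_le_compat; lra).
      assert (/ d * / d * nsq (f z) <= 1 * nsq (f z))
        by (apply Rmult_le_compat_r; [apply nsq_pos | lra]). lra.
    + now apply Hg.
    + now apply Hg.
    + apply B0. rewrite K0. unfold O2. f_equal. ring.
    + rewrite (surjective_pairing p). now apply B0.
    + rewrite (surjective_pairing q). now apply B0.
  - assert (Ke : K * eta <= eps / 2).
    { unfold eta. apply Rle_trans with (K * ((eps * Rmin e1 e2 / (2 * K)) / Rmin e1 e2)).
      - apply Rmult_le_compat_l; [lra|]. unfold Rdiv at 1 2.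
        apply Rmult_le_compat_r; [left; now apply Rinv_0_lt_compat | unfold Rdiv in L2; lra].
      - apply Req_le. field. split; lra. }
    rewrite Fr in HC2. lra.
Qed.

(** * Reduction to the base point 0 *)

Lemma cara_val_transport (p q z : C * C) (r : R) : nsq (fst z) < 1 -> nsq (snd z) < 1 ->
  cara_val (mob (- fst z) (fst p), mob (- snd z) (snd p))
           (mob (- fst z) (fst q), mob (- snd z) (snd q)) O2 r ->
  cara_val p q z r.
Proof.
  intros H1 H2 (F & HF & E1 & E2 & E3).
  exists (fun a => F (mob (- fst z) (fst a), mob (- snd z) (snd a))).
  split; [|split; [exact E1|split; [exact E2|]]].
  - apply holo2_comp2; [exact HF | apply holo1_mob; now rewrite nsq_opp..].
  - rewrite !mob_opp_self. exact E3.
Qed.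

Lemma lemp_val_transport (p q z : C * C) (s : R) : nsq (fst z) < 1 -> nsq (snd z) < 1 ->
  nsq (fst p) < 1 -> nsq (snd p) < 1 -> nsq (fst q) < 1 -> nsq (snd q) < 1 ->
  lemp_val (mob (- fst z) (fst p), mob (- snd z) (snd p))
           (mob (- fst z) (fst q), mob (- snd z) (snd q)) O2 s ->
  lemp_val p q z s.
Proof.
  intros H1 H2 Hp1 Hp2 Hq1 Hq2 (f & g & l & m & Hf & Hg & Hl & Hm & E0 & E1 & E2 & Es).
  exists (fun x => mob (fst z) (f x)), (fun x => mob (snd z) (g x)), l, m.
  assert (G : forall a b c d : C, (a, b) = (c, d) -> a = c /\ b = d)
    by (intros a b c d E; now inversion E).
  destruct (G _ _ _ _ E0) as [-> ->]. destruct (G _ _ _ _ E1) as [-> ->].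
  destruct (G _ _ _ _ E2) as [-> ->].
  rewrite !mob_0_r, !mob_cancel by assumption. rewrite <- !surjective_pairing.
  repeat (split; [first [assumption | reflexivity | now apply holo1_mob_comp]|]). exact Es.
Qed.

(** Both values are 0 when the base point is a pole: take the zero function on one side and a linear
    disc through [q] with [l = 0] on the other. *)
Lemma approx_eq_at_pole (q : C * C) : nsq (fst q) < 1 -> nsq (snd q) < 1 -> approx_eq O2 q O2.
Proof.
  intros Hq1 Hq2 eps He.
  set (t := Rmax (Cmod (fst q)) (Cmod (snd q))).
  apply nsq_lt1 in Hq1. apply nsq_lt1 in Hq2.
  assert (Ht : t < 1) by now apply Rmax_lub_lt.
  assert (L1 : Cmod (fst q) <= t) by apply Rmax_l. assert (L2 : Cmod (snd q) <= t) by apply Rmax_r.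
  assert (P := Cmod_ge_0 (fst q)).
  (* Any number strictly between the larger modulus [t] and 1 would do. *)
  set (m := (1 + t) / 2). assert (Hm : 0 < m < 1) by (unfold m; lra).
  assert (Nm : RtoC m <> 0%C) by (intro E; apply RtoC_inj in E; lra).
  assert (B : forall x : C, Cmod x <= t -> nsq (x / RtoC m) <= 1).
  { intros x Hx. apply nsq_le1. rewrite Cmod_div, Cmod_R, Rabs_pos_eq by (exact Nm || lra).
    apply Rmult_le_reg_r with m; [lra|]. unfold Rdiv. rewrite Rmult_assoc, Rinv_l by lra.
    unfold m. lra. }
  exists 0, 0. split; [|split; [|lra]].
  - exists (fun _ => RtoC 0). split; [|split; [reflexivity|split; [reflexivity|apply Cmod_0]]].
    intros a _ _. split; [apply dif2_const | rewrite nsq_RtoC; lra].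
  - exists (fun z => (fst q / RtoC m * z)%C), (fun z => (snd q / RtoC m * z)%C), (RtoC 0), (RtoC m).
    rewrite !Cmult_0_r.
    split; [now apply holo1_rot, B|split; [now apply holo1_rot, B|]].
    split; [rewrite nsq_RtoC; lra|].
    split; [apply nsq_lt1; rewrite Cmod_R, Rabs_pos_eq; lra|].
    split; [reflexivity|split; [reflexivity|split]].
    + rewrite (surjective_pairing q) at 3. f_equal; field; exact Nm.
    + rewrite Cmod_0. ring.
Qed.

Lemma approx_eq_all (p q z : C * C) : p <> q ->
  nsq (fst p) < 1 -> nsq (snd p) < 1 -> nsq (fst q) < 1 -> nsq (snd q) < 1 ->
  nsq (fst z) < 1 -> nsq (snd z) < 1 -> approx_eq p q z.
Proof.
  intros Hpq Hp1 Hp2 Hq1 Hq2 Hz1 Hz2.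
  set (p' := (mob (- fst z) (fst p), mob (- snd z) (snd p))).
  set (q' := (mob (- fst z) (fst q), mob (- snd z) (snd q))).
  assert (B : forall a b, nsq a < 1 -> nsq b < 1 -> nsq (mob (- a) b) < 1)
    by (intros a b Ha Hb; apply mob_lt1; [now rewrite nsq_opp | exact Hb]).
  assert (Hpq' : p' <> q').
  { intro E. apply Hpq. assert (E1 := f_equal fst E). assert (E2 := f_equal snd E).
    unfold p', q' in E1, E2. simpl fst in E1. simpl snd in E2.
    rewrite (surjective_pairing p), (surjective_pairing q). f_equal.
    - now rewrite <- (mob_cancel (fst z) (fst p)), E1, mob_cancel.
    - now rewrite <- (mob_cancel (snd z) (snd p)), E2, mob_cancel. }
  assert (H : approx_eq p' q' O2).
  { assert (B1 := B _ _ Hz1 Hp1). assert (B2 := B _ _ Hz2 Hp2).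
    assert (B3 := B _ _ Hz1 Hq1). assert (B4 := B _ _ Hz2 Hq2).
    destruct (excluded_middle_informative (p' = O2)) as [Ep|Np].
    { rewrite Ep. now apply approx_eq_at_pole. }
    destruct (excluded_middle_informative (q' = O2)) as [Eq|Nq].
    { rewrite Eq. apply approx_eq_sym. now apply approx_eq_at_pole. }
    now apply approx_eq_O2. }
  intros eps He. destruct (H eps He) as (r & s & HC & HL & Hrs).
  exists r, s. split; [now apply cara_val_transport|]. split; [now apply lemp_val_transport | exact Hrs].
Qed.

(** * Logarithms and extended real values *)

Lemma cara_set_iff (p q z : C * C) (t : ER) :
  cara_set z p q t <-> exists r, cara_val p q z r /\ t = logE r.
Proof.
  unfold cara_set, cara_val. split.
  - intros (F & HF & E1 & E2 & E3). exists (Cmod (F z)). rewrite <- Cabs_Cmod.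
    split; [|exact E3]. exists F. split; [now apply holo2_iff|].
    split; [exact E1|]. split; [exact E2|]. symmetry. apply Cabs_Cmod.
  - intros (r & (F & HF & E1 & E2 & E3) & ->). exists F. rewrite Cabs_Cmod, E3.
    split; [now apply holo2_iff|]. now repeat split.
Qed.

Lemma lempert_set_iff (p q z : C * C) (t : ER) :
  lempert_set z p q t <-> exists s, lemp_val p q z s /\ t = logE s.
Proof.
  unfold lempert_set, lemp_val, inD. split.
  - intros (psi & l & m & H & Hl & Hm & E0 & E1 & E2 & Et).
    apply holo_D_D2_iff in H. rewrite Cabs_Cmod in Hl, Hm. rewrite !Cabs_Cmod in Et.
    exists (Cmod l * Cmod m). split; [|exact Et].
    exists (fun x => fst (psi x)), (fun x => snd (psi x)), l, m.
    rewrite <- !surjective_pairing. change (RtoC 0) with C0. rewrite !nsq_lt1. tauto.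
  - intros (s & (f & g & l & m & Hf & Hg & Hl & Hm & E0 & E1 & E2 & ->) & ->).
    exists (fun x => (f x, g x)), l, m. rewrite !Cabs_Cmod.
    split; [apply holo_D_D2_iff; now split|]. rewrite <- !nsq_lt1.
    now repeat (split; [assumption|]).
Qed.

Lemma logE_le (x y : R) : 0 <= x -> x <= y -> ER_le (logE x) (logE y).
Proof.
  intros Hx Hxy. unfold logE. destruct (Req_EM_T x 0) as [E|E]; [exact I|].
  destruct (Req_EM_T y 0) as [E'|E']; [exfalso; lra|]. simpl.
  destruct Hxy as [Hxy| ->]; [left; apply ln_increasing; lra | right; reflexivity].
Qed.

Theorem theorem1 :
  forall p q : Cx * Cx, inD2 p -> inD2 q -> p <> q ->
  forall z : Cx * Cx, inD2 z ->
    exists v : ER, cara_is z p q v /\ lempert_is z p q v.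
Proof.
  intros p q [Hp1 Hp2] [Hq1 Hq2] Hpq z [Hz1 Hz2].
  unfold inD in *. rewrite !Cabs_Cmod in *. apply nsq_lt1 in Hp1, Hp2, Hq1, Hq2, Hz1, Hz2.
  assert (H := approx_eq_all p q z Hpq Hp1 Hp2 Hq1 Hq2 Hz1 Hz2).
  assert (HC0 : forall r, cara_val p q z r -> 0 <= r).
  { intros r (F & _ & _ & _ & <-). apply Cmod_ge_0. }
  destruct (H 1 Rlt_0_1) as (r1 & s1 & HC1 & HL1 & _).
  (* [c] is the supremum of the moduli; the common value is its logarithm, which is [MInf] when
     [c = 0]. *)
  destruct (completeness (cara_val p q z)) as [c [U1 U2]].
  { exists s1. intros r Hr. exact (cara_val_le_lemp_val p q z r s1 Hpq Hr HL1). }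
  { exists r1. exact HC1. }
  assert (HCc : forall r, cara_val p q z r -> r <= c) by exact U1.
  assert (HLc : forall s, lemp_val p q z s -> c <= s).
  { intros s Hs. apply U2. intros r Hr. exact (cara_val_le_lemp_val p q z r s Hpq Hr Hs). }
  assert (Hc0 : 0 <= c) by exact (Rle_trans _ _ _ (HC0 r1 HC1) (HCc r1 HC1)).
  exists (logE c). split; split.
  - intros x Hx. apply cara_set_iff in Hx. destruct Hx as (r & Hr & ->).
    apply logE_le; [now apply HC0 | now apply HCc].
  - intros u Hu.
    assert (Hu' : forall r, cara_val p q z r -> ER_le (logE r) u).
    { intros r Hr. apply Hu, cara_set_iff. now exists r. }
    unfold logE at 1. destruct (Req_EM_T c 0) as [E|E]; [exact I|].
    (* A positive modulus is needed to exclude [MInf] as an upper bound. *)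
    assert (Ex : exists r, cara_val p q z r /\ 0 < r).
    { apply NNPP. intro K. apply E. apply Rle_antisym; [|exact Hc0]. apply U2. intros r Hr.
      destruct (Rle_dec r 0) as [L|L]; [exact L|]. exfalso. apply K. exists r. split; [exact Hr | lra]. }
    destruct Ex as (r0 & Hr0 & Pr0).
    destruct u as [b|].
    + simpl. assert (Hb : c <= exp b).
      { apply U2. intros r Hr. destruct (Rle_dec r 0) as [L|L]; [generalize (exp_pos b); lra|].
        specialize (Hu' r Hr). unfold logE in Hu'. destruct (Req_EM_T r 0) as [E'|E']; [lra|]. simpl in Hu'.
        rewrite <- (exp_ln r) by lra. destruct Hu' as [K| ->]; [left; now apply exp_increasing | right; reflexivity]. }
      rewrite <- (ln_exp b). destruct Hb as [K| ->]; [left; apply ln_increasing; lra | right; reflexivity].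
    + specialize (Hu' r0 Hr0). unfold logE in Hu'. destruct (Req_EM_T r0 0); [lra | contradiction].
  - intros x Hx. apply lempert_set_iff in Hx. destruct Hx as (s & Hs & ->).
    apply logE_le; [exact Hc0 | now apply HLc].
  - intros u Hu.
    assert (Hu' : forall s, lemp_val p q z s -> ER_le u (logE s)).
    { intros s Hs. apply Hu, lempert_set_iff. now exists s. }
    destruct u as [b|]; [|exact I].
    (* A finite lower bound [b] rules out discs with [s = 0], and [s < r + e <= c + e] for suitable
       discs. *)
    assert (Hb : exp b <= c).
    { apply le_epsilon. intros e He. destruct (H e He) as (r & s & HCr & HLs & Hrs).
      specialize (Hu' s HLs). unfold logE in Hu'. destruct (Req_EM_T s 0) as [E'|E']; [contradiction|].
      simpl in Hu'. assert (Ps : 0 < s) by (generalize (HLc s HLs); lra).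
      apply Rle_trans with s; [|generalize (HCc r HCr); lra].
      rewrite <- (exp_ln s Ps). destruct Hu' as [K| ->]; [left; now apply exp_increasing | right; reflexivity]. }
    unfold logE. assert (Pb := exp_pos b). destruct (Req_EM_T c 0) as [E'|E']; [lra|]. simpl.
    rewrite <- (ln_exp b). destruct Hb as [K|K]; [left; apply ln_increasing; lra | rewrite K; right; reflexivity].
Qed.
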